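(* For each integer $\kappa\ge0$, $J\ge0$ and $\ell\ge1$, provided $u\ge\ell$, \begin{multline*} K_{\ell}(u,\kappa)=\sum_{m=0}^{\ell}\sum_{n=m}^{\kappa}\sum_{r=0}^{\ell-m}\frac{(-1)^{r}\kappa!\,E_{n,m}}{m!\,(\ell-m-r)!}C_{r,\kappa-n}u^{\kappa-n}\log^{\ell-m-r}u\\ +\sum_{j=1}^{J}\sum_{m=0}^{\ell}\sum_{r=0}^{\ell-m}\frac{(-1)^{r}\kappa!\,E_{\kappa+j,m}}{m!\,(\ell-m-r)!}C_{r}\left(\log^{\ell-m-r}u\right)^{(j)}+O_{\kappa,\ell,J}\!\left(\frac{\log^{\ell}(eu)}{u^{J+1}}\right), \end{multline*} where the implied constant depends only on $\kappa,\ell,J$ (and the sum over $n$ is empty when $m>\kappa$).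
   Context: For integers $\ell\ge1$, $\kappa\ge0$ and real $u>0$, \[ K_{\ell}(u,\kappa):=\frac{1}{\ell!}\int\cdots\int_{\substack{t_{1},\ldots,t_{\ell}\ge1\\ t_{1}+\cdots+t_{\ell}\le u}}\left(u-(t_1+\cdots+t_\ell)\right)^{\kappa}\frac{dt_{1}}{t_{1}}\cdots\frac{dt_{\ell}}{t_{\ell}}. \] The constants $C_{r,\kappa}$ ($r,\kappa\ge0$) are defined by $\sum_{r\ge0}C_{r,\kappa}z^r=e^{\gamma z}/\Gamma(\kappa+1-z)$, $\gamma$ Euler's constant, and $C_r:=C_{r,0}$. The constants $E_{j,m}$ ($j,m\ge0$) are defined by $\sum_{j\ge0}E_{j,m}z^j=\left(\int_0^z\frac{1-e^{-t}}{t}\,dt\right)^m$. The notation $\left(\log^{k}u\right)^{(j)}$ denotes the $j$-th derivative with respect to $u$ of $(\log u)^k$. *)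

(* Defs.v *)
From HB Require Import structures.
From mathcomp Require Import all_boot all_order all_algebra.
From mathcomp Require Import all_classical all_reals all_analysis.
Set Implicit Arguments. Unset Strict Implicit. Unset Printing Implicit Defensive.
Import Order.TTheory GRing.Theory Num.Theory.
Import numFieldNormedType.Exports.
Local Open Scope classical_set_scope.
Local Open Scope ring_scope.

Section Defs.
Variable R : realType.

Definition euler_gamma : R :=
  lim ((\sum_(1 <= k < n.+1) (k%:R : R)^-1 - ln (n%:R : R)) @[n --> \oo]).

Definition Gamma (s : R) : R :=
  Rintegral (@lebesgue_measure R) [set t : R | 0 < t]
    (fun t => t `^ (s - 1) * expR (- t)).

Definition Ccoef (r kappa : nat) : R :=
  (derive1n r (fun z : R => expR (euler_gamma * z) / Gamma (kappa.+1%:R - z)) 0)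
    / (r`!)%:R.

Definition C0coef (r : nat) : R := Ccoef r 0.

Definition Ein (z : R) : R :=
  if 0 <= z then
    Rintegral (@lebesgue_measure R) `[0, z] (fun t => (1 - expR (- t)) / t)
  else
    - Rintegral (@lebesgue_measure R) `[z, 0] (fun t => (1 - expR (- t)) / t).

Definition Ecoef (j m : nat) : R :=
  (derive1n j (fun z : R => Ein z ^+ m) 0) / (j`!)%:R.

(* Kint l kappa u = int...int_{t_1..t_l >= 1, t_1+..+t_l <= u}
     (u - (t_1+..+t_l))^kappa dt_1/t_1 ... dt_l/t_l,
   written as an iterated (Tonelli) integral of a nonnegative function. *)
Fixpoint Kint (l kappa : nat) (u : R) : \bar R :=
  match l with
  | 0 => if 0 <= u then (u ^+ kappa)%:E else 0%E
  | l'.+1 => (\int[@lebesgue_measure R]_(t in [set t : R | 1 <= t])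
               (Kint l' kappa (u - t) * (GRing.inv t)%:E)%E)
  end.

Definition Kfun (l kappa : nat) (u : R) : R := fine (Kint l kappa u) / (l`!)%:R.

End Defs.

(* Main.v *)
(**
Write [K] for [Kfun l kappa] and [M] for the main term of order [N = kappa + J + 1], that is the
finite sum of [kappa! E_{n,m} / m!] times the [n]-th derivatives of
[u^kappa sum_r (-1)^r C_{r,kappa} (log u)^(l-m-r) / (l-m-r)!].

Differentiating the convolution gives the delay equation [u K_{l+1}' = kappa K_{l+1} + K_l(u-1)].
The relation [z Ein' = 1 - e^(-z)], read on the coefficients [E_{n,m}], says that the formal series
behind [M] solves the same equation, the shift by 1 being [e^(-d/du)]; truncation at [N] costs
[O((1 + log u)^l / u^(J+2))]. By induction on [l] the derivative of [(K - M) / u^kappa] is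
[O(u^(-kappa-J-2))], so that [K - M = c u^kappa + O(u^(-J-1))] for some constant [c].

To see that [c = 0], compare Laplace transforms as [s -> 0]. That of [K_l] is
[kappa! E_1(s)^l / (l! s^(kappa+1))] with [E_1(s) = - gamma - log s + O(s^(1/2))], while that of the
leading part of [M] is exactly [kappa! (- gamma - log s)^l / (l! s^(kappa+1))], by the generating
function [e^(gamma z) / Gamma(kappa + 1 - z)] of the [C_{r,kappa}].
*)

Require Import Defs.
From HB Require Import structures.
From mathcomp Require Import all_boot all_order all_algebra.
From mathcomp Require Import all_classical all_reals all_analysis.
From mathcomp Require Import measurable_realfun ring lra.
Set Implicit Arguments.
Unset Strict Implicit.
Unset Printing Implicit Defensive.
Import Order.TTheory GRing.Theory Num.Theory.
Import numFieldNormedType.Exports.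
Local Open Scope ring_scope.
Local Open Scope classical_set_scope.

(** * Derivatives and Taylor coefficients *)

(** Comparing the two equations leaves a multiple of [u^kappa] free, since this is the homogeneous
    solution; a global argument has to exclude it. Only the order [n = 0] of the main term matters
    there: what is left of [K] after removing that order and [c u^kappa] is [O(u^(kappa-1/2))] on
    all of []0, oo[], so its Laplace transform is [O(s^(-kappa-1/2))], whereas that of [c u^kappa]
    is [c kappa! s^(-kappa-1)]. The two displayed sums are one object: [d/du] maps
    [u^(kappa+z)/Gamma(kappa+1+z)] to the same expression with [kappa-1], so that derivatives of
    order up to [kappa] only lower [kappa], and later ones differentiate powers of the logarithm.
    The order is one larger than displayed in order to keep logarithms out of the induction: the
    truncation error [(1 + log u)^l / u^(J+2)] is weakened to [1/u^(J+1)], a bound that survives the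
    integration unchanged. The factor [log^l(eu)] returns only when the order [kappa+J+1] is finally
    removed. *)

Lemma is_derive_derive1 (R : realType) (f : R -> R) (x d : R) :
  is_derive x 1 f d -> f^`() x = d.
Proof. by move=> [_ <-]; rewrite derive1E. Qed.

Lemma derivable_is_derive1 (R : realType) (f : R -> R) (x : R) :
  derivable f x 1 -> is_derive x 1 f (f^`() x).
Proof. by move=> fx; rewrite derive1E; exact: DeriveDef. Qed.

Lemma is_derive_addf (R : realType) (f g : R -> R) (x df dg : R) :
  is_derive x 1 f df -> is_derive x 1 g dg ->
  is_derive x 1 (fun x => f x + g x) (df + dg).
Proof. exact: is_deriveD. Qed.

Lemma is_derive_mulf (R : realType) (f g : R -> R) (x df dg : R) :
  is_derive x 1 f df -> is_derive x 1 g dg ->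
  is_derive x 1 (fun x => f x * g x) (f x * dg + g x * df).
Proof. exact: is_deriveM. Qed.

Lemma is_derive_scalef (R : realType) (f : R -> R) (c x df : R) :
  is_derive x 1 f df -> is_derive x 1 (fun x => c * f x) (c * df).
Proof. exact: is_deriveZ. Qed.

Lemma is_derive_constf (R : realType) (c x : R) : is_derive x 1 (fun=> c) 0.
Proof. exact: is_derive_cst. Qed.

Lemma is_derive_idf (R : realType) (x : R) : is_derive x 1 (fun x => x) 1.
Proof. exact: is_derive_id. Qed.

Lemma is_derive_invf (R : realType) (f : R -> R) (x df : R) : f x != 0 ->
  is_derive x 1 f df -> is_derive x 1 (fun x => (f x)^-1) (- df / f x ^+ 2).
Proof.
move=> fx0 dfx; have := @is_deriveV R f x df 1 fx0 dfx.
by rewrite /GRing.scale/= !mulNr mulrC.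
Qed.

Lemma is_derive_compf (R : realType) (f g : R -> R) (x a b : R) :
  is_derive (g x) 1 f a -> is_derive x 1 g b ->
  is_derive x 1 (fun x => f (g x)) (a * b).
Proof. exact: is_derive1_comp. Qed.

Lemma is_derive_eqd (R : realType) (f : R -> R) (x a b : R) :
  is_derive x 1 f a -> a = b -> is_derive x 1 f b.
Proof. by move=> + <-. Qed.

Lemma near_all (R : realType) (p : R) (P : R -> Prop) :
  (forall x, P x) -> \forall x \near p, P x.
Proof. by move=> Px; apply: filterE. Qed.

Section taylor.
Variable R : realType.
Implicit Types (f g : R -> R) (p : R) (n k : nat).

(** [derive1n] is total, so the rules below must know that its first k iterates are genuine
    derivatives, and on a neighbourhood of p since each is differentiated again. *)
Fixpoint smooth k f p : Prop :=
  if k is k'.+1 then (\forall x \near p, derivable f x 1) /\ smooth k' f^`() p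
  else True.

(** Dividing by [n!] turns the Leibniz rule into a Cauchy product. [Ecoef] and [Ccoef] are such
    coefficients at 0. *)
Definition tcoef n f p : R := derive1n n f p / n`!%:R.

Lemma near_eq_derive1 f g p : (\forall x \near p, f x = g x) ->
  \forall x \near p, f^`() x = g^`() x.
Proof.
move=> /near_join; apply: filterS => x fgx.
by rewrite !derive1E; apply: near_eq_derive => //; exact: oner_neq0.
Qed.

Lemma near_eq_derivable1 f g p : (\forall x \near p, f x = g x) ->
  derivable f p 1 -> derivable g p 1.
Proof. by move=> fg; apply: near_eq_derivable => //; exact: oner_neq0. Qed.

Lemma eq_smooth k f g p : (\forall x \near p, f x = g x) ->
  smooth k f p -> smooth k g p.
Proof.
elim: k f g => [//|k IH] f g fg [df sf]; split; last first.
  exact: IH (near_eq_derive1 fg) sf.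
move/near_join : fg => fg; apply: filterS2 fg df => x.
exact: near_eq_derivable1.
Qed.

Lemma derive1Sn n f : derive1n n.+1 f = derive1n n f^`().
Proof. exact: iterSr. Qed.

Lemma eq_derive1n n f g p : (\forall x \near p, f x = g x) ->
  derive1n n f p = derive1n n g p.
Proof.
elim: n f g => [|n IH] f g fg; first exact: (nbhs_singleton fg).
by rewrite !derive1Sn; apply: IH; exact: near_eq_derive1.
Qed.

Lemma eq_tcoef n f g p : (\forall x \near p, f x = g x) ->
  tcoef n f p = tcoef n g p.
Proof. by move=> fg; rewrite /tcoef (eq_derive1n n fg). Qed.

Lemma tcoef0 f p : tcoef 0 f p = f p.
Proof. by rewrite /tcoef derive1n0 fact0 divr1. Qed.

Lemma tcoefS n f p : n.+1%:R * tcoef n.+1 f p = tcoef n f^`() p.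
Proof.
rewrite /tcoef derive1Sn factS natrM invfM.
by rewrite mulrA [n.+1%:R * _]mulrC -mulrA mulrA mulrA mulfK ?pnatr_eq0.
Qed.

Lemma smoothW k f p : smooth k.+1 f p -> smooth k f p.
Proof. by elim: k f => [//|k IH] f [df sf]; split => //; exact: IH. Qed.

Lemma smoothD k f g p : smooth k f p -> smooth k g p ->
  smooth k (fun x => f x + g x) p.
Proof.
elim: k f g => [//|k IH] f g [df sf] [dg sg]; split.
  by apply: filterS2 df dg => x; exact: derivableD.
apply: eq_smooth (IH _ _ sf sg).
apply: filterS2 df dg => x /derivable_is_derive1 dfx /derivable_is_derive1 dgx.
exact/esym/(is_derive_derive1 (is_derive_addf dfx dgx)).
Qed.

Lemma smoothM k f g p : smooth k f p -> smooth k g p ->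
  smooth k (fun x => f x * g x) p.
Proof.
elim: k f g => [//|k IH] f g sf sg.
have [[df sf'] [dg sg']] := (sf, sg).
split; first by apply: filterS2 df dg => x; exact: derivableM.
apply: eq_smooth (smoothD (IH _ _ (smoothW sf) sg')
                                  (IH _ _ (smoothW sg) sf')).
apply: filterS2 df dg => x /derivable_is_derive1 dfx /derivable_is_derive1 dgx.
exact/esym/(is_derive_derive1 (is_derive_mulf dfx dgx)).
Qed.

Lemma smooth_cst k (c : R) p : smooth k (fun=> c) p.
Proof.
elim: k c => [//|k IH] c; split; first by apply: near_all => x; exact: derivable_cst.
apply: eq_smooth (IH 0); apply: near_all => x.
exact/esym/(is_derive_derive1 (is_derive_constf _ x)).
Qed.

Lemma smooth_id k p : smooth k (fun x => x) p.
Proof.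
case: k => [//|k]; split; first by apply: near_all => x; exact: derivable_id.
apply: eq_smooth (smooth_cst k 1 p); apply: near_all => x.
exact/esym/(is_derive_derive1 (is_derive_idf x)).
Qed.

Lemma smoothX k f n p : smooth k f p -> smooth k (fun x => f x ^+ n) p.
Proof.
move=> sf; elim: n => [|n IH].
  by under eq_fun do rewrite expr0; exact: smooth_cst.
by under eq_fun do rewrite exprS; exact: smoothM.
Qed.

Lemma smoothV k f p : (\forall x \near p, f x != 0) -> smooth k f p ->
  smooth k (fun x => (f x)^-1) p.
Proof.
move=> f0; elim: k => [//|k IH] sf; have [df sf'] := sf.
have sV := IH (smoothW sf).
split.
  by apply: filterS2 f0 df => x fx0 dfx; exact: derivableV.
have := smoothM (smooth_cst k (-1) p) (smoothM (smoothX 2 sV) sf').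
apply: eq_smooth; apply: filterS2 f0 df => x fx0 /derivable_is_derive1 dfx.
apply/esym/(is_derive_derive1 (is_derive_eqd (is_derive_invf fx0 dfx) _)).
by rewrite exprVn mulN1r mulNr mulrC.
Qed.

Lemma is_derive_expRZ (a x : R) :
  is_derive x 1 (fun x => expR (a * x)) (a * expR (a * x)).
Proof.
have := is_derive_compf (is_derive_expR (a * x))
  (is_derive_scalef a (is_derive_idf x)).
by rewrite mulr1 mulrC.
Qed.

Lemma smooth_expR k (a : R) p : smooth k (fun x => expR (a * x)) p.
Proof.
elim: k => [//|k IH]; split.
  by apply: near_all => x; have [] := is_derive_expRZ a x.
apply: eq_smooth (smoothM (smooth_cst k a p) IH); apply: near_all => x.
exact/esym/(is_derive_derive1 (is_derive_expRZ a x)).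
Qed.

Lemma tcoefD n f g p : smooth n f p -> smooth n g p ->
  tcoef n (fun x => f x + g x) p = tcoef n f p + tcoef n g p.
Proof.
elim: n f g => [|n IH] f g sf sg; first by rewrite !tcoef0.
apply: (@mulfI _ n.+1%:R); first by rewrite pnatr_eq0.
move: sf sg => [df sf] [dg sg]; rewrite mulrDr !tcoefS -(IH _ _ sf sg).
apply: eq_tcoef.
apply: filterS2 df dg => x /derivable_is_derive1 dfx /derivable_is_derive1 dgx.
exact: (is_derive_derive1 (is_derive_addf dfx dgx)).
Qed.

Lemma tcoef_cst n (c : R) p : tcoef n (fun=> c) p = c *+ (n == 0)%N.
Proof.
case: n => [|n]; first by rewrite tcoef0.
apply: (@mulfI _ n.+1%:R); first by rewrite pnatr_eq0.
rewrite tcoefS mulr0n mulr0 (@eq_tcoef _ _ (fun=> 0)); last first.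
  by apply: near_all => x; exact: (is_derive_derive1 (is_derive_constf _ x)).
elim: n => [|n IH]; first by rewrite tcoef0.
apply: (@mulfI _ n.+1%:R); first by rewrite pnatr_eq0.
rewrite tcoefS (@eq_tcoef _ _ (fun=> 0)) ?IH ?mulr0//.
by apply: near_all => x; exact: (is_derive_derive1 (is_derive_constf _ x)).
Qed.

(** The Leibniz rule on coefficients: split [n+1 = (n+1-i) + i] in each term. *)
Lemma cauchy_productS (a b : nat -> R) n :
  n.+1%:R * (\sum_(i < n.+2) a i * b (n.+1 - i)%N) =
  \sum_(i < n.+1) a i * ((n - i).+1%:R * b (n - i).+1)
  + \sum_(i < n.+1) (i.+1%:R * a i.+1) * b (n - i)%N.
Proof.
have -> : n.+1%:R * (\sum_(i < n.+2) a i * b (n.+1 - i)%N) =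
   \sum_(i < n.+2) (a i * ((n.+1 - i)%N%:R * b (n.+1 - i)%N) + i%:R * a i * b (n.+1 - i)%N).
  rewrite mulr_sumr; apply: eq_bigr => i _.
  have -> : n.+1%:R = (n.+1 - i)%N%:R + i%:R :> R.
    by rewrite -natrD subnK// -ltnS.
  ring.
rewrite big_split/= [X in X + _]big_ord_recr [X in _ + X]big_ord_recl/=.
rewrite subnn !mul0r mulr0 addr0 add0r; congr (_ + _).
  by apply: eq_bigr => i _; rewrite subSn// -ltnS.
Qed.

Lemma tcoefM n f g p : smooth n f p -> smooth n g p ->
  tcoef n (fun x => f x * g x) p =
  \sum_(i < n.+1) tcoef i f p * tcoef (n - i) g p.
Proof.
elim: n f g => [|n IH] f g sf sg; first by rewrite big_ord1 !tcoef0.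
apply: (@mulfI _ n.+1%:R); first by rewrite pnatr_eq0.
rewrite (cauchy_productS (fun i => tcoef i f p) (fun i => tcoef i g p)) tcoefS.
move: (sf) (sg) => [df sf'] [dg sg'].
rewrite (@eq_tcoef _ _ (fun x => f x * derive1 g x + g x * derive1 f x)); last first.
  apply: filterS2 df dg => x /derivable_is_derive1 dfx /derivable_is_derive1 dgx.
  exact: (is_derive_derive1 (is_derive_mulf dfx dgx)).
rewrite tcoefD; last 2 first.
  by apply: smoothM => //; exact: smoothW.
  by apply: smoothM => //; exact: smoothW.
rewrite IH//; last exact: smoothW.
rewrite IH//; last exact: smoothW.
congr (_ + _); first by apply: eq_bigr => i _; rewrite tcoefS.
rewrite (reindex_inj rev_ord_inj)/=; apply: eq_bigr => i _.
by rewrite subSS subKn ?tcoefS 1?mulrC// -ltnS.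
Qed.

Lemma tcoefZ n c f p : smooth n f p ->
  tcoef n (fun x => c * f x) p = c * tcoef n f p.
Proof.
move=> sf; rewrite tcoefM//; last exact: smooth_cst.
rewrite big_ord_recl big1/=.
  by rewrite tcoef_cst subn0 addr0.
by move=> i _; rewrite tcoef_cst mul0r.
Qed.

Lemma tcoef_id n p : tcoef n (fun x => x) p = p *+ (n == 0)%N + (n == 1)%N%:R.
Proof.
case: n => [|n]; first by rewrite tcoef0 addr0.
apply: (@mulfI _ n.+1%:R); first by rewrite pnatr_eq0.
rewrite tcoefS (@eq_tcoef _ _ (fun=> 1)).
  by rewrite tcoef_cst add0r; case: n => [|n]; rewrite ?mulr1// !mulr0n mulr0.
by apply: near_all => x; exact: (is_derive_derive1 (is_derive_idf x)).
Qed.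

Lemma tcoef_idM n f : smooth n f 0 ->
  tcoef n (fun z => z * f z) 0 = if n is n'.+1 then tcoef n' f 0 else 0.
Proof.
move=> sf; rewrite tcoefM//; last exact: smooth_id.
rewrite big_ord_recl tcoef_id mulr0n add0r mul0r add0r.
case: n sf => [|n] sf; first by rewrite big_ord0.
rewrite big_ord_recl big1 ?addr0 => [|i _]; last by rewrite tcoef_id mulr0n add0r mul0r.
by rewrite tcoef_id mulr0n add0r mul1r subSS subn0.
Qed.

Lemma tcoef_expR n (a : R) : tcoef n (fun x => expR (a * x)) 0 = a ^+ n / n`!%:R.
Proof.
elim: n => [|n IH]; first by rewrite tcoef0 mulr0 expR0 expr0 fact0 divr1.
apply: (@mulfI _ n.+1%:R); first by rewrite pnatr_eq0.
rewrite tcoefS (@eq_tcoef _ _ (fun x => a * expR (a * x))); last first.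
  by apply: near_all => x; exact: (is_derive_derive1 (is_derive_expRZ a x)).
rewrite tcoefZ ?IH; last exact: smooth_expR.
rewrite factS natrM exprS; field.
by rewrite -[1 + _]/(1%:R + _) -natrD !pnatr_eq0 -lt0n fact_gt0.
Qed.

(** An explicit family of successive derivatives near p yields smoothness and the value of
    [derive1n] together. It serves for power series, for Laplace transforms as functions of the
    exponent, and for powers of the logarithm. *)
Lemma tower_smooth (F : nat -> R -> R) p :
  (forall n, \forall x \near p, is_derive (x : R) 1 (F n) (F n.+1 x)) ->
  forall k, smooth k (F 0%N) p /\ derive1n k (F 0%N) p = F k p.
Proof.
move=> dF k; elim: k F dF => [//|k IH] F dF.
have dF0 : \forall x \near p, F 1%N x = (F 0%N)^`() x.
  by apply: filterS (dF 0%N) => x dFx; exact/esym/(is_derive_derive1 dFx).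
have [sF1 F1k] := IH (fun n => F n.+1) (fun n => dF n.+1).
split; last by rewrite derive1Sn -F1k; apply/esym/eq_derive1n.
split; last exact: eq_smooth sF1.
by apply: filterS (dF 0%N) => x [].
Qed.

End taylor.

Lemma is_derive_expf (R : realType) (f : R -> R) n (x df : R) :
  is_derive x 1 f df ->
  is_derive x 1 (fun x => f x ^+ n.+1) (n.+1%:R * (f x ^+ n * df)).
Proof.
move=> dfx; elim: n => [|n IH].
  by rewrite expr0 !mul1r; apply: is_derive_eqd dfx _.
rewrite (_ : (fun y => _) = (fun y => f y * f y ^+ n.+1)); last first.
  by apply/funext => y; rewrite exprS.
by apply: is_derive_eqd (is_derive_mulf dfx IH) _; rewrite exprS -natr1; ring.
Qed.

(** * The coefficients of the powers of Ein *)

Section ein.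
Variable R : realType.
Notation mu := (@lebesgue_measure R).

(** The bound is stable under termwise differentiation and gives convergence everywhere by
    comparison with the exponential series, so no radius of convergence has to be discussed. *)
Definition fact_bounded (c : nat -> R) := forall i, `|c i| <= i`!%:R^-1.

Definition psum (c : nat -> R) (x : R) : R := limn (pseries c x).

Lemma is_cvg_psum (c : nat -> R) (x : R) : fact_bounded c -> cvgn (pseries c x).
Proof.
move=> cb; apply: normed_cvg.
apply: series_le_cvg (is_cvg_series_exp_coeff `|x|) => [n|n|n].
- exact: normr_ge0.
- by rewrite exp_coeff_ge0.
- by rewrite /exp_coeff /= normrM normrX mulrC ler_wpM2l// exprn_ge0.
Qed.

Lemma fact_bounded_diffs (c : nat -> R) :
  fact_bounded c -> fact_bounded (pseries_diffs c).
Proof.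
move=> cb i; rewrite /pseries_diffs normrM normr_nat.
rewrite -ler_pdivlMl ?ltr0n// -invfM -natrM.
exact: cb.
Qed.

Lemma is_derive_psum (c : nat -> R) (x : R) : fact_bounded c ->
  is_derive x 1 (psum c) (psum (pseries_diffs c) x).
Proof.
move=> cb; apply: (@pseries_snd_diffs R c (`|x| + 1)).
- exact: is_cvg_psum.
- exact/is_cvg_psum/fact_bounded_diffs.
- exact/is_cvg_psum/fact_bounded_diffs/fact_bounded_diffs.
- by rewrite [ltRHS]ger0_norm ?ltrDl// addr_ge0.
Qed.

Lemma smooth_psum k (c : nat -> R) p : fact_bounded c -> smooth k (psum c) p.
Proof.
move=> cb.
have itb n : fact_bounded (iter n (@pseries_diffs R) c).
  by elim: n => // n; exact: fact_bounded_diffs.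
have [] := @tower_smooth R (fun n => psum (iter n (@pseries_diffs R) c)) p _ k => //.
by move=> n; apply: near_all => x; exact/is_derive_psum.
Qed.

Lemma continuous_is_derive (f df : R -> R) : (forall x : R, is_derive x 1 f (df x)) ->
  continuous f.
Proof.
move=> dF x; apply: differentiable_continuous; apply/derivable1_diffP.
by have [] := dF x.
Qed.

Lemma continuous_psum (c : nat -> R) : fact_bounded c -> continuous (psum c).
Proof.
move=> cb; apply: (@continuous_is_derive _ (psum (pseries_diffs c))) => x.
exact: is_derive_psum.
Qed.

Lemma integral_is_derive (f F : R -> R) (a b : R) : a < b ->
  (forall x : R, is_derive x 1 F (f x)) -> continuous f ->
  (\int[mu]_(x in `[a, b]) (f x)%:E = (F b)%:E - (F a)%:E)%E.
Proof.
move=> ab dF cf; have cF := continuous_is_derive dF.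
apply: continuous_FTC2 => //.
- exact: continuous_subspaceT.
- split.
  + by move=> x _; have [] := dF x.
  + exact: cvg_at_right_filter (cF a).
  + exact: cvg_at_left_filter (cF b).
- by move=> x _; exact: is_derive_derive1.
Qed.

(** Termwise integration of [(1 - e^(-t))/t = sum_i (-t)^i/(i+1)!]; the last factor removes the
    constant term. *)
Definition ein_coef (i : nat) : R := (-1) ^+ i.-1 / (i * i`!)%:R *+ (i != 0)%N.

Lemma fact_bounded_ein_coef : fact_bounded ein_coef.
Proof.
case=> [|i]; first by rewrite /ein_coef mulr0n normr0 invr_ge0.
rewrite /ein_coef mulr1n normrM normrX normrN1 expr1n mul1r ger0_norm ?invr_ge0//.
by rewrite lef_pV2 ?posrE ?ltr0n ?muln_gt0 ?fact_gt0//= ler_nat leq_pmull.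
Qed.

Lemma ein_coef_diffs i : pseries_diffs ein_coef i = (-1) ^+ i / (i.+1)`!%:R.
Proof.
rewrite /pseries_diffs /ein_coef /= mulr1n natrM invfM mulrCA; congr (_ * _).
by rewrite mulVKf// pnatr_eq0.
Qed.

Definition dein : R -> R := psum (pseries_diffs ein_coef).

Lemma mulr_dein (z : R) : z * dein z = 1 - expR (- z).
Proof.
have -> : z * dein z = limn (fun n => z * pseries (pseries_diffs ein_coef) z n).
  rewrite limZl_tmp//.
  exact/is_cvg_psum/fact_bounded_diffs/fact_bounded_ein_coef.
rewrite /expR; apply/cvg_lim => //.
(* Multiplication by z turns a partial sum into 1 minus the partial sum of [exp(-z)] with one more
   term. *)
have -> : (fun n => z * pseries (pseries_diffs ein_coef) z n) =
   (fun n => 1 - series (exp_coeff (- z)) n.+1).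
  apply/funext => n; rewrite /pseries /series/= big_nat_recl//= /exp_coeff /=.
  rewrite expr0 fact0 divr1 opprD addNKr mulr_sumr -sumrN.
  apply: eq_bigr => i _; rewrite ein_coef_diffs.
  by rewrite [in RHS]exprNn exprS exprS; ring.
apply: cvgB; first exact: cvg_cst.
rewrite (@cvg_shiftS _ (series (exp_coeff (- z)))).
exact: is_cvg_series_exp_coeff.
Qed.

(** At [t = 0] the integrand of [Ein] is 0 by the convention on division, while the continuous
    [dein] takes the value 1; the endpoint 0 is therefore dropped before the two are compared, and
    put back for the fundamental theorem of calculus. *)
Lemma EinE : @Ein R = psum ein_coef.
Proof.
have cd : continuous dein.
  exact/continuous_psum/fact_bounded_diffs/fact_bounded_ein_coef.
have dP (x : R) : is_derive x 1 (psum ein_coef) (dein x).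
  exact: is_derive_psum fact_bounded_ein_coef.
have P0 : psum ein_coef 0 = 0.
  apply/cvg_lim => //; rewrite (_ : pseries _ _ = fun=> 0); first exact: cvg_cst.
  apply/funext => n; rewrite /pseries /series/= big1// => -[|i] _.
    by rewrite /ein_coef mulr0n mul0r.
  by rewrite exprS mul0r mulr0.
have deinE x : x != 0 -> (1 - expR (- x)) / x = dein x.
  by move=> x0; rewrite -mulr_dein mulrC mulKf.
have md (A : set R) : measurable A ->
    measurable_fun A (EFin \o dein).
  move=> mA; apply: measurable_funTS; apply/measurable_EFinP.
  exact: continuous_measurable_fun.
apply/funext => z; rewrite /Ein; case: ifPn => [z0|].
  have [->|zn0] := eqVneq z 0; first by rewrite set_itv1 Rintegral_set1 P0.
  have zp : 0 < z by rewrite lt_neqAle eq_sym zn0.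
  have eqd : {in `]0, z]%classic, forall x, (dein x)%:E = ((1 - expR (- x)) / x)%:E}.
    by move=> x /[!inE]/=; rewrite in_itv/= => /andP[x0 _]; rewrite deinE// gt_eqF.
  rewrite /Rintegral -integral_itv_obnd_cbnd; last first.
    exact: eq_measurable_fun (md _ _).
  have -> : (\int[mu]_(x in `]0%R, z]%classic) ((1 - expR (- x)) / x)%:E =
            \int[mu]_(x in `]0%R, z]%classic) (dein x)%:E)%E.
    by apply: eq_integral => x /eqd ->.
  rewrite integral_itv_obnd_cbnd; last exact: md.
  by rewrite (integral_is_derive zp dP cd) P0 sube0.
rewrite -ltNge => zn.
have eqd : {in `[z, 0[%classic, forall x, (dein x)%:E = ((1 - expR (- x)) / x)%:E}.
  by move=> x /[!inE]/=; rewrite in_itv/= => /andP[_ x0]; rewrite deinE// lt_eqF.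
rewrite /Rintegral -integral_itv_bndo_bndc; last first.
  exact: eq_measurable_fun (md _ _).
have -> : (\int[mu]_(x in `[z, 0%R[%classic) ((1 - expR (- x)) / x)%:E =
            \int[mu]_(x in `[z, 0%R[%classic) (dein x)%:E)%E.
    by apply: eq_integral => x /eqd ->.
  rewrite integral_itv_bndo_bndc; last exact: md.
by rewrite (integral_is_derive zn dP cd) P0 sub0e/= opprK.
Qed.

Lemma EcoefE j m : Ecoef R j m = tcoef j (fun z => psum ein_coef z ^+ m) 0.
Proof. by rewrite /Ecoef EinE. Qed.

Lemma Ecoef_m0 j : Ecoef R j 0 = (j == 0)%N%:R.
Proof.
rewrite EcoefE (@eq_tcoef _ _ _ (fun=> 1)) ?tcoef_cst//.
by apply: near_all => x; rewrite expr0.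
Qed.

Lemma Ecoef_0m m : Ecoef R 0 m.+1 = 0.
Proof.
by rewrite EcoefE tcoef0 -EinE /Ein lexx set_itv1 Rintegral_set1 expr0n.
Qed.

(** Coefficient of [z^n] in [z (Ein^(m+1))' = (m+1) Ein^m (1 - e^(-z))]. *)
Lemma EcoefS n m : n%:R * Ecoef R n m.+1 =
  m.+1%:R * (Ecoef R n m - \sum_(i < n.+1) Ecoef R i m * ((-1) ^+ (n - i) / (n - i)`!%:R)).
Proof.
have sP k : smooth k (psum ein_coef) 0.
  exact: smooth_psum fact_bounded_ein_coef.
pose F m z := psum ein_coef z ^+ m.
have dF x : (F m.+1)^`() x = m.+1%:R * (dein x * F m x).
  apply: is_derive_derive1; rewrite [dein x * _]mulrC.
  exact/is_derive_expf/is_derive_psum/fact_bounded_ein_coef.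
have sF k : smooth k (F m.+1)^`() 0 by have [] := smoothX m.+1 (sP k.+1).
transitivity (tcoef n (fun z => z * derive1 (F m.+1) z) 0).
  rewrite tcoef_idM// EcoefE; case: n => [|n]; first by rewrite mul0r.
  by rewrite tcoefS.
rewrite (@eq_tcoef _ _ _ (fun z => m.+1%:R * (F m z + -1 * (F m z * expR (-1 * z))))).
  have sFm : smooth n (F m) 0 by exact: smoothX.
  have sFe : smooth n (fun z => F m z * expR (-1 * z)) 0.
    by apply: smoothM => //; exact: smooth_expR.
  rewrite tcoefZ; last by apply: smoothD => //; apply: smoothM => //; exact: smooth_cst.
  rewrite tcoefD//; last by apply: smoothM => //; exact: smooth_cst.
  rewrite tcoefZ// tcoefM//; last exact: smooth_expR.
  rewrite mulN1r EcoefE; congr (_ * (_ - _)).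
  by apply: eq_bigr => i _; rewrite EcoefE tcoef_expR.
apply: near_all => x; rewrite dF mulrCA (mulrA x) mulr_dein (mulN1r x); ring.
Qed.

(** [Ein^m] vanishes to order m at 0; this is why the sum over n in the theorem starts at m. *)
Lemma Ecoef_lt n m : (n < m)%N -> Ecoef R n m = 0.
Proof.
elim: m n => [//|m IH] n nm; case: n nm => [_|n nm]; first exact: Ecoef_0m.
apply: (@mulfI _ n.+1%:R); first by rewrite pnatr_eq0.
rewrite EcoefS mulr0 big_ord_recr/= subnn fact0 expr0 divr1 mulr1 big1 ?add0r ?subrr ?mulr0//.
by move=> i _; rewrite IH ?mul0r// (leq_trans (ltn_ord i)).
Qed.

End ein.

(** * Laplace transforms of powers and logarithms *)

Section change_of_variables.
Variable R : realType.
Notation mu := (@lebesgue_measure R).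
Local Open Scope ereal_scope.

Notation pushforward_measure :=
  measure_function_pushforward__canonical__measure_function_Measure.

Definition homothety (s : R) : measurableTypeR R -> measurableTypeR R :=
  fun x => (s * x)%R.

Lemma measurable_homothety (s : R) : measurable_fun setT (homothety s).
Proof. exact: measurable_funM. Qed.

Definition translation (a : R) : measurableTypeR R -> measurableTypeR R :=
  fun x => (x + a)%R.

Lemma measurable_translation (a : R) : measurable_fun setT (translation a).
Proof. exact: measurable_funD. Qed.

Lemma lebesgue_measure_homothety (s : R) (s0 : (0 < s)%R) (A : set R) :
  measurable A ->
  mscale (NngNum (ltW s0)) (pushforward_measure mu (measurable_homothety s)) A = mu A.
Proof.
move=> mA; apply/esym/lebesgue_measure_unique => //= _ [[a b]] _ <-.
rewrite /mscale/=.
have -> : pushforward mu (homothety s) `]a, b] = mu `](a / s)%R, (b / s)%R].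
  by congr (mu _); apply/seteqP; split => x /=;
    rewrite !in_itv/= ltr_pdivrMr// ler_pdivlMr// /homothety [(x * s)%R]mulrC.
rewrite !lebesgue_measure_itv/= !lte_fin ltr_pM2r ?invr_gt0//.
case: ifPn => _; last by rewrite mule0.
by rewrite -!EFinB -EFinM -mulrBl mulrC divfK ?gt_eqF.
Qed.

Lemma ge0_integral_mulr (s : R) (D : set R) (f : R -> \bar R) : (0 < s)%R ->
  measurable D -> measurable_fun D f -> (forall x, D x -> 0 <= f x) ->
  \int[mu]_(x in D) f x =
  s%:E * \int[mu]_(x in (fun x => (s * x)%R) @^-1` D) f (s * x)%R.
Proof.
move=> s0 mD mf f0.
transitivity (s%:E * \int[pushforward mu (homothety s)]_(x in D) f x).
  have := @ge0_integral_mscale _ _ _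
    (pushforward_measure mu (measurable_homothety s)) D mD (NngNum (ltW s0)) f mf f0.
  move=> /= <-.
  by apply: eq_measure_integral => A mA _; exact/esym/lebesgue_measure_homothety.
rewrite (@ge0_integral_pushforward _ _ _ _ R _ (measurable_homothety s) mu D f)//.
by move=> x; rewrite inE; exact: f0.
Qed.

Lemma lebesgue_measure_translation (a : R) (A : set R) : measurable A ->
  pushforward_measure mu (measurable_translation a) A = mu A.
Proof.
move=> mA; apply/esym/lebesgue_measure_unique => //= _ [[b c]] _ <-.
have -> : pushforward mu (translation a) `]b, c] = mu `](b - a)%R, (c - a)%R].
  by congr (mu _); apply/seteqP; split => x /=; rewrite !in_itv/= ltrBlDr lerBrDr.
rewrite !lebesgue_measure_itv/= !lte_fin ltrD2r.
by case: ifPn => // _; rewrite -!EFinB opprB addrA subrK.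
Qed.

Lemma ge0_integral_addr (a : R) (f : R -> \bar R) :
  measurable_fun setT f -> (forall x, 0 <= f x) ->
  \int[mu]_x f (x + a)%R = \int[mu]_x f x.
Proof.
move=> mf f0.
transitivity (\int[pushforward_measure mu (measurable_translation a)]_x f x).
  rewrite (@ge0_integral_pushforward _ _ _ _ R _ (measurable_translation a) mu setT f)//.
by apply: eq_measure_integral => A mA _; exact: lebesgue_measure_translation.
Qed.

(** The integrand is extended by 0 outside the rectangle, so that measurability and sign are only
    required on it. *)
Lemma tonelli_rect (A B : set R) (f : R -> R -> \bar R) :
  measurable A -> measurable B ->
  measurable_fun (A `*` B) (fun z => f z.1 z.2) ->
  (forall x y, A x -> B y -> 0 <= f x y) ->
  \int[mu]_(x in A) \int[mu]_(y in B) f x y =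
  \int[mu]_(y in B) \int[mu]_(x in A) f x y.
Proof.
move=> mA mB mf f0.
pose g := (fun z : R * R => f z.1 z.2) \_ (A `*` B).
have mg : measurable_fun setT g.
  by apply/(measurable_restrictT _ _).1 => //; exact: measurableX.
have g0 z : 0 <= g z.
  rewrite /g patchE; case: ifPn => //; rewrite inE => -[/= Az Bz]; exact: f0.
rewrite integral_mkcond [RHS]integral_mkcond.
have gE x y : g (x, y) = if (x \in A) && (y \in B) then f x y else 0.
  by rewrite /g patchE in_setX.
transitivity (\int[mu]_x \int[mu]_y g (x, y)).
  apply: eq_integral => x _; rewrite patchE; case: ifPn => xA.
    rewrite [LHS]integral_mkcond; apply: eq_integral => y _.
    by rewrite gE patchE xA.
  by rewrite integral0_eq// => y _; rewrite gE (negbTE xA).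
rewrite fubini_tonelli//.
apply: eq_integral => y _; rewrite patchE; case: ifPn => yB.
  rewrite [RHS]integral_mkcond; apply: eq_integral => x _.
  by rewrite gE patchE yB andbT.
by rewrite integral0_eq// => x _; rewrite gE (negbTE yB) andbF.
Qed.

End change_of_variables.

(** * The Gamma integral and its derivatives in the exponent *)

Section lap.
Variable R : realType.
Notation mu := (@lebesgue_measure R).

Lemma powRE (t a : R) : 0 < t -> t `^ a = expR (a * ln t).
Proof. by move=> t0; rewrite /powR gt_eqF. Qed.

Lemma powR_derive (t y : R) : 0 < t ->
  is_derive y 1 (fun y => t `^ (y - 1)) (t `^ (y - 1) * ln t).
Proof.
move=> t0; rewrite (_ : (fun y => _) = (fun y => expR (ln t * (y + (-1))))).
  rewrite powRE//.
  apply: is_derive_eqd (is_derive_compf (is_derive_expR _) (is_derive_scalef _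
    (is_derive_addf (is_derive_idf _) (is_derive_constf _ _)))) _.
  by rewrite addr0 mulr1 [ln t * _]mulrC.
by apply/funext => z; rewrite powRE// mulrC.
Qed.

Lemma pow_le_expR (x : R) i : 0 <= x -> x ^+ i / i`!%:R <= expR x.
Proof.
case: i => [|n] x0; first by rewrite expr0 fact0 divr1 -expR0 ler_expR.
by apply: le_trans (expR_ge1Dxn n x0); rewrite lerDr.
Qed.

(** Compare [(e |ln t|)^i / i!] with [exp(e |ln t|)], which is [t^e] or [t^(-e)]; hence the constant
    [i!/e^i]. *)
Lemma ln_pow_bound i (e : R) : 0 < e -> exists2 C : R, 0 <= C &
  forall t, 0 < t -> `|ln t| ^+ i <= C * (t `^ e + t `^ (- e)).
Proof.
move=> e0; exists (i`!%:R / e ^+ i); first by rewrite divr_ge0// exprn_ge0// ltW.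
move=> t t0.
have ely : 0 <= e * `|ln t| by rewrite mulr_ge0// ltW.
have := pow_le_expR i ely.
rewrite ler_pdivrMr ?ltr0n ?fact_gt0// exprMn mulrC -ler_pdivlMr ?exprn_gt0//.
move/le_trans; apply; rewrite -mulrA mulrC; apply: ler_wpM2l.
  by rewrite divr_ge0// exprn_ge0// ltW.
rewrite !powRE//; case: (lerP 0 (ln t)) => l0.
  by rewrite ger0_norm// lerDl expR_ge0.
by rewrite ltr0_norm// mulrN mulNr lerDr expR_ge0.
Qed.

Definition pos : set R := [set t : R | 0 < t].

Lemma pos_itv : pos = `]0, +oo[%classic.
Proof. by apply/seteqP; split => x /=; rewrite in_itv/= andbT. Qed.

Lemma measurable_pos : measurable (pos : set (measurableTypeR R)).
Proof. by rewrite pos_itv. Qed.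

(** The i-th derivative in x of [t^(x-1) e^(-st)]. Accordingly [Lap s i] is the i-th derivative of
    [s^(-x) Gamma(x)] for positive s and x. *)
Definition lapk (s x : R) (i : nat) (t : R) : R :=
  t `^ (x - 1) * ln t ^+ i * expR (- (s * t)).

Definition Lap (s : R) (i : nat) (x : R) : R := Rintegral mu pos (lapk s x i).

(** Valued in the extended reals so that scaling and the functional equation can be proved by
    Tonelli before finiteness is known. *)
Definition eLap (s x : R) : \bar R := (\int[mu]_(t in pos) (t `^ (x - 1) * expR (- (s * t)))%:E)%E.

Lemma measurable_lapk s x i (D : set R) : measurable_fun D (lapk s x i).
Proof.
apply: measurable_funTS; apply: measurable_funM; first apply: measurable_funM.
- exact: measurable_powR.
- by apply: measurable_funX; exact: measurable_ln.
- apply: (measurableT_comp (@measurable_expR R)).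
  apply: measurableT_comp => //; exact: measurable_funM.
Qed.

Lemma measurable_eLap s x (D : set R) :
  measurable_fun D (fun t => (t `^ (x - 1) * expR (- (s * t)))%:E).
Proof.
have := @measurable_lapk s x 0 D; rewrite (_ : lapk s x 0 = (fun t => t `^ (x - 1) * expR (- (s * t)))).
  by move/measurable_EFinP.
by apply/funext => t; rewrite /lapk expr0 mulr1.
Qed.

Lemma LapE s x : Lap s 0 x = fine (eLap s x).
Proof.
by congr fine; apply: eq_integral => t _; rewrite /lapk expr0 mulr1.
Qed.

Lemma Gamma_eLap x : Gamma x = fine (eLap 1 x).
Proof. by congr fine; apply: eq_integral => t _; rewrite mul1r. Qed.

Lemma eLap_ge0 s x : (0 <= eLap s x)%E.
Proof.
by apply: integral_ge0 => t _; rewrite lee_fin mulr_ge0 ?powR_ge0 ?expR_ge0.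
Qed.

Lemma eLap_scale s x : 0 < s -> eLap 1 x = ((s `^ x)%:E * eLap s x)%E.
Proof.
move=> s0; rewrite /eLap (ge0_integral_mulr s0 measurable_pos); last 2 first.
- exact: measurable_eLap.
- by move=> t _; rewrite lee_fin mulr_ge0 ?powR_ge0 ?expR_ge0.
rewrite (_ : _ @^-1` pos = pos); last first.
  by apply/seteqP; split => t; rewrite /pos/= pmulr_rgt0.
rewrite (_ : s `^ x = s * s `^ (x - 1)); last first.
  rewrite -[X in X * _](powRr1 (ltW s0)) -powRD; last by rewrite (gt_eqF s0) implybT.
  by congr (_ `^ _); rewrite addrC subrK.
rewrite EFinM -muleA; congr (_ * _)%E.
rewrite -ge0_integralZl//; first last.
- by rewrite lee_fin powR_ge0.
- by move=> t _; rewrite lee_fin mulr_ge0 ?powR_ge0 ?expR_ge0.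
- exact: measurable_eLap.
- exact: measurable_pos.
apply: eq_integral => t /[!inE] t0.
by rewrite -EFinM mul1r powRM ?ltW// mulrA.
Qed.

Lemma integral_expR_itv (r T : R) : 0 < r ->
  (\int[mu]_(t in `[T, +oo[) (expR (- (r * t)))%:E = (expR (- (r * T)) / r)%:E)%E.
Proof.
move=> r0.
have dE (t : R) : is_derive t 1 (fun t => - r^-1 * expR (- r * t)) (expR (- r * t)).
  apply: is_derive_eqd (is_derive_scalef _ (is_derive_expRZ _ _)) _.
  by rewrite mulrA mulrNN mulVf ?mul1r// gt_eqF.
have cF := continuous_is_derive dE.
rewrite (@ge0_continuous_FTC2y _ _ (fun t => - r^-1 * expR (- r * t)) _ 0).
- by rewrite sub0e -EFinN mulNr opprK mulNr mulrC.
- by move=> x _; exact: expR_ge0.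
- apply: continuous_subspaceT; apply: (@continuous_is_derive _ _ (fun t => - r * expR (- r * t))) => t.
  under eq_fun do rewrite -mulNr.
  exact: is_derive_expRZ.
- rewrite -[X in _ --> X](mulr0 (- r^-1)); apply: cvgM; first exact: cvg_cst.
  rewrite (_ : (fun x => _) = (fun z => expR (- z)) \o (fun z => r * z)).
    by apply: (@cvg_comp _ _ _ _ _ _ (pinfty_nbhs R)); [exact: gt0_cvgMry|exact: cvgr_expR].
  by apply/funext => z; rewrite /= mulNr.
- by move=> x _; have [] := dE x.
- exact: cvg_at_right_filter (cF T).
- by move=> x _; rewrite (is_derive_derive1 (dE x)) mulNr.
Qed.

Lemma eLap_ge1_lty s x : 0 < s -> 1 <= x -> (eLap s x < +oo)%E.
Proof.
move=> s0 x1.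
pose a := x - 1; have a0 : 0 <= a by rewrite subr_ge0.
(* From [t <= e^(ct)/c] follows [t^a <= c^(-a) e^(act)]; this c gives [ac <= s/2], so half of the
   exponential decay remains. *)
pose c := s / (2 * (a + 1)).
have c0 : 0 < c by rewrite divr_gt0// mulr_gt0// ltr_wpDl.
apply: (@le_lt_trans _ _ (\int[mu]_(t in `[0%R, +oo[) ((c^-1 `^ a)%:E * (expR (- (s / 2 * t)))%:E))%E).
  rewrite /eLap; apply: (@le_trans _ _ (\int[mu]_(t in pos) ((c^-1 `^ a)%:E * (expR (- (s / 2 * t)))%:E))%E); last first.
    apply: ge0_subset_integral => //.
    - exact: measurable_pos.
    - apply/measurable_EFinP; apply: measurable_funTS; apply: measurable_funM => //.
      apply: (measurableT_comp (@measurable_expR R)).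
      by apply: measurableT_comp => //; exact: measurable_funM.
    - by move=> t _; rewrite mule_ge0// lee_fin ?powR_ge0 ?expR_ge0.
    - by move=> t; rewrite /pos/= in_itv/= andbT => /ltW.
  apply: ge0_le_integral => //.
  - exact: measurable_pos.
  - by move=> t _; rewrite lee_fin mulr_ge0 ?powR_ge0 ?expR_ge0.
  - exact: measurable_eLap.
  - apply/measurable_EFinP; apply: measurable_funTS; apply: measurable_funM => //.
    apply: (measurableT_comp (@measurable_expR R)).
    by apply: measurableT_comp => //; exact: measurable_funM.
  move=> t t0; rewrite -EFinM lee_fin.
  have tle : t <= c^-1 * expR (c * t).
    rewrite -ler_pdivrMl ?invr_gt0// invrK.
    by apply: le_trans (expR_ge1Dx _); rewrite lerDr.
  apply: (@le_trans _ _ ((c^-1 * expR (c * t)) `^ a * expR (- (s * t)))).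
    apply: ler_wpM2r; first exact: expR_ge0.
    apply: ge0_ler_powR => //; rewrite ?nnegrE ?ltW// mulr_gt0 ?expR_gt0 ?invr_gt0//.
  rewrite powRM ?expR_ge0 ?invr_ge0 ?(ltW c0)// -expRM -mulrA -expRD.
  apply: ler_wpM2l; first exact: powR_ge0.
  rewrite ler_expR.
  have : c * a <= s / 2.
    rewrite /c; rewrite -mulrA -[leRHS]mulr1 invfM -!mulrA; apply: ler_wpM2l; first exact: ltW.
    apply: ler_wpM2l => //; rewrite mulrC ler_pdivrMr ?ltr_wpDl// mul1r lerDl//.
  rewrite -(ler_pM2r t0); lra.
rewrite ge0_integralZl//; last 2 first.
- apply/measurable_EFinP; apply: measurable_funTS.
  apply: (measurableT_comp (@measurable_expR R)).
  by apply: measurableT_comp => //; exact: measurable_funM.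
- by rewrite lee_fin powR_ge0.
by rewrite integral_expR_itv ?divr_gt0// -EFinM ltry.
Qed.

Lemma cvg_powRN (x : R) : 0 < x -> t `^ (- x) @[t --> +oo] --> 0.
Proof.
move=> x0; rewrite (_ : (fun t => _) = (fun t => (t `^ x)^-1)); last first.
  by apply/funext => t; rewrite powRN.
apply/gtr0_cvgV0; first by near=> t; apply: powR_gt0; near: t; exact: nbhs_pinfty_gt.
apply/cvgryPge => A; near=> t.
have tA : `|A| `^ x^-1 <= t by near: t; exact: nbhs_pinfty_ge.
apply: (le_trans (ler_norm A)).
rewrite -(powRr1 (normr_ge0 A)) -[X in _ `^ X](@mulVf _ x) ?gt_eqF// powRrM.
apply: ge0_ler_powR => //; rewrite ?nnegrE ?powR_ge0 ?(ltW x0)//.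
Unshelve. all: by end_near. Qed.

Lemma integral_powRN (x : R) : 0 < x ->
  (\int[mu]_(t in `[1%R, +oo[) (t `^ (- (x + 1)))%:E = (x^-1)%:E)%E.
Proof.
move=> x0.
have dE (t : R) : 0 < t -> is_derive t 1 (fun t => - x^-1 * t `^ (- x)) (t `^ (- (x + 1))).
  move=> t0; apply: is_derive_eqd (is_derive_scalef _ (is_derive1_powR (- x) t0)) _.
  by rewrite mulrA mulrNN mulVf ?mul1r ?opprD// gt_eqF.
have cF (t : R) : 0 < t -> {for t, continuous (fun t => - x^-1 * t `^ (- x))}.
  by move=> /dE[dt _]; apply: differentiable_continuous; exact/derivable1_diffP.
have cf (t : R) : 0 < t -> {for t, continuous (fun t => t `^ (- (x + 1)))}.
  move=> t0; apply: differentiable_continuous; apply/derivable1_diffP.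
  by have [] := is_derive1_powR (- (x + 1)) t0.
rewrite (@ge0_continuous_FTC2y _ _ (fun t => - x^-1 * t `^ (- x)) _ 0).
- by rewrite powR1 mulr1 sub0e -EFinN opprK.
- by move=> t _; exact: powR_ge0.
- apply/continuous_within_itvcyP; split.
    by move=> t; rewrite in_itv/= andbT => t1; apply: cf; exact: lt_trans t1.
  by apply: cvg_at_right_filter; exact: cf.
- by rewrite -[X in _ --> X](mulr0 (- x^-1)); apply: cvgM; [exact: cvg_cst|exact: cvg_powRN].
- by move=> t t1; have [] := dE t (lt_trans ltr01 t1).
- by apply: cvg_at_right_filter; exact: cF.
- by move=> t; rewrite in_itv/= andbT => t1; rewrite (is_derive_derive1 (dE t (lt_trans ltr01 t1))).
Qed.

(** Tonelli in place of integration by parts: write [t^(x-1) e^(-t)] as the integral of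
    [t^x e^(-ty)] over [y >= 1]. Integrating first in t gives [y^(-x-1) Gamma(x+1)], and [y^(-x-1)]
    has integral [1/x]. *)
Lemma eLap_rec (x : R) : 0 < x -> (eLap 1 x = (x^-1)%:E * eLap 1 (x + 1))%E.
Proof.
move=> x0.
pose f (t y : R) : \bar R := (t `^ x * expR (- (t * y)))%:E.
transitivity (\int[mu]_(t in pos) \int[mu]_(y in `[1%R, +oo[) f t y)%E.
  apply: eq_integral => t /[!inE] t0; rewrite /f.
  under eq_integral do rewrite EFinM.
  rewrite ge0_integralZl//; last 2 first.
  - apply/measurable_EFinP; apply: measurable_funTS.
    apply: (measurableT_comp (@measurable_expR R)).
    by apply: measurableT_comp => //; exact: measurable_funM.
  - by rewrite lee_fin powR_ge0.
  rewrite integral_expR_itv// -EFinM mul1r mulr1 -(mulr_powRB1 (ltW t0) x0).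
  by congr EFin; field; rewrite gt_eqF.
rewrite (tonelli_rect measurable_pos); last 3 first.
- by [].
- apply/measurable_EFinP; apply: measurable_funTS; apply: measurable_funM.
    exact: (measurableT_comp (measurable_powR x)).
  apply: (measurableT_comp (@measurable_expR R)).
  by apply: measurableT_comp => //; exact: measurable_funM.
- by move=> t y _ _; rewrite lee_fin mulr_ge0 ?powR_ge0 ?expR_ge0.
transitivity (\int[mu]_(y in `[1%R, +oo[) ((y `^ (- (x + 1)))%:E * eLap 1 (x + 1)))%E.
  apply: eq_integral => y; rewrite inE/= in_itv/= andbT => y1.
  have y0 : 0 < y by exact: lt_le_trans y1.
  rewrite (eLap_scale _ y0) muleA -EFinM powRN mulVf ?mul1e; last by rewrite gt_eqF ?powR_gt0.
  apply: eq_integral => t _; rewrite /f addrK [t * y]mulrC.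
  by [].
rewrite ge0_integralZr//; last 3 first.
- apply/measurable_EFinP; apply: measurable_funTS; exact: measurable_powR.
- by move=> t _; rewrite lee_fin powR_ge0.
- exact: eLap_ge0.
by rewrite integral_powRN.
Qed.

(** The functional equation brings the case of exponents at least 1 down to all positive ones;
    scaling then reaches every s. *)
Lemma eLap_lty s x : 0 < s -> 0 < x -> (eLap s x < +oo)%E.
Proof.
move=> s0 x0.
have : (eLap 1 x < +oo)%E.
  rewrite eLap_rec// lte_mul_pinfty// ?lee_fin ?invr_ge0 ?ltW//.
  by apply: eLap_ge1_lty => //; rewrite lerDr ltW.
apply: contraTT; rewrite -!leNgt !leye_eq => /eqP Ly.
by rewrite (eLap_scale _ s0) Ly gt0_muley// lte_fin powR_gt0.
Qed.

Lemma Lap_scale s x : 0 < s -> 0 < x -> Lap s 0 x = s `^ (- x) * Gamma x.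
Proof.
move=> s0 x0; rewrite Gamma_eLap (eLap_scale _ s0) LapE fineM//; last first.
  by rewrite ge0_fin_numE ?eLap_ge0 ?eLap_lty.
by rewrite /= mulrA powRN mulVf ?mul1r// gt_eqF ?powR_gt0.
Qed.

Lemma Gamma_rec (x : R) : 0 < x -> Gamma (x + 1) = x * Gamma x.
Proof.
move=> x0; rewrite !Gamma_eLap (eLap_rec x0) fineM//=.
  by rewrite mulVKf// gt_eqF.
by rewrite ge0_fin_numE ?eLap_ge0 ?eLap_lty// ltr_wpDl// ltW.
Qed.

Lemma integrable_lapk s x i : 0 < s -> 0 < x ->
  mu.-integrable pos (EFin \o lapk s x i).
Proof.
move=> s0 x0.
(* The logarithms cost a factor [t^(x/2)] or [t^(-x/2)]; the resulting exponents [3x/2] and [x/2]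
   are still positive. *)
have x20 : 0 < x / 2 by rewrite divr_gt0.
have [C C0 Cle] := ln_pow_bound i x20.
have iL y : 0 < y -> mu.-integrable pos (fun t => (t `^ (y - 1) * expR (- (s * t)))%:E).
  move=> y0; apply/integrableP; split; first exact: measurable_eLap.
  under eq_integral do rewrite gee0_abs ?lee_fin ?mulr_ge0 ?powR_ge0 ?expR_ge0//.
  exact: eLap_lty.
pose g (t : R) := (C%:E * ((t `^ (x / 2 + x - 1) * expR (- (s * t)))%:E +
                    (t `^ (x / 2 - 1) * expR (- (s * t)))%:E))%E.
apply: (@le_integrable _ _ _ mu _ measurable_pos _ g).
- by apply/measurable_EFinP; exact: measurable_lapk.
- move=> t t0; rewrite /g /= lee_fin.
  rewrite -mulrDl /lapk !normrM normrX !(ger0_norm (powR_ge0 _ _)).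
  rewrite !(ger0_norm (expR_ge0 _)) (ger0_norm C0).
  rewrite (ger0_norm (addr_ge0 (powR_ge0 _ _) (powR_ge0 _ _))).
  rewrite mulrA; apply: ler_wpM2r; first exact: expR_ge0.
  apply: (@le_trans _ _ (t `^ (x - 1) * (C * (t `^ (x / 2) + t `^ (- (x / 2)))))).
    by apply: ler_wpM2l; [exact: powR_ge0|exact: Cle].
  rewrite mulrCA mulrDr -!powRD ?(gt_eqF t0) ?implybT//.
  rewrite (_ : x - 1 + x / 2 = x / 2 + x - 1); last by ring.
  by rewrite (_ : x - 1 - x / 2 = x / 2 - 1); last by field.
- apply: integrableZl; first exact: measurable_pos.
  apply: integrableD; first exact: measurable_pos.
    by apply: iL; rewrite addr_gt0.
  exact: iL.
Qed.

End lap.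

(** * Gamma, Euler's constant and the coefficients C *)

Section gamma.
Variable R : realType.
Notation mu := (@lebesgue_measure R).
Local Notation pos := (@pos R).

Lemma powR_le_sum (t u v y : R) : 0 < t -> u <= y <= v -> t `^ y <= t `^ u + t `^ v.
Proof.
move=> t0 /andP[uy yv]; case: (lerP t 1) => t1.
  by apply: le_trans (_ : t `^ u <= _); [apply: ger_powR; rewrite ?t0|rewrite lerDl powR_ge0].
by apply: le_trans (_ : t `^ v <= _); [by apply: ler_powR => //; exact: ltW|rewrite lerDr powR_ge0].
Qed.

Lemma is_derive_lapk (s x : R) i (t : R) : 0 < t ->
  is_derive x 1 (fun y => lapk s y i t) (lapk s x i.+1 t).
Proof.
move=> t0; rewrite (_ : (fun y => _) = fun y => (ln t ^+ i * expR (- (s * t))) * t `^ (y - 1)).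
  apply: is_derive_eqd (is_derive_scalef _ (powR_derive x t0)) _.
  by rewrite /lapk exprSr; ring.
by apply/funext => y; rewrite /lapk; ring.
Qed.

Lemma is_derive_Lap (s x : R) i : 0 < s -> 0 < x ->
  is_derive x 1 (Lap s i) (Lap s i.+1 x).
Proof.
move=> s0 x0.
(* For exponents in []u, v[] the differentiated integrand is dominated by the sum of its absolute
   values at u and v, both integrable since u and v are positive. *)
pose u := x / 2; pose v := 2 * x.
have u0 : 0 < u by rewrite divr_gt0.
have v0 : 0 < v by rewrite mulr_gt0.
pose G (t : R) := `|lapk s u i.+1 t| + `|lapk s v i.+1 t|.
have Ix : `]u, v[%classic x by rewrite /= in_itv/= /u /v; apply/andP; split; lra.
have iN y : 0 < y -> mu.-integrable pos (fun t => `|lapk s y i.+1 t|%:E).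
  move=> y0; have := integrable_abse (integrable_lapk i.+1 s0 y0).
  by apply: eq_integrable => //; exact: measurable_pos.
have intf y : `]u, v[%classic y -> mu.-integrable pos (EFin \o (fun t => lapk s y i t)).
  rewrite /= in_itv/= => /andP[uy _]; apply: integrable_lapk => //.
  exact: lt_trans uy.
have derf y t : `]u, v[%classic y -> pos t -> derivable (fun y => lapk s y i t) y 1.
  by move=> _ /(is_derive_lapk s y i)[].
have G0 t : 0 <= G t by rewrite addr_ge0.
have intG : mu.-integrable pos (EFin \o G).
  by apply: (integrableD _ (iN u u0) (iN v v0)); exact: measurable_pos.
have dE y t : pos t -> partial1of2 (fun y t => lapk s y i t) y t = lapk s y i.+1 t.
  by move=> t0; exact: is_derive_derive1 (is_derive_lapk s y i t0).
have Gub y t : `]u, v[%classic y -> pos t ->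
    `|partial1of2 (fun y t => lapk s y i t) y t| <= G t.
  rewrite /= in_itv/= => /andP[uy yv] t0; rewrite dE// /G /lapk !normrM -!mulrDl.
  rewrite !(ger0_norm (powR_ge0 _ _)); apply: ler_wpM2r => //; apply: ler_wpM2r => //.
  by apply: powR_le_sum => //; rewrite !lerD2r !ltW.
apply: DeriveDef.
  change (derivable (fun y => Rintegral mu pos (fun t => lapk s y i t)) x 1).
  exact: (derivable_under_integral (@measurable_pos R) Ix intf derf G0 intG Gub).
rewrite -derive1E.
change ((fun y => Rintegral mu pos (fun t => lapk s y i t))^`() x = Lap s i.+1 x).
rewrite (differentiation_under_integral (@measurable_pos R) Ix intf derf G0 intG Gub).
by apply: eq_Rintegral => t /[!inE]; exact: dE.
Qed.

Lemma Gamma_Lap (x : R) : Gamma x = Lap 1 0 x.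
Proof. by rewrite Gamma_eLap LapE. Qed.

Lemma Gamma1 : Gamma 1 = 1 :> R.
Proof.
rewrite Gamma_eLap /eLap pos_itv integral_itv_obnd_cbnd; last exact: measurable_eLap.
under eq_integral do rewrite subrr powRr0 mul1r.
by rewrite integral_expR_itv//= mulr0 oppr0 expR0 divr1.
Qed.

Lemma Gamma_nat n : Gamma n.+1%:R = n`!%:R :> R.
Proof.
elim: n => [|n IH]; first by rewrite Gamma1 fact0.
by rewrite -[n.+2]addn1 natrD Gamma_rec ?ltr0n// IH factS natrM.
Qed.

(** The derivative of [Gamma(x+1) = x Gamma(x)]; [Lap 1 1] is the derivative of [Gamma]. *)
Lemma Lap1_rec (x : R) : 0 < x -> Lap 1 1 (x + 1) = x * Lap 1 1 x + Gamma x.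
Proof.
move=> x0.
have d1 : is_derive x 1 (fun y => Lap 1 0 (y + 1)) (Lap 1 1 (x + 1)).
  have x10 : 0 < x + 1 by exact: addr_gt0.
  have := @is_derive_compf R (Lap 1 0) (fun y => y + 1) x _ _
    (is_derive_Lap 0 ltr01 x10) (is_derive_addf (is_derive_idf x) (is_derive_constf 1 x)).
  by rewrite addr0 mulr1.
have d2 : is_derive x 1 (fun y => y * Lap 1 0 y) (x * Lap 1 1 x + Lap 1 0 x * 1).
  exact: (is_derive_mulf (is_derive_idf x) (is_derive_Lap 0 ltr01 x0)).
rewrite mulr1 -Gamma_Lap in d2.
rewrite -(is_derive_derive1 d2) -(is_derive_derive1 d1).
have : \forall y \near x, Lap 1 0 (y + 1) = y * Lap 1 0 y.
  near=> y; rewrite -!Gamma_Lap Gamma_rec//.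
  by near: y; exact: lt_nbhsr.
by move=> /near_eq_derive1 /nbhs_singleton.
Unshelve. all: by end_near. Qed.

Lemma lnB_le (a t : R) : 0 < a -> 0 < t -> ln t <= ln a - 1 + t / a.
Proof.
move=> a0 t0; have := @le_ln1Dx R (t / a - 1).
rewrite [1 + _]addrC subrK ln_div ?posrE// => lnle.
have ta : -1 < t / a - 1 by rewrite ltrBrDl subrr divr_gt0.
by have := lnle ta; lra.
Qed.

Lemma LapZ (s c x : R) i : 0 < s -> 0 < x ->
  c * Lap s i x = Rintegral mu pos (fun t => c * lapk s x i t).
Proof.
by move=> s0 x0; rewrite RintegralZl//; [exact: measurable_pos|exact: integrable_lapk].
Qed.

Lemma integrable_lapkZ (s c x : R) i : 0 < s -> 0 < x ->
  mu.-integrable pos (EFin \o (fun t => c * lapk s x i t)).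
Proof.
move=> s0 x0; have := integrableZl (@measurable_pos R) c (integrable_lapk i s0 x0).
by apply: eq_integrable => //; exact: measurable_pos.
Qed.

Lemma lapk0S (s x t : R) : 0 < t -> lapk s (x + 1) 0 t = t * lapk s x 0 t.
Proof.
move=> t0; rewrite /lapk !expr0 !mulr1 mulrA; congr (_ * _).
rewrite addrK -[X in X * _](powRr1 (ltW t0)) -powRD ?(gt_eqF t0) ?implybT//.
by congr (_ `^ _); ring.
Qed.

Lemma lapk1E (s x t : R) : lapk s x 1 t = ln t * lapk s x 0 t.
Proof. by rewrite /lapk expr1 expr0; ring. Qed.

Lemma lapk_ge0 (s x t : R) : 0 <= lapk s x 0 t.
Proof. by rewrite /lapk expr0 mulr1 mulr_ge0 ?powR_ge0 ?expR_ge0. Qed.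

(* Both bounds integrate the tangent inequality for ln at the mean of the Gamma distribution. *)
Lemma Lap1_le (x : R) : 0 < x -> Lap 1 1 x <= ln x * Gamma x.
Proof.
move=> x0; have x10 : 0 < x + 1 by exact: addr_gt0.
have -> : ln x * Gamma x = (ln x - 1) * Lap 1 0 x + x^-1 * Lap 1 0 (x + 1).
  by rewrite -!Gamma_Lap Gamma_rec// mulKf ?gt_eqF//; ring.
rewrite !LapZ// -RintegralD; last 3 first.
- exact: measurable_pos.
- exact: integrable_lapkZ.
- exact: integrable_lapkZ.
apply: le_Rintegral.
- exact: measurable_pos.
- exact: integrable_lapk.
- by apply: (integrableD _ (integrable_lapkZ _ _ ltr01 x0) (integrable_lapkZ _ _ ltr01 x10)); exact: measurable_pos.
- move=> t t0; rewrite -/(lapk 1 x 1 t) lapk1E lapk0S//; have := lapk_ge0 1 x t.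
  move: (lapk 1 x 0 t) => L L0; rewrite mulrA -mulrDl.
  by apply: ler_wpM2r => //; rewrite [x^-1 * _]mulrC; exact: lnB_le.
Qed.

Lemma Lap1_ge (x : R) : 0 < x -> ln x * Gamma (x + 1) <= Lap 1 1 (x + 1).
Proof.
move=> x0; have x10 : 0 < x + 1 by exact: addr_gt0.
have -> : ln x * Gamma (x + 1) = (ln x + 1) * Lap 1 0 (x + 1) + (- x) * Lap 1 0 x.
  by rewrite -!Gamma_Lap Gamma_rec//; ring.
rewrite !LapZ// -RintegralD; last 3 first.
- exact: measurable_pos.
- exact: integrable_lapkZ.
- exact: integrable_lapkZ.
apply: le_Rintegral.
- exact: measurable_pos.
- by apply: (integrableD _ (integrable_lapkZ _ _ ltr01 x10) (integrable_lapkZ _ _ ltr01 x0)); exact: measurable_pos.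
- exact: integrable_lapk.
- move=> t t0; rewrite -/(lapk 1 (x + 1) 1 t) lapk1E lapk0S//; have := lapk_ge0 1 x t.
  move: (lapk 1 x 0 t) => L L0; rewrite !mulrA -mulrDl.
  apply: ler_wpM2r => //.
  have tp : 0 < t by [].
  have := ler_wpM2r (ltW tp) (lnB_le tp x0).
  by rewrite !mulrDl divfK ?gt_eqF//; lra.
Qed.

Definition harmonic_sum (n : nat) : R := \sum_(1 <= k < n.+1) k%:R^-1.

Lemma Lap1_nat n : Lap 1 1 n.+1%:R = (harmonic_sum n + Lap 1 1 1) * Gamma n.+1%:R.
Proof.
elim: n => [|n IH].
  by rewrite /harmonic_sum big_geq// add0r Gamma1 mulr1.
rewrite -natr1 (Lap1_rec (ltr0Sn R n)) IH (Gamma_rec (ltr0Sn R n)).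
rewrite /harmonic_sum [in RHS]big_nat_recr//=.
have n0 : n.+1%:R != 0 :> R by rewrite pnatr_eq0.
by field; rewrite -[1 + _]/(1%:R + _) -natrD pnatr_eq0.
Qed.

(** By [Lap1_nat], [H_n + Gamma'(1)] is the logarithmic derivative of [Gamma] at [n+1]. [Lap1_ge]
    and [Lap1_le] place it between [ln n] and [ln(n+1) <= ln n + 1/n]. *)
Lemma euler_gammaE : euler_gamma R = - Lap 1 1 1.
Proof.
rewrite /euler_gamma; apply/cvg_lim => //.
apply/cvgrPdist_le => e e0; near=> n.
have n0 : (0 < n)%N by near: n; exists 1%N.
have nR : 0 < n%:R :> R by rewrite ltr0n.
have G0 : 0 < Gamma (n%:R + 1) :> R by rewrite natr1 Gamma_nat ltr0n fact_gt0.
have ub : harmonic_sum n + Lap 1 1 1 <= ln (n%:R + 1).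
  rewrite -(ler_pM2r G0) natr1 -Lap1_nat -natr1; apply: Lap1_le; exact: addr_gt0.
have lb : ln n%:R <= harmonic_sum n + Lap 1 1 1.
  rewrite -(ler_pM2r G0) [in leRHS]natr1 -Lap1_nat -natr1; exact: Lap1_ge.
have up : ln (n%:R + 1) <= ln n%:R + n%:R^-1 :> R.
  have := @le_ln1Dx R n%:R^-1; rewrite (_ : 1 + n%:R^-1 = (n%:R + 1) / n%:R); last first.
    by field; rewrite gt_eqF.
  rewrite ln_div ?posrE ?addr_gt0// => lnle.
  have nV : -1 < n%:R^-1 :> R by rewrite (@lt_le_trans _ _ 0)// ?invr_ge0 ?ler0n// ltrN10.
  by have := lnle nV; lra.
have ne : n%:R^-1 <= e.
  rewrite -[leRHS]invrK lef_pV2 ?posrE ?invr_gt0//.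
  by near: n; exact: nbhs_infty_ger.
by rewrite -/(harmonic_sum n) ler_norml; apply/andP; split; lra.
Unshelve. all: by end_near. Qed.

(** Each derivative in z adds one logarithm under the integral and, because of [k+1-z], one sign. *)
Lemma Lap_tower (s : R) k n : 0 < s ->
  smooth n (fun z => Lap s 0 (k.+1%:R - z)) 0 /\
  tcoef n (fun z => Lap s 0 (k.+1%:R - z)) 0 = (-1) ^+ n * Lap s n k.+1%:R / n`!%:R.
Proof.
move=> s0.
pose F n (z : R) := (-1) ^+ n * Lap s n (k.+1%:R - z).
have dF m : \forall z \near (0 : R), is_derive (z : R) 1 (F m) (F m.+1 z).
  have : \forall z \near (0 : R), 0 < k.+1%:R - z.
    have : \forall z \near (0 : R), z < k.+1%:R by exact: lt_nbhsl.
    by apply: filterS => z; rewrite subr_gt0.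
  apply: filterS => z z0.
  have := is_derive_scalef ((-1) ^+ m) (is_derive_compf (g := fun y => k.+1%:R + -1 * y)
    (is_derive_Lap m s0 (_ : 0 < k.+1%:R + -1 * z))
    (is_derive_addf (is_derive_constf k.+1%:R z) (is_derive_scalef (-1) (is_derive_idf z)))).
  rewrite /F mulN1r => /(_ z0) H.
  rewrite (_ : (fun y => _) = (fun y => (-1) ^+ m * Lap s m (k.+1%:R + -1 * y))); last first.
    by apply/funext => y; rewrite mulN1r.
  by apply: is_derive_eqd H _; rewrite exprSr; ring.
have F0 : F 0%N = (fun z => Lap s 0 (k.+1%:R - z)).
  by apply/funext => z; rewrite /F expr0 mul1r.
have [] := tower_smooth dF n; rewrite F0 => sn Fn; split=> //.
by rewrite /tcoef Fn /F subr0.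
Qed.

Definition gamma_quot (k : nat) (z : R) : R :=
  expR (euler_gamma R * z) / Gamma (k.+1%:R - z).

Lemma near_Gamma_gt0 k : \forall z \near (0 : R), 0 < Gamma (k.+1%:R - z).
Proof.
have [sG _] := Lap_tower k 1 ltr01.
have cG : {for 0, continuous (fun z : R => Lap 1 0 (k.+1%:R - z))}.
  apply: differentiable_continuous; apply/derivable1_diffP.
  by have [/nbhs_singleton] := sG.
have : 0 < Lap 1 0 (k.+1%:R - 0) :> R.
  by rewrite subr0 -Gamma_Lap Gamma_nat ltr0n fact_gt0.
move=> /(cvgr_gt _ cG).
by apply: filterS => z; rewrite Gamma_Lap.
Qed.

Lemma smooth_gamma_quot n k : smooth n (gamma_quot k) 0.
Proof.
apply: smoothM; first exact: smooth_expR.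
apply: smoothV.
  by apply: filterS (near_Gamma_gt0 k) => z /gt_eqF ->.
have [+ _] := Lap_tower k n ltr01; apply: eq_smooth; apply: near_all => z.
by rewrite Gamma_Lap.
Qed.

Lemma CcoefE r k : Ccoef R r k = tcoef r (gamma_quot k) 0.
Proof. by []. Qed.

Lemma Ccoef_0 k : Ccoef R 0 k = k`!%:R^-1.
Proof. by rewrite CcoefE tcoef0 /gamma_quot mulr0 expR0 subr0 Gamma_nat mul1r. Qed.

(** Coefficients of [gamma_quot k z = (k+1-z) gamma_quot (k+1) z], which is
    [Gamma(k+2-z) = (k+1-z) Gamma(k+1-z)]. *)
Lemma Ccoef_rec r k : Ccoef R r k =
  k.+1%:R * Ccoef R r k.+1 - (if r is r'.+1 then Ccoef R r' k.+1 else 0).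
Proof.
rewrite CcoefE (@eq_tcoef _ _ _ (fun z => k.+1%:R * gamma_quot k.+1 z
    + -1 * (z * gamma_quot k.+1 z))); last first.
  apply: filterS2 (near_Gamma_gt0 k) (lt_nbhsl (ltr0Sn R k)) => z Gz zk.
  have kz : 0 < k.+1%:R - z by rewrite subr_gt0.
  rewrite /gamma_quot (_ : k.+2%:R - z = k.+1%:R - z + 1); last first.
    by rewrite -[k.+2%:R]natr1; ring.
  rewrite Gamma_rec//; field; rewrite (gt_eqF Gz)/=.
  by apply: lt0r_neq0; rewrite -[1 + k%:R]/(1%:R + k%:R) -natrD.
have sq := smooth_gamma_quot r k.+1.
have si : smooth r (fun z => z * gamma_quot k.+1 z) 0 by apply: smoothM; [exact: smooth_id|].
rewrite tcoefD; [|by apply: smoothM => //; exact: smooth_cst..].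
by rewrite !tcoefZ// mulN1r tcoef_idM.
Qed.

(** The left side is the Cauchy product of [e^(gamma z)/Gamma(k+1-z)] with [s^(z-k-1) Gamma(k+1-z)].
    The Gamma factors cancel and leave [s^(-k-1) e^((gamma + ln s) z)]: the coefficients [Ccoef] are
    made for this. *)
Lemma sum_Ccoef_Lap (s : R) k l : 0 < s ->
  \sum_(r < l.+1) Ccoef R r k * ((-1) ^+ (l - r) * Lap s (l - r) k.+1%:R / (l - r)`!%:R) =
  s `^ (- k.+1%:R) * ((euler_gamma R + ln s) ^+ l / l`!%:R).
Proof.
move=> s0.
under eq_bigr do rewrite -(Lap_tower k _ s0).2 CcoefE.
rewrite -tcoefM; [|exact: smooth_gamma_quot|exact: (Lap_tower k l s0).1].
rewrite -tcoef_expR -tcoefZ; last exact: smooth_expR.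
apply: eq_tcoef; apply: filterS2 (near_Gamma_gt0 k) (lt_nbhsl (ltr0Sn R k)) => z Gz zk.
have kz : 0 < k.+1%:R - z by rewrite subr_gt0.
rewrite /gamma_quot Lap_scale// mulrCA mulfVK ?gt_eqF//.
rewrite !powRE// mulrC -!expRD; congr expR; ring.
Qed.

(** At [s = 1] the preceding identity reads [C_{1,0} - Gamma'(1) = gamma], and
    [gamma = - Gamma'(1)]. *)
Lemma Ccoef_10 : Ccoef R 1 0 = 0.
Proof.
have := @sum_Ccoef_Lap 1 0 1 ltr01.
rewrite big_ord_recl big_ord1 /= subn0 subnn !expr1 expr0 Ccoef_0 fact0 invr1 !mulr1 !mul1r.
rewrite ln1 addr0 powR1 mul1r -Gamma_Lap Gamma1 !mulr1 euler_gammaE mulN1r.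
lra.
Qed.

(** The integral of [s ln t e^(-st)] over [t > 0]. Its part over [t >= 1] will turn out to be the
    exponential integral [E_1(s)], whence the expansion of [E_1] at 0. *)
Lemma Lap1_ln (s : R) : 0 < s -> s * Lap s 1 1 = - euler_gamma R - ln s.
Proof.
move=> s0; have := sum_Ccoef_Lap 0 1 s0.
rewrite big_ord_recl big_ord1 /= subn0 subnn !expr1 expr0 Ccoef_0 Ccoef_10 fact0 invr1.
rewrite !mulr1 !mul1r mul0r addr0 mulN1r.
rewrite powRN powRr1 ?ltW// => /(congr1 (fun x => - s * x)).
by rewrite mulrN mulNr opprK => ->; rewrite mulrA mulNr mulfV ?gt_eqF// mulN1r opprD.
Qed.

End gamma.

(** * Derivatives of logarithmic polynomials *)

Section sums.
Variable R : realType.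

Lemma is_derive_sumf n (f : 'I_n -> R -> R) (d : 'I_n -> R) (x : R) :
  (forall i, is_derive x 1 (f i) (d i)) ->
  is_derive x 1 (fun y => \sum_(i < n) f i y) (\sum_(i < n) d i).
Proof.
elim: n f d => [|n IH] f d fd.
  rewrite (_ : (fun y => _) = fun=> 0); first by rewrite big_ord0; exact: is_derive_constf.
  by apply/funext => y; rewrite big_ord0.
rewrite (_ : (fun y => _) =
    (fun y => \sum_(i < n) f (widen_ord (leqnSn n) i) y + f ord_max y)); last first.
  by apply/funext => y; rewrite big_ord_recr.
by rewrite big_ord_recr; exact: (is_derive_addf (IH _ _ (fun i => fd _)) (fd ord_max)).
Qed.

(* Since the sum differentiates to its last term by telescoping, one application
   of the mean value theorem suffices. *)
Lemma taylor_backward (F : nat -> R -> R) q (u B : R) :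
  (forall i x, u - 1 <= x <= u -> is_derive x 1 (F i) (F i.+1 x)) ->
  (forall x, u - 1 <= x <= u -> `|F q.+1 x| <= B) ->
  `|F 0%N (u - 1) - \sum_(i < q.+1) (-1) ^+ i / i`!%:R * F i u| <= B.
Proof.
move=> dF FB.
(* The Taylor polynomial about x evaluated at [u - 1]. It equals [F 0 (u - 1)] at [x = u - 1] and
   the sum of the statement at [x = u]. *)
pose S q (x : R) := \sum_(i < q.+1) (u - 1 - x) ^+ i / i`!%:R * F i x.
have dS x : u - 1 <= x <= u ->
    is_derive x 1 (S q) ((u - 1 - x) ^+ q / q`!%:R * F q.+1 x).
  move=> xu; elim: q {FB} => [|n IH].
    rewrite (_ : S 0%N = F 0%N).
      by apply: is_derive_eqd (dF 0%N x xu) _; rewrite expr0 fact0; field.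
    by apply/funext => y; rewrite /S big_ord1 expr0 fact0 divr1 mul1r.
  rewrite (_ : S n.+1 = fun y => S n y + (n.+1)`!%:R^-1 * ((u - 1 + -1 * y) ^+ n.+1 * F n.+1 y)).
    apply: is_derive_eqd (is_derive_addf IH (is_derive_scalef _ (is_derive_mulf
      (is_derive_expf n (is_derive_addf (is_derive_constf (u - 1) x)
         (is_derive_scalef (-1) (is_derive_idf x)))) (dF n.+1 x xu)))) _.
    rewrite factS natrM mulN1r; field.
    by rewrite -[1 + n%:R]/(1%:R + n%:R) -natrD !pnatr_eq0 -lt0n fact_gt0.
  by apply/funext => y; rewrite /S big_ord_recr/= mulN1r; ring.
have u1 : u - 1 <= u by rewrite lerBlDr lerDl.
have [||c cu SE] := @MVT_segment R (S q) (fun x => (u - 1 - x) ^+ q / q`!%:R * F q.+1 x) (u - 1) u u1.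
- move=> x; rewrite in_itv/= => /andP[xl xr]; apply: dS.
  by rewrite !ltW.
- apply: derivable_within_continuous => x; rewrite in_itv/= => xu.
  by have [] := dS x xu.
have cu' : u - 1 <= c <= u by rewrite in_itv/= in cu.
have S0 : S q (u - 1) = F 0%N (u - 1).
  rewrite /S big_ord_recl subrr expr0 fact0 divr1 mul1r big1 ?addr0// => i _.
  by rewrite exprS !mul0r.
have Su : S q u = \sum_(i < q.+1) (-1) ^+ i / i`!%:R * F i u.
  by apply: eq_bigr => i _; congr (_ ^+ _ / _ * _); ring.
rewrite -S0 -Su distrC SE (_ : u - (u - 1) = 1); last by ring.
rewrite mulr1 normrM -[leRHS]mul1r; apply: ler_pM => //; last exact: FB.
have /andP[cl cr] := cu'.
rewrite normrM normfV normr_nat normrX ler_pdivrMr ?ltr0n ?fact_gt0// mul1r.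
apply: (@le_trans _ _ 1); last by rewrite ler1n fact_gt0.
by apply: exprn_ile1 => //; rewrite ler_norml; apply/andP; split; lra.
Qed.

Lemma ltr01_ln (u : R) : 1 <= u -> 1 <= 1 + ln u.
Proof. by move=> u1; rewrite lerDl ln_ge0. Qed.

Lemma expr_1ln_le k : exists2 C : R, 0 <= C &
  forall u, 1 <= u -> (1 + ln u) ^+ k <= C * u.
Proof.
exists (k`!%:R * expR 1) => [|u u1]; first by rewrite mulr_ge0// expR_ge0.
have u0 : 0 < u by exact: lt_le_trans u1.
have l0 : 0 <= 1 + ln u by rewrite (le_trans ler01)// ltr01_ln.
have := pow_le_expR k l0; rewrite expRD lnK ?posrE//.
by rewrite ler_pdivrMr ?ltr0n ?fact_gt0// mulrC mulrA.
Qed.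

Lemma ler_ln_exp (u v : R) k : 1 <= u -> u <= v -> (1 + ln u) ^+ k <= (1 + ln v) ^+ k.
Proof.
move=> u1 uv; have l0 : 0 <= 1 + ln u by rewrite (le_trans ler01)// ltr01_ln.
rewrite lerXn2r ?nnegrE//.
  by rewrite (le_trans ler01)// ltr01_ln// (le_trans u1).
rewrite lerD2l ler_ln// posrE; first exact: lt_le_trans u1.
by rewrite (lt_le_trans _ uv)// (lt_le_trans _ u1).
Qed.

Lemma ler_1ln_exp (u : R) k m : 1 <= u -> (k <= m)%N -> (1 + ln u) ^+ k <= (1 + ln u) ^+ m.
Proof. by move=> u1 km; apply: ler_weXn2l => //; exact: ltr01_ln. Qed.

End sums.

(** * Logarithmic polynomials as coefficients of powers of u *)

Section logpoly.
Variable R : realType.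
Implicit Types (c : nat -> R) (j k kap : nat) (u : R).

(** The coefficient of [z^k] in [u^z]; with this normalisation differentiation lowers k and divides
    by u. *)
Definition logpow k u : R := ln u ^+ k / k`!%:R.

Definition logpoly c k u : R := \sum_(r < k.+1) c r * logpow (k - r) u.

(* [dlp kap c j k] is the j-th derivative of u^kap (logpoly c k u); the recursion
   expresses that [logpoly c k] is the degree-k coefficient of a multiple of u^z. *)
Fixpoint dlp kap c j k u : R :=
  if j is j'.+1 then
    ((kap%:R - j'%:R) * dlp kap c j' k u
     + (if k is k'.+1 then dlp kap c j' k' u else 0)) / u
  else u ^+ kap * logpoly c k u.

Definition dlp_pred kap c j k u : R := if k is k'.+1 then dlp kap c j k' u else 0.

Lemma dlpS kap c j k u : dlp kap c j.+1 k u =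
  ((kap%:R - j%:R) * dlp kap c j k u + dlp_pred kap c j k u) / u.
Proof. by []. Qed.

Lemma mulr_dlpS kap c j k u : 0 < u -> u * dlp kap c j.+1 k u =
  (kap%:R - j%:R) * dlp kap c j k u + dlp_pred kap c j k u.
Proof. by move=> u0; rewrite dlpS mulrC divfK// gt_eqF. Qed.

Lemma is_derive_logpow k u : 0 < u ->
  is_derive u 1 (logpow k) (if k is k'.+1 then logpow k' u / u else 0).
Proof.
move=> u0; case: k => [|k].
  rewrite (_ : logpow 0 = fun=> 1); first exact: is_derive_constf.
  by apply/funext => y; rewrite /logpow expr0 fact0 divr1.
rewrite (_ : logpow k.+1 = fun y => (k.+1)`!%:R^-1 * ln y ^+ k.+1); last first.
  by apply/funext => y; rewrite /logpow mulrC.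
have := is_derive_scalef (k.+1)`!%:R^-1 (is_derive_expf k (is_derive1_ln u0)).
move/is_derive_eqd; apply; rewrite /logpow factS natrM; field.
by rewrite (gt_eqF u0)/= -[1 + k%:R]/(1%:R + k%:R) -natrD !pnatr_eq0 -lt0n fact_gt0.
Qed.

Lemma is_derive_logpoly c k u : 0 < u ->
  is_derive u 1 (logpoly c k) (if k is k'.+1 then logpoly c k' u / u else 0).
Proof.
move=> u0.
have := is_derive_sumf (fun r : 'I_k.+1 => is_derive_scalef (c r) (is_derive_logpow (k - r) u0)).
move/is_derive_eqd; apply; case: k => [|k].
  by rewrite big_ord1 mulr0.
rewrite big_ord_recr/= subnn mulr0 addr0 /logpoly mulr_suml.
apply: eq_bigr => i _; have ik : (i <= k)%N by rewrite -ltnS.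
by rewrite (subSn ik) mulrA.
Qed.

Lemma is_derive_dlp kap c j k u : 0 < u ->
  is_derive u 1 (dlp kap c j k) (dlp kap c j.+1 k u).
Proof.
elim: j k u => [|j IH] k u u0.
  have dX : is_derive u 1 (fun y => y ^+ kap) (kap%:R * u ^+ kap / u).
    case: kap => [|p].
      by rewrite !mul0r; apply: is_derive_constf.
    apply: is_derive_eqd (is_derive_expf p (is_derive_idf u)) _.
    by rewrite mulr1 exprS -mulrA [u * _ / u]mulrAC mulfV ?mul1r ?gt_eqF// -mulrA.
  apply: is_derive_eqd (is_derive_mulf dX (is_derive_logpoly c k u0)) _.
  rewrite dlpS /dlp_pred subr0 /=; case: k => [|k] /=; first by rewrite mulr0 add0r addr0; ring.
  by ring.
have dpred : is_derive u 1 (dlp_pred kap c j k) (dlp_pred kap c j.+1 k u).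
  by case: k => [|k]; [exact: is_derive_constf|exact: IH].
have u2 : u != 0 by rewrite gt_eqF.
rewrite (_ : dlp kap c j.+1 k =
  fun y => ((kap%:R - j%:R) * dlp kap c j k y + dlp_pred kap c j k y) * y^-1); last first.
  by apply/funext => y; rewrite dlpS.
apply: is_derive_eqd (is_derive_mulf (is_derive_addf
  (is_derive_scalef (kap%:R - j%:R) (IH k u u0)) dpred)
  (is_derive_invf u2 (is_derive_idf u))) _.
rewrite -mulr_dlpS// [in RHS]dlpS -natr1; field.
exact: u2.
Qed.

Lemma dlp_bound kap c j k : exists2 C : R, 0 <= C & forall u, 1 <= u ->
  `|dlp kap c j k u| <= C * ((1 + ln u) ^+ k * (u ^+ kap / u ^+ j)).
Proof.
elim: j k => [|j IH] k.
  exists (\sum_(r < k.+1) `|c r|); first by apply: sumr_ge0.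
  move=> u u1; have u0 : 0 < u by exact: lt_le_trans u1.
  rewrite /= expr0 divr1 normrM normrX (ger0_norm (ltW u0)) mulrA mulrC.
  apply: ler_wpM2r; first by rewrite exprn_ge0// ltW.
  apply: (le_trans (ler_norm_sum _ _ _)); rewrite mulr_suml; apply: ler_sum => r _.
  rewrite normrM; apply: ler_wpM2l => //.
  rewrite /logpow normrM normfV normr_nat normrX (ger0_norm (ln_ge0 u1)).
  rewrite ler_pdivrMr ?ltr0n ?fact_gt0//.
  apply: (@le_trans _ _ ((1 + ln u) ^+ k)); last first.
    by rewrite ler_peMr ?exprn_ge0 ?(le_trans ler01 (ltr01_ln u1))// ler1n fact_gt0.
  apply: (@le_trans _ _ ((1 + ln u) ^+ (k - r))).
    by rewrite lerXn2r ?nnegrE ?ln_ge0 ?(le_trans ler01 (ltr01_ln u1))// lerDr.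
  by apply: ler_1ln_exp => //; exact: leq_subr.
have [C C0 Ck] := IH k.
have [C' C'0 Ck'] : exists2 C : R, 0 <= C & forall u, 1 <= u ->
    `|dlp_pred kap c j k u| <= C * ((1 + ln u) ^+ k * (u ^+ kap / u ^+ j)).
  case: k {C C0 Ck} => [|k]; first by exists 0 => // u _; rewrite normr0 mul0r.
  have [C C0 Ck] := IH k; exists C => // u u1; apply: (le_trans (Ck u u1)).
  have u0 : 0 < u by exact: lt_le_trans u1.
  apply: ler_wpM2l => //; apply: ler_wpM2r; last exact: ler_1ln_exp.
  by rewrite divr_ge0// exprn_ge0// ltW.
exists (`|kap%:R - j%:R| * C + C') => [|u u1]; first by rewrite addr_ge0// mulr_ge0.
have u0 : 0 < u by exact: lt_le_trans u1.
rewrite dlpS normrM normfV (ger0_norm (ltW u0)) ler_pdivrMr//.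
rewrite exprSr invfM -!mulrA mulVf ?mulr1 ?gt_eqF//.
apply: (le_trans (ler_normD _ _)); rewrite [leRHS]mulrDl; apply: lerD; last exact: Ck'.
by rewrite normrM -mulrA; apply: ler_wpM2l => //; exact: Ck.
Qed.

(** With these signs [u^kap logpoly (logcoef kap) k u] is the coefficient of [z^k] in
    [e^(-gamma z) u^(kap+z) / Gamma(kap+1+z)]. *)
Definition logcoef kap (r : nat) : R := (-1) ^+ r * Ccoef R r kap.

(** The derivative of [u^(kap+1+z)/Gamma(kap+2+z)] is [u^(kap+z)/Gamma(kap+1+z)]; on coefficients
    this is [Ccoef_rec]. *)
Lemma dlp_shift kap i k u : 0 < u ->
  dlp kap.+1 (logcoef kap.+1) i.+1 k u = dlp kap (logcoef kap) i k u.
Proof.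
move=> u0; elim: i k => [|i IH] k.
  rewrite dlpS /= subr0.
  rewrite (_ : dlp_pred _ _ _ _ _ = u ^+ kap.+1 *
    \sum_(r < k) logcoef kap.+1 r * logpow (k - r.+1) u); last first.
    by case: k => [|k] /=; rewrite ?big_ord0 ?mulr0.
  transitivity (u ^+ kap * (kap.+1%:R * logpoly (logcoef kap.+1) k u
     + \sum_(r < k) logcoef kap.+1 r * logpow (k - r.+1) u)).
    by rewrite exprS; field; rewrite gt_eqF.
  congr (_ * _).
  rewrite /logpoly mulr_sumr big_ord_recl [in RHS]big_ord_recl.
  rewrite -addrA -big_split/=; congr (_ + _).
    by rewrite /logcoef !expr0 !mul1r [in RHS]Ccoef_rec subr0 mulrA.
  apply: eq_bigr => r _; rewrite /bump/= add1n mulrA -mulrDl; congr (_ * _).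
  by rewrite /logcoef [in RHS]Ccoef_rec exprS; ring.
rewrite dlpS [RHS]dlpS IH (_ : dlp_pred _ _ i.+1 k u = dlp_pred kap (logcoef kap) i k u).
  by congr ((_ * _ + _) / _); rewrite -!natr1; ring.
by case: k.
Qed.

(** This and [dlp_ge] identify the derivatives in the main term: up to order [kap] they lower the
    exponent of u and produce the first sum of the theorem, and beyond it they produce the
    second. *)
Lemma dlp_le kap j k u : 0 < u -> (j <= kap)%N ->
  dlp kap (logcoef kap) j k u = u ^+ (kap - j) * logpoly (logcoef (kap - j)) k u.
Proof.
move=> u0; elim: j kap => [|j IH] [|kap] jk //=; rewrite ?subn0//.
by rewrite -/(dlp kap.+1 (logcoef kap.+1) j.+1 k u) dlp_shift// subSS IH.
Qed.

Lemma dlp_ge kap j k u : 0 < u ->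
  dlp kap (logcoef kap) (kap + j) k u = dlp 0 (logcoef 0) j k u.
Proof. by move=> u0; elim: kap => // kap IH; rewrite addSn dlp_shift. Qed.

(** The coefficient sequence 1, 0, 0, ... with [kap = 0] isolates a single power of the
    logarithm. *)
Lemma derive1n_ln j k u : 0 < u ->
  derive1n j (fun x : R => ln x ^+ k) u = k`!%:R * dlp 0 (fun r => (r == 0)%N%:R) j k u.
Proof.
move=> u0; pose F j y := k`!%:R * dlp 0 (fun r => (r == 0)%N%:R) j k y.
have F0 : F 0%N = fun x : R => ln x ^+ k.
  apply/funext => y; rewrite /F /= expr0 mul1r /logpoly big_ord_recl big1 ?addr0.
    by rewrite mul1r subn0 /logpow mulrC divfK// pnatr_eq0 -lt0n fact_gt0.
  by move=> i _; rewrite mul0r.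
have [|_] := @tower_smooth R F u _ j; last by rewrite F0.
move=> n; apply: filterS (lt_nbhsr u0) => y y0.
exact/is_derive_scalef/is_derive_dlp.
Qed.

Lemma dlp0_sum c j k u : 0 < u -> dlp 0 c j k u =
  \sum_(r < k.+1) c r / (k - r)`!%:R * derive1n j (fun x : R => ln x ^+ (k - r)) u.
Proof.
move=> u0.
have fk n : n`!%:R != 0 :> R by rewrite pnatr_eq0 -lt0n fact_gt0.
under eq_bigr do rewrite derive1n_ln// mulrA divfK//.
elim: j k => [|j IH] k.
  rewrite /= expr0 mul1r; apply: eq_bigr => r _; congr (_ * _).
  rewrite mul1r /logpoly big_ord_recl big1 ?addr0; first by rewrite mul1r subn0.
  by move=> i _; rewrite mul0r.
pose D := dlp 0 (fun r => (r == 0)%N%:R).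
rewrite dlpS IH [RHS](eq_bigr (fun r : 'I_k.+1 => ((0%:R - j%:R) * (c r * D j (k - r)%N u)
  + c r * dlp_pred 0 (fun r => (r == 0)%N%:R) j (k - r) u) / u)); last first.
  by move=> r _; rewrite dlpS; rewrite /D; ring.
rewrite -mulr_suml big_split/= -mulr_sumr; congr ((_ + _) / _).
case: k => [|k]; first by rewrite big_ord1 /= mulr0.
rewrite big_ord_recr/= subnn mulr0 addr0 IH.
by apply: eq_bigr => r _; rewrite subSn// -ltnS.
Qed.

End logpoly.

(** * The main term *)

Section dominated.
Variable R : realType.
Implicit Types (f g h : R -> R) (A : R).

(** A big O with its half-line made explicit: the theorem asks for one constant on a fixed
    half-line, and translation by 1 moves the induction from [u >= 1] to [u >= 2]. *)
Definition dominated A f g :=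
  exists2 C : R, 0 <= C & forall u, A <= u -> `|f u| <= C * g u.

Lemma dominated_ext A f1 f2 g : (forall u, A <= u -> f1 u = f2 u) ->
  dominated A f1 g -> dominated A f2 g.
Proof. by move=> f12 [C C0 fC]; exists C => // u Au; rewrite -f12// fC. Qed.

Lemma dominated_le A f g h K : 0 <= K -> (forall u, A <= u -> g u <= K * h u) ->
  dominated A f g -> dominated A f h.
Proof.
move=> K0 gh [C C0 fC]; exists (C * K) => [|u Au]; first exact: mulr_ge0.
by rewrite (le_trans (fC u Au))// -mulrA ler_wpM2l// gh.
Qed.

Lemma dominatedW A B f g : A <= B -> dominated A f g -> dominated B f g.
Proof. by move=> AB [C C0 fC]; exists C => // u Bu; rewrite fC// (le_trans AB). Qed.

Lemma dominatedD A f1 f2 g : dominated A f1 g -> dominated A f2 g ->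
  dominated A (fun u => f1 u + f2 u) g.
Proof.
move=> [C C0 fC] [D D0 fD]; exists (C + D) => [|u Au]; first exact: addr_ge0.
by rewrite (le_trans (ler_normD _ _))// mulrDl lerD ?fC ?fD.
Qed.

Lemma dominatedZ A c f g : dominated A f g -> dominated A (fun u => c * f u) g.
Proof.
move=> [C C0 fC]; exists (`|c| * C) => [|u Au]; first exact: mulr_ge0.
by rewrite normrM -mulrA ler_wpM2l// fC.
Qed.

Lemma dominated_sum A n (f : 'I_n -> R -> R) g : (forall u, A <= u -> 0 <= g u) ->
  (forall i, dominated A (f i) g) -> dominated A (fun u => \sum_(i < n) f i u) g.
Proof.
move=> g0; elim: n f => [|n IH] f fg.
  by exists 0 => // u Au; rewrite big_ord0 normr0 mul0r.
apply: (@dominated_ext _ (fun u => \sum_(i < n) f (widen_ord (leqnSn n) i) u + f ord_max u)).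
  by move=> u _; rewrite big_ord_recr.
by apply: dominatedD => //; apply: IH.
Qed.

End dominated.

(** * Differential equation and translation of the main term *)

Section main_terms.
Variable R : realType.
Implicit Types (kap N l : nat) (u : R).

Local Notation P kap := (@dlp R kap (logcoef R kap)).

Definition main_term kap N l u : R := kap`!%:R *
  \sum_(m < l.+1) \sum_(n < N.+1) Ecoef R n m / m`!%:R * P kap n (l - m)%N u.

Definition dmain_term kap N l u : R := kap`!%:R *
  \sum_(m < l.+1) \sum_(n < N.+1) Ecoef R n m / m`!%:R * P kap n.+1 (l - m)%N u.

(** By [EcoefS] the bracket is the coefficient of [z^n] in [Ein^m e^(-z) / m!]. This is thus
    [main_term] translated by 1, with [e^(-d/du)] expanded and cut at order N. *)
Definition main_term_shift kap N l u : R := kap`!%:R *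
  \sum_(m < l.+1) \sum_(n < N.+1)
    (Ecoef R n m / m`!%:R - n%:R * Ecoef R n m.+1 / (m.+1)`!%:R) * P kap n (l - m)%N u.

Lemma is_derive_main_term kap N l u : 0 < u ->
  is_derive u 1 (main_term kap N l) (dmain_term kap N l u).
Proof.
move=> u0; apply: is_derive_scalef; apply: is_derive_sumf => m.
by apply: is_derive_sumf => n; apply: is_derive_scalef; exact: is_derive_dlp.
Qed.

(** Exact, with no truncation error. By [mulr_dlpS] the factor [kap] cancels, leaving a multiple by
    [-n] and a term of lower degree. The former is reindexed by [m -> m+1], its term [m = 0] being
    zero because [n E_{n,0} = 0]; the latter is zero at [m = l+1], where the degree is already 0. *)
Lemma main_term_ode kap N l u : 0 < u ->
  u * dmain_term kap N l.+1 u - kap%:R * main_term kap N l.+1 u =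
  main_term_shift kap N l u.
Proof.
move=> u0; rewrite /dmain_term /main_term /main_term_shift.
rewrite mulrCA [kap%:R * _]mulrCA -mulrBr; congr (_ * _).
pose X m n := n%:R * Ecoef R n m / m`!%:R * P kap n (l.+1 - m)%N u.
pose Y m n := Ecoef R n m / m`!%:R * dlp_pred kap (logcoef R kap) n (l.+1 - m)%N u.
transitivity (\sum_(m < l.+2) \sum_(n < N.+1) Y m n - \sum_(m < l.+2) \sum_(n < N.+1) X m n).
  rewrite !mulr_sumr -!sumrB; apply: eq_bigr => m _.
  rewrite !mulr_sumr -!sumrB; apply: eq_bigr => n _.
  rewrite mulrCA mulr_dlpS// /X /Y; ring.
rewrite big_ord_recr/= [X in _ + X - _]big1 ?addr0; last first.
  by move=> n _; rewrite /Y subnn mulr0.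
rewrite [X in _ - X]big_ord_recl [X in _ - (X + _)]big1 ?add0r; last first.
  move=> n _; rewrite /X; case: (nat_of_ord n) => [|k]; first by rewrite !mul0r.
  by rewrite Ecoef_m0 mulr0 !mul0r.
rewrite -sumrB; apply: eq_bigr => m _; rewrite -sumrB; apply: eq_bigr => n _.
rewrite /X /Y subSS subSn -1?ltnS// /=; ring.
Qed.

(** The expansion starts at order n and stops so that the remainder always involves the derivative
    of order [N+1]. For [u >= 2], each x in [[u-1, u]] satisfies [u <= 2x], whence the factor
    [2^(N+1)]. *)
Lemma dlp_taylor kap N n k : (n <= N)%N -> dominated 2
  (fun u => P kap n k (u - 1) - \sum_(s < N.+1 | (n <= s)%N)
     (-1) ^+ (s - n) / (s - n)`!%:R * P kap s k u)
  (fun u => (1 + ln u) ^+ k * (u ^+ kap / u ^+ N.+1)).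
Proof.
move=> nN; have [C C0 Cle] := dlp_bound kap (logcoef R kap) N.+1 k.
exists (C * 2 ^+ N.+1) => [|u u2]; first by rewrite mulr_ge0// exprn_ge0.
have u0 : 0 < u by exact: lt_le_trans u2.
rewrite (_ : \sum_(s < N.+1 | _) _ =
    \sum_(i < (N - n).+1) (-1) ^+ i / i`!%:R * P kap (n + i) k u); last first.
  rewrite -(big_mkord (fun s => (n <= s)%N)
     (fun s => (-1) ^+ (s - n) / (s - n)`!%:R * P kap s k u)).
  transitivity (\sum_(n <= s < N.+1) (-1) ^+ (s - n) / (s - n)`!%:R * P kap s k u).
    by rewrite (big_nat_widenl _ _ _ _ _ (leq0n n)).
  rewrite -{1}[n]add0n big_addn big_mkord subSn//.
  by apply: eq_bigr => i _; rewrite addnK addnC.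
rewrite -{1}[n]addn0.
apply: (taylor_backward (F := fun i => P kap (n + i) k)).
  move=> i x /andP[ux _]; rewrite addnS; apply: is_derive_dlp.
  by apply: lt_le_trans ux; lra.
move=> x /andP[ux xu]; rewrite addnS subnKC//.
have x1 : 1 <= x by lra.
have x0 : 0 < x by exact: lt_le_trans x1.
apply: (le_trans (Cle x x1)); rewrite -mulrA; apply: ler_wpM2l => //.
rewrite [leRHS]mulrCA; apply: ler_pM.
- by rewrite exprn_ge0// (le_trans ler01 (ltr01_ln x1)).
- by rewrite divr_ge0// exprn_ge0// ltW.
- exact: ler_ln_exp.
rewrite [leRHS]mulrCA; apply: ler_pM.
- by rewrite exprn_ge0// ltW.
- by rewrite invr_ge0 exprn_ge0// ltW.
- by rewrite lerXn2r ?nnegrE// ltW.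
rewrite -exprVn -exprVn -exprMn lerXn2r ?nnegrE ?mulr_ge0 ?invr_ge0 ?(ltW u0) ?(ltW x0)//.
rewrite -[leLHS]mul1r ler_pdivrMr// mulrAC ler_pdivlMr//; lra.
Qed.

Lemma main_term_shiftP kap N l : dominated 2
  (fun u => main_term kap N l (u - 1) - main_term_shift kap N l u)
  (fun u => (1 + ln u) ^+ l * (u ^+ kap / u ^+ N.+1)).
Proof.
pose t i : R := (-1) ^+ i / i`!%:R.
apply: (@dominated_ext _ _ (fun u => kap`!%:R * \sum_(m < l.+1) \sum_(n < N.+1)
    Ecoef R n m / m`!%:R * (P kap n (l - m)%N (u - 1) -
     \sum_(s < N.+1 | (n <= s)%N) t (s - n)%N * P kap s (l - m)%N u))).
  move=> u u2; rewrite /main_term /main_term_shift -mulrBr; congr (_ * _).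
  rewrite -sumrB; apply: eq_bigr => m _.
  under eq_bigr do rewrite mulrBr.
  rewrite sumrB; congr (_ - _).
  under eq_bigr do rewrite mulr_sumr.
  (* Collecting the derivative of order s leaves the convolution of [Ecoef R n m] with the
     coefficients of [e^(-z)], which [EcoefS] evaluates. *)
  rewrite (exchange_big_dep xpredT)//=; apply: eq_bigr => s _.
  under eq_bigr do rewrite mulrA.
  rewrite -mulr_suml; congr (_ * _).
  rewrite -(big_ord_widen N.+1 (fun n => Ecoef R n m / m`!%:R * t (s - n)%N) (ltn_ord s)).
  under eq_bigr do rewrite mulrAC.
  rewrite -mulr_suml EcoefS factS natrM /t; field.
  by rewrite -[1 + m%:R]/(1%:R + m%:R) -natrD !pnatr_eq0 -lt0n fact_gt0.
have g0 u : 2 <= u -> 0 <= (1 + ln u) ^+ l * (u ^+ kap / u ^+ N.+1).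
  move=> u2; have u1 : 1 <= u by lra.
  have u0 : 0 < u by lra.
  by rewrite mulr_ge0 ?divr_ge0 ?exprn_ge0 ?(le_trans ler01 (ltr01_ln u1))// ltW.
apply: dominatedZ; apply: dominated_sum => // m.
apply: dominated_sum => // n; apply: dominatedZ.
apply: dominated_le ler01 _ (dlp_taylor kap (l - m) _); last by rewrite -ltnS.
move=> u u2; rewrite mul1r; have u1 : 1 <= u by lra.
have u0 : 0 < u by lra.
by apply: ler_wpM2r; [rewrite divr_ge0 ?exprn_ge0 ?ltW|apply: ler_1ln_exp => //; exact: leq_subr].
Qed.

Lemma dlp_dominated kap n k l : (k <= l)%N -> dominated 1 (P kap n k)
  (fun u => (1 + ln u) ^+ l * (u ^+ kap / u ^+ n)).
Proof.
move=> kl; have [C C0 Cle] := dlp_bound kap (logcoef R kap) n k.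
exists C => // u u1; apply: (le_trans (Cle u u1)); apply: ler_wpM2l => //.
apply: ler_wpM2r; last exact: ler_1ln_exp.
have u0 : 0 < u by exact: lt_le_trans u1.
by rewrite divr_ge0 ?exprn_ge0 ?ltW.
Qed.

Lemma bound_fun_ge0 kap n l u : 1 <= u -> 0 <= (1 + ln u) ^+ l * (u ^+ kap / u ^+ n).
Proof.
move=> u1; have u0 : 0 < u by exact: lt_le_trans u1.
by rewrite mulr_ge0 ?divr_ge0 ?exprn_ge0 ?(le_trans ler01 (ltr01_ln u1))// ltW.
Qed.

Lemma main_termS kap N l u : main_term kap N.+1 l u = main_term kap N l u +
  kap`!%:R * \sum_(m < l.+1) Ecoef R N.+1 m / m`!%:R * P kap N.+1 (l - m)%N u.
Proof.
rewrite /main_term -mulrDr -big_split/=; congr (_ * _).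
by apply: eq_bigr => m _; rewrite big_ord_recr.
Qed.

Lemma main_termS_dominated kap N l : dominated 1
  (fun u => main_term kap N.+1 l u - main_term kap N l u)
  (fun u => (1 + ln u) ^+ l * (u ^+ kap / u ^+ N.+1)).
Proof.
apply: (@dominated_ext _ _ (fun u => kap`!%:R * \sum_(m < l.+1) Ecoef R N.+1 m / m`!%:R * P kap N.+1 (l - m)%N u)).
  by move=> u _; rewrite main_termS [main_term _ _ _ _ + _]addrC addrK.
apply: dominatedZ; apply: dominated_sum => [u u1|m]; first exact: bound_fun_ge0.
by apply: dominatedZ; apply: dlp_dominated; exact: leq_subr.
Qed.

Lemma main_term0 kap l u : main_term kap 0 l u =
  kap`!%:R * (u ^+ kap * logpoly (logcoef R kap) l u).
Proof.
rewrite /main_term; congr (_ * _).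
under eq_bigr do rewrite big_ord1.
rewrite big_ord_recl big1 ?addr0 => [|m _]; last by rewrite Ecoef_0m !mul0r.
by rewrite Ecoef_m0 fact0 divr1 mul1r subn0.
Qed.

Lemma main_termE kap J l u : 0 < u -> main_term kap (kap + J) l u =
  (\sum_(0 <= m < l.+1) \sum_(m <= n < kap.+1) \sum_(0 <= r < (l - m).+1)
     ((-1) ^+ r * (kap`!)%:R * Ecoef R n m / ((m`!)%:R * ((l - m - r)`!)%:R))
     * Ccoef R r (kap - n) * u ^+ (kap - n) * ln u ^+ (l - m - r))
  + (\sum_(1 <= j < J.+1) \sum_(0 <= m < l.+1) \sum_(0 <= r < (l - m).+1)
     ((-1) ^+ r * (kap`!)%:R * Ecoef R (kap + j) m
        / ((m`!)%:R * ((l - m - r)`!)%:R))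
     * C0coef R r * derive1n j (fun x : R => ln x ^+ (l - m - r)) u).
Proof.
move=> u0.
have fk n : n`!%:R != 0 :> R by rewrite pnatr_eq0 -lt0n fact_gt0.
rewrite [X in _ = _ + X]exchange_big/= -big_split/= /main_term mulr_sumr big_mkord.
apply: eq_bigr => m _.
pose f n := kap`!%:R * (Ecoef R n m / m`!%:R * P kap n (l - m)%N u).
transitivity (\sum_(0 <= n < (kap + J).+1) f n).
  by rewrite big_mkord mulr_sumr.
rewrite (@big_cat_nat _ _ _ kap.+1)//=; last by rewrite ltnS leq_addr.
congr (_ + _).
  have f0 n : (n < m)%N -> f n = 0 by move=> nm; rewrite /f Ecoef_lt// !mul0r mulr0.
  transitivity (\sum_(m <= n < kap.+1) f n).
    case: (leqP m kap.+1) => mk.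
      rewrite (@big_cat_nat _ _ _ m 0 kap.+1)//= big_nat_cond big1 ?add0r// => n.
      by rewrite andbT => /andP[_]; exact: f0.
    rewrite [RHS]big_geq ?(ltnW mk)// big_nat_cond big1// => n.
    by rewrite andbT => /andP[_ nk]; apply: f0; exact: ltn_trans mk.
  apply: eq_big_nat => n /andP[_ nk]; rewrite /f dlp_le// big_mkord /logpoly !mulr_sumr.
  apply: eq_bigr => r _; rewrite /logcoef /logpow; field.
  by rewrite !fk.
rewrite -[kap.+1]add1n -addnS [(kap + _)%N]addnC big_addn addnK.
apply: eq_bigr => j _; rewrite addnC /f dlp_ge// dlp0_sum// big_mkord !mulr_sumr.
apply: eq_bigr => r _; rewrite /logcoef /C0coef; field.
by rewrite !fk.
Qed.

End main_terms.

(** * The integrals K *)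

Section kint.
Variable R : realType.
Notation mu := (@lebesgue_measure R).
Local Open Scope ereal_scope.

Local Notation pushforward_measure :=
  measure_function_pushforward__canonical__measure_function_Measure.

Definition ge1 : set R := [set t : R | (1 <= t)%R].

Lemma ge1_itv : ge1 = `[1%R, +oo[%classic.
Proof. by apply/seteqP; split => t /=; rewrite in_itv/= andbT. Qed.

Lemma measurable_ge1 : measurable (ge1 : set (measurableTypeR R)).
Proof. by rewrite ge1_itv. Qed.

Lemma measurable_integral_section (B : set R) (f : R -> R -> \bar R) :
  measurable (B : set (measurableTypeR R)) ->
  measurable_fun (setT `*` B) (fun z => f z.1 z.2) ->
  (forall x y, B y -> 0 <= f x y) ->
  measurable_fun setT (fun x => \int[mu]_(y in B) f x y).
Proof.
move=> mB mf f0.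
pose g := (fun z : R * R => f z.1 z.2) \_ (setT `*` B).
have mg : measurable_fun setT g.
  by apply/(measurable_restrictT _ _).1 => //; exact: measurableX.
have g0 z : 0 <= g z.
  by rewrite /g patchE; case: ifPn => //; rewrite inE => -[_ /= Bz]; exact: f0.
have := measurable_fun_fubini_tonelli_F (m2 := mu) g mg g0.
rewrite (_ : fubini_F _ _ = fun x => \int[mu]_(y in B) f x y)//.
apply/funext => x; rewrite /fubini_F [RHS]integral_mkcond; apply: eq_integral => y _.
by rewrite /g !patchE in_setX in_setT.
Qed.

Lemma measurable_funV_ge1 : measurable_fun ge1 (@GRing.inv R).
Proof.
rewrite ge1_itv; apply: subspace_continuous_measurable_fun => //.
apply: continuous_in_subspaceT => x; rewrite inE/= in_itv/= andbT => x1.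
apply: inv_continuous; rewrite gt_eqF//; exact: lt_le_trans x1.
Qed.

Lemma Kint_ge0 l kap (u : R) : 0 <= Kint l kap u.
Proof.
elim: l u => [|l IH] u /=; first by case: ifPn => // u0; rewrite lee_fin exprn_ge0.
apply: integral_ge0 => t t1; apply: mule_ge0; first exact: IH.
by rewrite lee_fin invr_ge0 (le_trans ler01).
Qed.

Lemma Kint_lt0 l kap (u : R) : (u < 0)%R -> Kint l kap u = 0.
Proof.
elim: l u => [|l IH] u u0 /=; first by rewrite leNgt u0.
apply: integral0_eq => t t1; rewrite IH ?mul0e//.
by rewrite subr_lt0 (lt_le_trans u0)// (le_trans ler01).
Qed.

Lemma measurable_Kint l kap : measurable_fun setT (@Kint R l kap).
Proof.
elim: l => [|l IH] /=.
  apply: measurable_fun_ifT => //; first exact: measurable_fun_ler.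
  by apply/measurable_EFinP; exact: measurable_funX.
apply: (@measurable_integral_section ge1 (fun u t => Kint l kap (u - t) * (t^-1)%:E)).
- exact: measurable_ge1.
- apply: emeasurable_funM.
    apply: measurable_funTS; apply: (measurableT_comp IH).
    by apply: measurable_funB.
  apply/measurable_EFinP.
  apply: (measurable_comp (F := ge1)); [exact: measurable_ge1| |exact: measurable_funV_ge1|exact: measurable_funTS].
  by move=> _ /= [z [_ Bz] <-].
- move=> x y y1; apply: mule_ge0; first exact: Kint_ge0.
  by rewrite lee_fin invr_ge0 (le_trans ler01).
Qed.

Lemma measurable_Kint_conv (phi : R -> \bar R) l kap : measurable_fun setT phi ->
  measurable_fun (setT `*` ge1)
    (fun z : R * R => phi z.1 * (Kint l kap (z.1 - z.2) * (z.2^-1)%:E)).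
Proof.
move=> mphi; apply: emeasurable_funM.
  by apply: measurable_funTS; apply: (measurableT_comp mphi).
apply: emeasurable_funM.
  apply: measurable_funTS; apply: (measurableT_comp (measurable_Kint l kap)).
  by apply: measurable_funB.
apply/measurable_EFinP.
apply: (measurable_comp (F := ge1)); [exact: measurable_ge1| |exact: measurable_funV_ge1|exact: measurable_funTS].
by move=> _ /= [z [_ Bz] <-].
Qed.

Lemma measurable_subr (u : R) : measurable_fun setT (fun t : R => u - t)%R.
Proof. exact: measurable_funB. Qed.

Lemma measurable_Kint_subr l kap (u : R) :
  measurable_fun setT (fun t : R => Kint l kap (u - t)).
Proof. exact: (measurableT_comp (measurable_Kint l kap) (measurable_subr u)). Qed.

Lemma KintS l kap (u : R) : Kint l.+1 kap u =
  \int[mu]_(t in ge1) (Kint l kap (u - t) * (t^-1)%:E).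
Proof. by []. Qed.

(** The convolution recursion tested against an arbitrary nonnegative [phi]: indicators of
    half-lines give the primitives of K, exponentials its Laplace transform. *)
Lemma integral_KintS (phi : R -> \bar R) l kap : measurable_fun setT phi ->
  (forall x, 0 <= phi x) ->
  \int[mu]_u (phi u * Kint l.+1 kap u) =
  \int[mu]_(t in ge1) ((t^-1)%:E * \int[mu]_v (phi (v + t)%R * Kint l kap v)).
Proof.
move=> mphi phi0.
have V0 (t : R) : ge1 t -> 0 <= (t^-1)%:E by move=> t1; rewrite lee_fin invr_ge0 (le_trans ler01).
transitivity (\int[mu]_u \int[mu]_(t in ge1) (phi u * (Kint l kap (u - t) * (t^-1)%:E))).
  apply: eq_integral => u _; rewrite KintS -ge0_integralZl//.
  - exact: measurable_ge1.
  - apply: emeasurable_funM; first by apply: measurable_funTS; exact: measurable_Kint_subr.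
    by apply/measurable_EFinP; exact: measurable_funV_ge1.
  - by move=> t t1; rewrite mule_ge0 ?Kint_ge0 ?V0.
rewrite (tonelli_rect measurableT measurable_ge1); last 2 first.
- exact: measurable_Kint_conv.
- by move=> u t _ t1; rewrite !mule_ge0 ?Kint_ge0 ?V0.
apply: eq_integral => t /[!inE] t1.
have mf : measurable_fun setT (fun u : R => phi u * Kint l kap (u - t)).
  apply: emeasurable_funM => //; apply: (measurableT_comp (measurable_Kint l kap)).
  exact: measurable_funB.
under eq_integral do rewrite muleA muleC.
rewrite ge0_integralZl//; last 2 first.
- by move=> u _; rewrite mule_ge0 ?Kint_ge0.
- exact: V0.
congr (_ * _); rewrite -(@ge0_integral_addr _ t _ mf); last first.
  by move=> u; rewrite mule_ge0 ?Kint_ge0.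
by apply: eq_integral => v _; rewrite addrK.
Qed.

(** Only t in [[1, u]] contributes, and [1/t <= 1] there. This crude bound suffices for finiteness
    and for bounded ranges of u. *)
Lemma Kint_le l kap (u : R) : (0 <= u)%R -> Kint l kap u <= (u ^+ (kap + l))%:E.
Proof.
elim: l u => [|l IH] u u0; first by rewrite /= u0 addn0.
apply: (@le_trans _ _ (\int[mu]_(t in `[0%R, u]) (cst (u ^+ (kap + l))%:E t))); last first.
  rewrite integral_cst//= lebesgue_measure_itv/= lte_fin.
  case: ifPn => [_|]; first by rewrite oppr0 adde0 -EFinM addnS exprSr.
  by rewrite mule0 lee_fin exprn_ge0.
rewrite KintS integral_mkcond [leRHS]integral_mkcond; apply: ge0_le_integral => //.
- move=> t _; rewrite patchE; case: ifPn => //; rewrite inE => t1.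
  by rewrite mule_ge0 ?Kint_ge0// lee_fin invr_ge0 (le_trans ler01).
- apply/(measurable_restrictT _ _).1; first exact: measurable_ge1.
  apply: emeasurable_funM; first by apply: measurable_funTS; exact: measurable_Kint_subr.
  by apply/measurable_EFinP; exact: measurable_funV_ge1.
- by apply/(measurable_restrictT _ _).1.
move=> t _; rewrite patchE; case: ifPn; rewrite patchE; last first.
  by case: ifPn => // _ _; rewrite lee_fin exprn_ge0.
rewrite inE => t1; have t0 : (0 < t)%R by exact: lt_le_trans t1.
case: ifPn; last first.
  rewrite notin_setE/= in_itv/= (ltW t0)/= => /negP; rewrite -ltNge => ut.
  by rewrite Kint_lt0 ?mul0e// subr_lt0.
rewrite inE/= in_itv/= => /andP[_ tu].
rewrite -[leRHS]mule1; apply: lee_pmul; rewrite ?Kint_ge0 ?lee_fin ?invr_ge0 ?(ltW t0)//.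
  apply: (le_trans (IH _ _)); first by rewrite subr_ge0.
  by rewrite lee_fin lerXn2r ?nnegrE ?subr_ge0// lerBlDr lerDl ltW.
by rewrite invf_le1.
Qed.

Lemma Kint_fin_num l kap (u : R) : Kint l kap u \is a fin_num.
Proof.
rewrite ge0_fin_numE ?Kint_ge0//; have [u0|u0] := ltP u 0%R; first by rewrite Kint_lt0.
by rewrite (le_lt_trans (Kint_le l kap u0))// ltry.
Qed.

Definition step (u v : R) : \bar R := if (v <= u)%R then 1 else 0.

Lemma measurable_step (u : R) : measurable_fun setT (step u).
Proof. by apply: measurable_fun_ifT => //; exact: measurable_fun_ler. Qed.

Lemma step_ge0 (u v : R) : 0 <= step u v.
Proof. by rewrite /step; case: ifP. Qed.

(** Primitives allow the delay equation to be proved in integrated form, before any regularity of K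
    is available. *)
Definition Kint_primitive l kap (u : R) : \bar R :=
  \int[mu]_(v in `]-oo, u]) Kint l kap v.

Lemma Kint_primitiveE l kap (u : R) : Kint_primitive l kap u =
  \int[mu]_v (step u v * Kint l kap v).
Proof.
rewrite /Kint_primitive integral_mkcond; apply: eq_integral => v _.
by rewrite patchE /step mem_setE/= in_itv/=; case: ifPn; rewrite ?mul1e ?mul0e.
Qed.

Lemma Kint_primitive_ge0 l kap (u : R) : 0 <= Kint_primitive l kap u.
Proof. by apply: integral_ge0 => v _; exact: Kint_ge0. Qed.

Lemma Kint_primitive_lt0 l kap (u : R) : (u < 0)%R -> Kint_primitive l kap u = 0.
Proof.
move=> u0; apply: integral0_eq => v; rewrite /= in_itv/= => vu.
by rewrite Kint_lt0// (le_lt_trans vu).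
Qed.

Lemma Kint_primitiveS l kap (u : R) : Kint_primitive l.+1 kap u =
  \int[mu]_(t in ge1) ((t^-1)%:E * Kint_primitive l kap (u - t)).
Proof.
rewrite Kint_primitiveE integral_KintS; last 2 first.
- exact: measurable_step.
- exact: step_ge0.
apply: eq_integral => t _; rewrite Kint_primitiveE; congr (_ * _).
by apply: eq_integral => v _; rewrite /step lerBrDr.
Qed.

Lemma measurable_fun_oppr : measurable_fun setT (-%R : R -> R).
Proof. by apply: continuous_measurable_fun; exact: opp_continuous. Qed.

Lemma integral_reflect (f : R -> \bar R) : measurable_fun setT f ->
  (forall x, 0 <= f x) -> \int[mu]_x f (- x)%R = \int[mu]_x f x.
Proof.
move=> mf f0.
have mN : measurable_fun setT (-%R : measurableTypeR R -> measurableTypeR R).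
  exact: measurable_fun_oppr.
transitivity (\int[pushforward_measure mu mN]_x f x).
  by rewrite (@ge0_integral_pushforward _ _ _ _ R _ mN mu setT f).
by apply: eq_measure_integral => A mA _; exact: lebesgue_measureN.
Qed.

(** The substitution [v = u - t], made of a reflection and a translation. *)
Lemma integral_Kint_subr l kap (u : R) :
  \int[mu]_(t in ge1) Kint l kap (u - t) = Kint_primitive l kap (u - 1).
Proof.
pose f (v : R) : \bar R := step (u - 1) v * Kint l kap v.
have mf : measurable_fun setT f.
  by apply: emeasurable_funM; [exact: measurable_step|exact: measurable_Kint].
have f0 v : 0 <= f v by rewrite mule_ge0 ?Kint_ge0 ?step_ge0.
rewrite Kint_primitiveE -/f -(integral_reflect mf f0).
rewrite -(@ge0_integral_addr _ (- u) (fun x => f (- x)%R)); last 2 first.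
- by apply: (measurableT_comp mf); exact: measurable_fun_oppr.
- by move=> x; exact: f0.
rewrite integral_mkcond; apply: eq_integral => t _.
rewrite patchE /f /step opprD opprK [(- t + u)%R]addrC lerD2l lerN2.
rewrite (_ : (t \in ge1) = (1 <= t)%R); last by apply/idP/idP; rewrite inE.
by case: ifPn; rewrite ?mul1e ?mul0e.
Qed.

Lemma Kint0_primitive kap (u : R) : (0 <= u)%R ->
  Kint_primitive 0 kap u = (u ^+ kap.+1 / kap.+1%:R)%:E.
Proof.
move=> u0.
have -> : Kint_primitive 0 kap u = \int[mu]_(v in `[0%R, u]) (v ^+ kap)%:E.
  rewrite /Kint_primitive integral_mkcond [RHS]integral_mkcond.
  apply: eq_integral => v _; rewrite !patchE !mem_setE/= !in_itv/=.
  by case: (v <= u)%R; rewrite ?andbT ?andbF//; case: ifP.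
rewrite le_eqVlt in u0; case/predU1P : u0 => [<-|u0].
  by rewrite set_itv1 integral_set1 exprS mul0r mul0r.
have dF (x : R) : is_derive x 1%R (fun y => kap.+1%:R^-1 * y ^+ kap.+1)%R (x ^+ kap)%R.
  apply: is_derive_eqd (is_derive_scalef _ (is_derive_expf kap (is_derive_idf x))) _.
  by rewrite mulr1 mulKf// pnatr_eq0.
rewrite (integral_is_derive u0 dF); last by move=> x; exact: exprn_continuous.
by rewrite [(0 ^+ _)%R]exprS mul0r mulr0 sube0 mulrC.
Qed.

(* Induction on [l], writing [u = t + (u - t)] under the integral. *)
Lemma Kint_ode l kap (u : R) : u%:E * Kint l kap u =
  kap.+1%:R%:E * Kint_primitive l kap u +
  (if l is l'.+1 then l%:R%:E * Kint_primitive l' kap (u - 1) else 0).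
Proof.
elim: l u => [|l IH] u.
  rewrite adde0; have [u0|u0] := ltP u 0%R.
    by rewrite Kint_lt0// Kint_primitive_lt0// !mule0.
  rewrite Kint0_primitive//= u0 -!EFinM; congr EFin.
  by rewrite mulrCA mulfV ?mulr1 ?exprS// pnatr_eq0.
have [u0|u0] := ltP u 0%R.
  rewrite Kint_lt0// Kint_primitive_lt0// Kint_primitive_lt0 ?mule0 ?adde0//.
  by rewrite subr_lt0 (lt_trans u0).
have V0 (t : R) : ge1 t -> 0 <= (t^-1)%:E by move=> t1; rewrite lee_fin invr_ge0 (le_trans ler01).
have mV : measurable_fun ge1 (fun t : R => (t^-1)%:E).
  by apply/measurable_EFinP; exact: measurable_funV_ge1.
have mprim l' (a : R) : measurable_fun setT (fun t : R => Kint_primitive l' kap (a - t)).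
  apply: (measurableT_comp (f := Kint_primitive l' kap)); last exact: measurable_subr.
  rewrite (_ : Kint_primitive l' kap = fun x => \int[mu]_(y in setT) (step x y * Kint l' kap y)).
    apply: (@measurable_integral_section setT (fun x y => step x y * Kint l' kap y)) => //.
      rewrite setXTT; apply: emeasurable_funM.
        by apply: measurable_fun_ifT => //; exact: measurable_fun_ler.
      by apply: (measurableT_comp (measurable_Kint l' kap)).
    by move=> x y _; rewrite mule_ge0 ?Kint_ge0 ?step_ge0.
  by apply/funext => x; rewrite Kint_primitiveE.
have -> : u%:E * Kint l.+1 kap u =
    \int[mu]_(t in ge1) (Kint l kap (u - t) +
       (t^-1)%:E * ((u - t)%:E * Kint l kap (u - t))).
  rewrite KintS -ge0_integralZl//; last 3 first.
  - exact: measurable_ge1.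
  - by apply: emeasurable_funM => //; by apply: measurable_funTS; exact: measurable_Kint_subr.
  - by move=> t t1; rewrite mule_ge0 ?Kint_ge0 ?V0.
  apply: eq_integral => t /[!inE] t1.
  have t0 : (0 < t)%R by exact: lt_le_trans t1.
  rewrite -[Kint l kap (u - t)]fineK ?Kint_fin_num// -!EFinM -EFinD; congr EFin.
  by field; rewrite gt_eqF.
under eq_integral do rewrite IH.
have IH0 t : 0 <= kap.+1%:R%:E * Kint_primitive l kap (u - t) +
    (if l is l'.+1 then l%:R%:E * Kint_primitive l' kap (u - t - 1) else 0).
  rewrite adde_ge0// ?mule_ge0 ?Kint_primitive_ge0 ?lee_fin//.
  by case: (l) => // l'; rewrite mule_ge0 ?Kint_primitive_ge0 ?lee_fin.
have m2 : measurable_fun setT (fun t : R => if l is l'.+1 then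
    l%:R%:E * Kint_primitive l' kap (u - t - 1) else 0).
  case: (l) => [|l'] //; apply: emeasurable_funM => //.
  have := mprim l' (u - 1)%R; under [X in _ -> measurable_fun _ X]eq_fun do rewrite addrAC.
  by [].
have m1 : measurable_fun setT (fun t : R => kap.+1%:R%:E * Kint_primitive l kap (u - t)).
  by apply: emeasurable_funM => //; exact: mprim.
rewrite ge0_integralD//; last 5 first.
- exact: measurable_ge1.
- by move=> t _; exact: Kint_ge0.
- by apply: measurable_funTS; exact: measurable_Kint_subr.
- by move=> t t1; rewrite mule_ge0 ?V0.
- by apply: emeasurable_funM => //; apply: measurable_funTS; apply: emeasurable_funD.
rewrite integral_Kint_subr.
have -> : \int[mu]_(t in ge1) ((t^-1)%:E * (kap.+1%:R%:E * Kint_primitive l kap (u - t) +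
    (if l is l'.+1 then l%:R%:E * Kint_primitive l' kap (u - t - 1) else 0))) =
  kap.+1%:R%:E * Kint_primitive l.+1 kap u + l%:R%:E * Kint_primitive l kap (u - 1).
  under eq_integral => t t1.
    rewrite ge0_muleDr ?mule_ge0 ?Kint_primitive_ge0 ?lee_fin//; last first.
      by case: (l) => // l'; rewrite mule_ge0 ?Kint_primitive_ge0 ?lee_fin.
    over.
  rewrite ge0_integralD//; last 5 first.
  - exact: measurable_ge1.
  - by move=> t t1; rewrite !mule_ge0 ?V0 ?Kint_primitive_ge0 ?lee_fin.
  - by apply: emeasurable_funM => //; exact: measurable_funTS.
  - move=> t t1; rewrite mule_ge0 ?V0//.
    by case: (l) => // l'; rewrite mule_ge0 ?Kint_primitive_ge0 ?lee_fin.
  - by apply: emeasurable_funM => //; exact: measurable_funTS.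
  congr (_ + _).
    under eq_integral do rewrite muleCA.
    rewrite ge0_integralZl//; last 3 first.
    - exact: measurable_ge1.
    - by apply: emeasurable_funM => //; by apply: measurable_funTS; exact: mprim.
    - by move=> t t1; rewrite !mule_ge0 ?V0 ?Kint_primitive_ge0.
    by rewrite -Kint_primitiveS.
  case: (l) => [|l'].
    by rewrite mul0e integral0_eq// => t _; rewrite mule0.
  under eq_integral do rewrite muleCA.
  rewrite ge0_integralZl//; last 3 first.
  - exact: measurable_ge1.
  - apply: emeasurable_funM => //; apply: measurable_funTS.
    have := mprim l' (u - 1)%R; under [X in _ -> measurable_fun _ X]eq_fun do rewrite addrAC.
    by [].
  - by move=> t t1; rewrite !mule_ge0 ?V0 ?Kint_primitive_ge0.
  congr (_ * _); rewrite Kint_primitiveS; apply: eq_integral => t _.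
  by rewrite addrAC.
rewrite addeC -addeA; congr (_ + _).
rewrite -[l.+1]addn1 natrD EFinD ge0_muleDl ?lee_fin// mul1e.
by [].
Qed.

End kint.

(** * Finiteness and differentiability of K *)

Section kint_real.
Variable R : realType.
Notation mu := (@lebesgue_measure R).

Local Notation ge1 := (@ge1 R).
Local Notation pos := (@pos R).

Definition Kr l kap (u : R) : R := fine (Kint l kap u).

Lemma KrE l kap u : (Kr l kap u)%:E = Kint l kap u.
Proof. by rewrite fineK// Kint_fin_num. Qed.

Lemma Kr_ge0 l kap u : 0 <= Kr l kap u.
Proof. by rewrite -lee_fin KrE Kint_ge0. Qed.

Lemma Kr_le l kap u : 0 <= u -> Kr l kap u <= u ^+ (kap + l).
Proof. by move=> u0; rewrite -lee_fin KrE Kint_le. Qed.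

(** Both terms on the right of [Kint_ode] are nonnegative, and the left side is finite. *)
Lemma Kint_primitive_lty l kap (u : R) : (Kint_primitive l kap u < +oo)%E.
Proof.
have : (kap.+1%:R%:E * Kint_primitive l kap u < +oo)%E.
  apply: (@le_lt_trans _ _ (u%:E * Kint l kap u)%E).
    rewrite Kint_ode leeDl//; case: l => // l.
    by rewrite mule_ge0 ?Kint_primitive_ge0 ?lee_fin.
  by rewrite -KrE -EFinM ltry.
apply: contraTT; rewrite -!leNgt !leye_eq => /eqP ->.
by rewrite gt0_muley// lte_fin ltr0n.
Qed.

Lemma integrable_Kr l kap (a b : R) : mu.-integrable `[a, b] (EFin \o Kr l kap).
Proof.
rewrite (_ : EFin \o _ = Kint l kap); last by apply/funext => v; exact: KrE.
apply: (@integrableS _ _ _ mu `]-oo, b]) => //.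
  by apply: subset_itvr.
apply/integrableP; split; first by apply: measurable_funTS; exact: measurable_Kint.
under eq_integral do rewrite gee0_abs ?Kint_ge0//.
exact: Kint_primitive_lty.
Qed.

(* [Kr] vanishes on negative reals; the lower bound -1 keeps 0 an interior point. *)
Definition Kprim l kap (x : R) : R := Rintegral mu `[-1, x] (Kr l kap).

Lemma KprimE l kap x : (Kprim l kap x)%:E = Kint_primitive l kap x.
Proof.
have -> : Kprim l kap x = fine (Kint_primitive l kap x).
  congr fine; under eq_integral do rewrite KrE.
  rewrite integral_mkcond /Kint_primitive [RHS]integral_mkcond.
  apply: eq_integral => v _; rewrite !patchE !mem_setE/= !in_itv/=.
  case: (v <= x); rewrite ?andbT ?andbF//; case: (lerP (-1) v) => // v1.
  by rewrite Kint_lt0// (lt_trans v1)// ltrN10.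
by rewrite fineK// ge0_fin_numE ?Kint_primitive_ge0 ?Kint_primitive_lty.
Qed.

Lemma Kr_ode l kap u : u * Kr l kap u = kap.+1%:R * Kprim l kap u +
  (if l is l'.+1 then l%:R * Kprim l' kap (u - 1) else 0).
Proof.
apply: EFin_inj; rewrite EFinM KrE Kint_ode -KprimE EFinD EFinM.
by case: l => // l; rewrite -KprimE.
Qed.

Lemma continuous_Kprim l kap x : -1 < x -> {for x, continuous (Kprim l kap)}.
Proof.
move=> x1.
have x1' : -1 <= x + 1 by rewrite (le_trans (ltW x1))// lerDl.
have := parameterized_integral_continuous x1' (integrable_Kr l kap (-1) (x + 1)).
rewrite continuous_within_itvP; last by rewrite (lt_trans x1)// ltrDl.
have xin : x \in `]-1, x + 1[%R by rewrite in_itv/= x1 ltrDl ltr01.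
by move=> [cK _ _]; exact: (cK x xin).
Qed.

(** The start of a bootstrap: primitives are continuous, so by this formula K is continuous on []0,
    oo[]; hence the primitives are differentiable there, and by the same formula K is differentiable
    on []1, oo[]. *)
Lemma Kr_quot l kap y : 0 < y -> Kr l kap y = (kap.+1%:R * Kprim l kap y +
  (if l is l'.+1 then l%:R * Kprim l' kap (y - 1) else 0)) * y^-1.
Proof. by move=> y0; rewrite -Kr_ode mulrC mulKf// gt_eqF. Qed.

Lemma near_eq_continuous (f g : R -> R) (x : R) :
  (\forall y \near x, f y = g y) -> {for x, continuous f} -> {for x, continuous g}.
Proof.
move=> fg cf; have fgx := nbhs_singleton fg.
rewrite /prop_for /continuous_at -fgx; apply: cvg_trans cf.
by apply: near_eq_cvg.
Qed.

Lemma continuous_Kr l kap u : 0 < u -> {for u, continuous (Kr l kap)}.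
Proof.
move=> u0; apply: near_eq_continuous.
  apply: filterS (lt_nbhsr u0) => y y0; exact/esym/Kr_quot.
have u1 : -1 < u by rewrite (lt_trans _ u0)// ltrN10.
apply: cvgM; last by apply: cvgV; [rewrite gt_eqF|exact: cvg_id].
apply: cvgD; first by apply: cvgM; [exact: cvg_cst|exact: continuous_Kprim].
case: l => [|l]; first exact: cvg_cst.
apply: cvgM; first exact: cvg_cst.
apply: (@cvg_comp _ _ _ (fun y : R => y - 1) (Kprim l kap) _ (nbhs (u - 1))).
  by apply: cvgB; [exact: cvg_id|exact: cvg_cst].
by apply: continuous_Kprim; rewrite ltrBrDr addNr.
Qed.

Lemma is_derive_Kprim l kap (u : R) : 0 < u -> is_derive u 1 (Kprim l kap) (Kr l kap u).
Proof.
move=> u0; have u1 : -1 < u by rewrite (lt_trans _ u0)// ltrN10.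
have uu : u < u + 1 by rewrite ltrDl.
have [du <-] := continuous_FTC1_closed uu (integrable_Kr l kap (-1) (u + 1)) u1
  (@continuous_Kr l kap u u0).
exact: derivable_is_derive1.
Qed.

(** Differentiating [u K = (kap+1) Kprim + ...] turns [kap+1] into [kap]. The condition [u > 1]
    keeps [u - 1] inside the range where the primitive is differentiable; K itself jumps at 0 when
    [l = kap = 0]. *)
Lemma is_derive_Kr l kap (u : R) : 1 < u ->
  is_derive u 1 (Kr l.+1 kap) ((kap%:R * Kr l.+1 kap u + l.+1%:R * Kr l kap (u - 1)) / u).
Proof.
move=> u1; have u0 : 0 < u by exact: lt_trans u1.
have un : u != 0 by rewrite gt_eqF.
pose F y := (kap.+1%:R * Kprim l.+1 kap y + l.+1%:R * Kprim l kap (y + (-1))) * y^-1.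
have u10 : 0 < u + (-1) by rewrite subr_gt0.
have dF := is_derive_mulf (is_derive_addf
    (is_derive_scalef kap.+1%:R (is_derive_Kprim l.+1 kap u0))
    (is_derive_scalef l.+1%:R (@is_derive_compf R (Kprim l kap) (fun y => y + (-1)) u _ _ (is_derive_Kprim l kap u10)
       (is_derive_addf (is_derive_idf u) (is_derive_constf (-1) u)))))
  (is_derive_invf un (is_derive_idf u)).
have FK : \forall y \near u, F y = Kr l.+1 kap y.
  by apply: filterS (lt_nbhsr u0) => y y0; rewrite Kr_quot.
have dK : derivable (Kr l.+1 kap) u 1.
  by apply: near_eq_derivable1 FK _; have [] := dF.
apply: is_derive_eqd (derivable_is_derive1 dK) _.
rewrite -(nbhs_singleton (near_eq_derive1 FK)) (is_derive_derive1 dF).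
have := Kr_ode l.+1 kap u => /= ode.
rewrite -ode -natr1; field.
exact: un.
Qed.

(** * Laplace transform of K and the exponential integral *)

Local Open Scope ereal_scope.

(** The exponential integral [E_1(s)], that is the Laplace transform of [1/t] on [[1, oo[]. *)
Definition eE1 (s : R) : \bar R := \int[mu]_(t in ge1) (t^-1 * expR (- (s * t)))%:E.

Definition eLapK l kap (s : R) : \bar R :=
  \int[mu]_v ((expR (- (s * v)))%:E * Kint l kap v).

Lemma measurable_expRN (s : R) (D : set R) : measurable_fun D (fun v : R => expR (- (s * v))).
Proof.
apply: measurable_funTS; apply: (measurableT_comp (@measurable_expR R)).
by apply: measurableT_comp => //; exact: measurable_funM.
Qed.

Lemma eLapK_ge0 l kap s : 0 <= eLapK l kap s.
Proof. by apply: integral_ge0 => v _; rewrite mule_ge0 ?Kint_ge0// lee_fin expR_ge0. Qed.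

(** K is an iterated convolution with [1/t] on [[1, oo[], which the Laplace transform turns into a
    product. *)
Lemma eLapKS l kap s : eLapK l.+1 kap s = eE1 s * eLapK l kap s.
Proof.
rewrite /eLapK integral_KintS; last 2 first.
- by apply/measurable_EFinP; exact: measurable_expRN.
- by move=> x; rewrite lee_fin expR_ge0.
rewrite -ge0_integralZr; last 4 first.
- exact: measurable_ge1.
- apply/measurable_EFinP; apply: measurable_funM; first exact: measurable_funV_ge1.
  exact: measurable_expRN.
- by move=> t t1; rewrite lee_fin mulr_ge0 ?expR_ge0 ?invr_ge0 ?(le_trans ler01).
- exact: eLapK_ge0.
apply: eq_integral => t /[!inE] t1; rewrite EFinM -muleA; congr (_ * _).
rewrite -ge0_integralZl//; last 2 first.
- apply: emeasurable_funM; last exact: measurable_Kint.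
  by apply/measurable_EFinP; exact: measurable_expRN.
- by move=> v _; rewrite mule_ge0 ?Kint_ge0// lee_fin expR_ge0.
apply: eq_integral => v _; rewrite muleA -EFinM -expRD.
by congr ((expR _)%:E * _); ring.
Qed.

Lemma eLapK0 kap s : eLapK 0 kap s = eLap s kap.+1%:R.
Proof.
rewrite /eLapK /eLap pos_itv integral_itv_obnd_cbnd; last exact: measurable_eLap.
rewrite [RHS]integral_mkcond; apply: eq_integral => v _.
rewrite patchE mem_setE/= in_itv/= andbT; case: ifPn => v0; last by rewrite mule0.
by rewrite -EFinM mulrC -natr1 addrK powR_mulrn.
Qed.

Lemma integral_invr (y : R) : (1 <= y)%R ->
  \int[mu]_(t in `[1%R, y]) (t^-1)%:E = (ln y)%:E.
Proof.
rewrite le_eqVlt => /predU1P[<-|y1]; first by rewrite set_itv1 integral_set1 ln1.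
have c0 (x : R) : (0 < x)%R -> {for x, continuous (@GRing.inv R)}.
  by move=> x0; apply: inv_continuous; rewrite gt_eqF.
have cl (x : R) : (0 < x)%R -> {for x, continuous (@ln R)} by exact: continuous_ln.
have y0 : (0 < y)%R by exact: lt_trans y1.
rewrite (continuous_FTC2 (F := @ln R) y1).
- by rewrite ln1 sube0.
- apply: continuous_in_subspaceT => x; rewrite inE/= in_itv/= => /andP[x1 _].
  by apply: c0; exact: lt_le_trans x1.
- split.
  + move=> x; rewrite in_itv/= => /andP[x1 _].
    by have [] := is_derive1_ln (lt_trans ltr01 x1).
  + by apply: cvg_at_right_filter; exact: cl.
  + by apply: cvg_at_left_filter; exact: cl.
- move=> x; rewrite in_itv/= => /andP[x1 _].
  exact: is_derive_derive1 (is_derive1_ln (lt_trans ltr01 x1)).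
Qed.

Lemma integral_expRZ_itv (s t : R) : (0 < s)%R ->
  \int[mu]_(y in `[t, +oo[) (s * expR (- (s * y)))%:E = (expR (- (s * t)))%:E.
Proof.
move=> s0; under eq_integral do rewrite EFinM.
rewrite ge0_integralZl//; last 2 first.
- by apply/measurable_EFinP; exact: measurable_expRN.
- by rewrite lee_fin ltW.
by rewrite integral_expR_itv// -EFinM mulrC divfK// gt_eqF.
Qed.

(** Integration by parts through Tonelli: [e^(-st)] is the integral of [s e^(-sy)] over [y >= t],
    and the integral of [1/t] over [[1, y]] is [ln y]. *)
Lemma eE1_ln (s : R) : (0 < s)%R ->
  eE1 s = \int[mu]_(y in ge1) (s * (ln y * expR (- (s * y))))%:E.
Proof.
move=> s0.
pose f (t y : R) : \bar R := step y t * (t^-1 * (s * expR (- (s * y))))%:E.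
have V0 (t : R) : ge1 t -> (0 <= t^-1)%R by move=> t1; rewrite invr_ge0 (le_trans ler01).
transitivity (\int[mu]_(t in ge1) \int[mu]_(y in ge1) f t y).
  apply: eq_integral => t /[!inE] t1.
  rewrite EFinM -(integral_expRZ_itv _ s0) -ge0_integralZl//; last 3 first.
  - by apply/measurable_EFinP; apply: measurable_funM => //; exact: measurable_expRN.
  - by move=> y _; rewrite lee_fin mulr_ge0 ?expR_ge0// ltW.
  - by rewrite lee_fin V0.
  rewrite integral_mkcond [RHS]integral_mkcond; apply: eq_integral => y _.
  rewrite !patchE /f /step mem_setE/= in_itv/= andbT.
  rewrite (_ : (y \in ge1) = (1 <= y)%R); last by apply/idP/idP; rewrite inE.
  case: ifPn => [ty|_]; last by rewrite mul0e; case: ifP.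
  by rewrite (le_trans t1 ty) mul1e EFinM.
rewrite (tonelli_rect (@measurable_ge1 R) (@measurable_ge1 R)); last 2 first.
- apply: emeasurable_funM.
    by apply: measurable_funTS; apply: measurable_fun_ifT => //; exact: measurable_fun_ler.
  apply/measurable_EFinP; apply: measurable_funM.
    apply: (measurable_comp (F := ge1)); [exact: measurable_ge1| |exact: measurable_funV_ge1|exact: measurable_funTS].
    by move=> _ /= [z [Bz _] <-].
  apply: measurable_funM => //.
  apply: measurable_funTS; apply: (measurableT_comp (@measurable_expR R)).
  by apply: measurableT_comp => //; apply: measurable_funM => //; exact: measurable_snd.
- move=> t y t1 _; rewrite mule_ge0 ?step_ge0// lee_fin !mulr_ge0 ?expR_ge0 ?V0//.
  exact: ltW.
apply: eq_integral => y /[!inE] y1.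
rewrite mulrCA EFinM -(integral_invr y1) -ge0_integralZr//; last 3 first.
- apply: (measurable_funS (E := ge1)); [exact: measurable_ge1| |].
    by move=> t /=; rewrite in_itv/= => /andP[].
  by apply/measurable_EFinP; exact: measurable_funV_ge1.
- by move=> t /=; rewrite in_itv/= => /andP[t1 _]; rewrite lee_fin V0.
- by rewrite lee_fin mulr_ge0 ?expR_ge0// ltW.
rewrite [LHS]integral_mkcond [RHS]integral_mkcond; apply: eq_integral => t _.
rewrite !patchE /f /step.
rewrite (_ : (t \in ge1) = (1 <= t)%R); last by apply/idP/idP; rewrite inE.
rewrite mem_setE/= in_itv/=.
case: (lerP 1 t) => t1 //=; case: ifPn => _; last by rewrite mul0e.
by rewrite mul1e -EFinM.
Qed.

Local Close Scope ereal_scope.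

(** The form of [E_1(s)] given by [eE1_ln], chosen because its integrand is the one of [Lap1_ln]. *)
Definition rE1 (s : R) : R := Rintegral mu (ge1) (fun y => s * lapk s 1 1 y).

Lemma rE1E s : 0 < s -> eE1 s = (rE1 s)%:E.
Proof.
move=> s0; have i1 := integrable_lapkZ s 1 s0 ltr01.
rewrite /rE1 /Rintegral fineK.
  rewrite eE1_ln//; apply: eq_integral => y _.
  by rewrite /lapk subrr powRr0 mul1r expr1.
apply: integrable_fin_num; first exact: measurable_ge1.
apply: (integrableS _ _ _ (integrable_lapkZ s 1 s0 ltr01)).
- exact: measurable_pos.
- exact: measurable_ge1.
- by move=> t; exact: lt_le_trans.
Qed.

(** The difference with [Lap1_ln] is the integral of [s ln t e^(-st)] over []0, 1[]. There
    [|ln t| <= 2C t^(-1/2)], so it is at most [2C s s^(-1/2) Gamma(1/2)]. Any positive power of s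
    would serve later. *)
Lemma rE1_asymp : exists2 C : R, 0 <= C & forall s, 0 < s ->
  `|rE1 s - (- euler_gamma R - ln s)| <= C * s `^ 2^-1.
Proof.
have h0 : 0 < 2^-1 :> R by rewrite invr_gt0.
have [C C0 Cle] := @ln_pow_bound R 1 2^-1 h0.
exists (2 * C * Gamma 2^-1) => [|s s0].
  by rewrite !mulr_ge0// Gamma_eLap fine_ge0// eLap_ge0.
rewrite -Lap1_ln// LapZ//.
have pU : pos = (ge1 `|` `]0, 1[%classic).
  apply/seteqP; split => t; rewrite /pos/= in_itv/=.
    by move=> t0; case: (lerP 1 t) => t1; [left|right; rewrite t0].
  by move=> [|/andP[]//]; exact: lt_le_trans.
have iZ i x : 0 < x -> mu.-integrable pos (EFin \o (fun t => s * lapk s x i t)).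
  by move=> x0; exact: integrable_lapkZ.
have m1 : measurable (`]0, 1[%classic : set (measurableTypeR R)) by [].
have s1 : `]0, 1[%classic `<=` pos by rewrite pU; exact: subsetUr.
have i01 : mu.-integrable `]0, 1[ (EFin \o (fun t => s * lapk s 1 1 t)).
  by apply: integrableS (iZ 1%N 1 ltr01) => //; exact: measurable_pos.
rewrite pU Rintegral_setU//=; last 3 first.
- exact: measurable_ge1.
- by rewrite -pU; exact: iZ.
- apply/disj_setPS => t [/= t1]; rewrite in_itv/= => /andP[_].
  by rewrite ltNge; move: t1; rewrite /ge1/= => ->.
rewrite opprD addNKr normrN.
apply: (le_trans (le_normr_Rintegral m1 i01)).
pose h t := 2 * C * s * lapk s 2^-1 0 t.
have ih : mu.-integrable pos (EFin \o h) by exact: integrable_lapkZ.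
apply: (@le_trans _ _ (Rintegral mu `]0, 1[ h)).
  apply: le_Rintegral => //.
  - by have := integrable_abse i01; apply: eq_integrable.
  - by apply: integrableS ih => //; exact: measurable_pos.
  move=> t; rewrite /= in_itv/= => /andP[t0 t1].
  rewrite /h /lapk subrr powRr0 mul1r !expr1 expr0 mulr1 !normrM.
  rewrite (ger0_norm (ltW s0)) (ger0_norm (expR_ge0 _)) !mulrA.
  apply: ler_wpM2r; first exact: expR_ge0.
  rewrite [_ * s]mulrC -!mulrA; apply: ler_wpM2l; first exact: ltW.
  have := Cle t t0; rewrite expr1 => /le_trans; apply.
  rewrite mulrCA; apply: ler_wpM2l => //.
  rewrite (_ : 2^-1 - 1 = - 2^-1 :> R); last by field.
  rewrite mulr_natl mulr2n lerD2r; apply: ger_powR; first by rewrite t0 ltW.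
  by rewrite ge0_cp.
apply: (@le_trans _ _ (Rintegral mu pos h)).
  rewrite pU Rintegral_setU//=; last 3 first.
  - exact: measurable_ge1.
  - by rewrite -pU.
  - apply/disj_setPS => t [/= t1]; rewrite in_itv/= => /andP[_].
    by rewrite ltNge; move: t1; rewrite /ge1/= => ->.
  rewrite lerDr; apply: Rintegral_ge0 => t _.
  by rewrite /h mulr_ge0 ?lapk_ge0// mulr_ge0 ?(ltW s0)// mulr_ge0.
rewrite -LapZ// Lap_scale// powRN.
rewrite (_ : 2 * C * s * _ = 2 * C * Gamma 2^-1 * (s / s `^ 2^-1)); last by ring.
apply: ler_wpM2l; first by rewrite !mulr_ge0// Gamma_eLap fine_ge0// eLap_ge0.
rewrite ler_pdivrMr ?powR_gt0// -powRD; last by rewrite (gt_eqF s0) implybT.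
have -> : 2^-1 + 2^-1 = 1 :> R by field.
by rewrite (powRr1 (ltW s0)).
Qed.

Lemma eLapKE l kap s : 0 < s ->
  eLapK l kap s = (rE1 s ^+ l * (kap`!%:R * s `^ (- kap.+1%:R)))%:E.
Proof.
move=> s0; elim: l => [|l IH].
  rewrite eLapK0 -[LHS]fineK; last by rewrite ge0_fin_numE ?eLap_ge0 ?eLap_lty.
  by rewrite -LapE Lap_scale// Gamma_nat expr0 mul1r mulrC.
by rewrite eLapKS IH (rE1E s0) -EFinM; congr EFin; rewrite exprS; ring.
Qed.

End kint_real.

(** * Vanishing of the integration constant *)

Section elementary.
Variable R : realType.

Lemma powr_ge1_split (u a b : R) : 0 < u -> u `^ (a + b) = u `^ a * u `^ b.
Proof. by move=> u0; rewrite powRD// (gt_eqF u0) implybT. Qed.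

Lemma ln_le_powR k (e : R) : 0 < e -> exists2 C : R, 0 <= C &
  forall u, 1 <= u -> (1 + ln u) ^+ k <= C * u `^ e.
Proof.
move=> e0; exists (k`!%:R / e ^+ k * expR e) => [|u u1].
  by rewrite mulr_ge0 ?expR_ge0// divr_ge0// exprn_ge0// ltW.
have u0 : 0 < u by exact: lt_le_trans u1.
have l0 : 0 <= 1 + ln u by rewrite (le_trans ler01)// ltr01_ln.
have el0 : 0 <= e * (1 + ln u) by rewrite mulr_ge0// ltW.
have := pow_le_expR k el0.
rewrite exprMn mulrDr mulr1 expRD -powRE//.
rewrite ler_pdivrMr ?ltr0n ?fact_gt0// mulrC -ler_pdivlMr ?exprn_gt0//.
by move/le_trans; apply; rewrite le_eqVlt; apply/orP; left; apply/eqP; ring.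
Qed.

Lemma powRN_bound_eq0 (c C e : R) : 0 < e ->
  (forall u, 1 <= u -> `|c| <= C * u `^ (- e)) -> c = 0.
Proof.
move=> e0 cle; apply/eqP; apply: contraT => c0; exfalso.
have cp : 0 < `|c| by rewrite normr_gt0.
have C0 : 0 <= C by have := cle 1 (lexx _); rewrite powR1 mulr1; exact: le_trans.
(* At [u = v^(1/e)] the hypothesis would give [|c| v <= C], although [|c| v = C + |c|]. *)
pose v := C / `|c| + 1.
have v1 : 1 <= v by rewrite lerDr divr_ge0.
have v0 : 0 < v by exact: lt_le_trans v1.
have u1 : 1 <= v `^ e^-1.
  by rewrite -(powRr0 v); apply: ler_powR => //; rewrite invr_ge0 ltW.
have := cle _ u1; rewrite -powRrM mulrN mulVf ?gt_eqF// powRN (powRr1 (ltW v0)).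
rewrite ler_pdivlMr// mulrDr mulr1 mulrC divfK ?gt_eqF//; lra.
Qed.

Lemma is_derive_invX k (u : R) : 0 < u ->
  is_derive u 1 (fun y => (y ^+ k)^-1) (- (k%:R / u ^+ k.+1)).
Proof.
move=> u0; case: k => [|k].
  rewrite mul0r oppr0 (_ : (fun y => _) = fun=> 1); first exact: is_derive_constf.
  by apply/funext => y; rewrite expr0 invr1.
have uk : u ^+ k.+1 != 0 by rewrite expf_neq0// gt_eqF.
apply: is_derive_eqd
  (@is_derive_invf R (fun y => y ^+ k.+1) u _ uk (is_derive_expf k (is_derive_idf u))) _.
rewrite mulr1 !exprS; field.
by rewrite expf_neq0 ?gt_eqF.
Qed.

(* If |f'| <= C a / u^(a+1) then f - C/u^a increases below the decreasing f + C/u^a,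
   so the supremum of the former is the limit. *)
Lemma limit_of_derive_bound (f df : R -> R) (A C : R) (a : nat) : 1 <= A -> 0 <= C ->
  (forall u, A <= u -> is_derive u 1 f (df u)) ->
  (forall u, A <= u -> `|df u| <= C * a%:R / u ^+ a.+1) ->
  exists c : R, forall u, A <= u -> `|f u - c| <= C / u ^+ a.
Proof.
move=> A1 C0 dfP dfC.
have pos u : A <= u -> 0 < u by move=> Au; rewrite (lt_le_trans ltr01)// (le_trans A1).
pose w (u : R) := C * (u ^+ a)^-1.
have dw u : A <= u -> is_derive u 1 w (- (C * a%:R / u ^+ a.+1)).
  move=> /pos u0; apply: is_derive_eqd (is_derive_scalef C (is_derive_invX a u0)) _.
  by rewrite mulrN mulrA.
have mono (h dh : R -> R) : (forall u, A <= u -> is_derive u 1 h (dh u)) ->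
    (forall u, A <= u -> 0 <= dh u) -> forall x y, A <= x -> x <= y -> h x <= h y.
  move=> dhP dh0 x y Ax xy.
  have [||c cxy E] := @MVT_segment R h dh x y xy.
  - by move=> z; rewrite in_itv/= => /andP[xz _]; apply: dhP; rewrite (le_trans Ax)// ltW.
  - apply: derivable_within_continuous => z; rewrite in_itv/= => /andP[xz _].
    by have [] := dhP z (le_trans Ax xz).
  rewrite -subr_ge0 E mulr_ge0 ?subr_ge0//; apply: dh0.
  by move: cxy; rewrite in_itv/= => /andP[xc _]; exact: le_trans xc.
have up x y : A <= x -> x <= y -> f x - w x <= f y - w y.
  apply: (mono (fun u => f u - w u) (fun u => df u + C * a%:R / u ^+ a.+1)) => u Au.
    have H := is_derive_addf (dfP u Au) (is_derive_scalef (-1) (dw u Au)).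
    rewrite (_ : (fun u => _) = (fun y => f y + -1 * w y)); last by apply/funext => z; rewrite mulN1r.
    by apply: is_derive_eqd H _; rewrite mulN1r opprK.
  by have := dfC u Au; rewrite ler_norml => /andP[+ _]; rewrite -subr_ge0 opprK addrC.
have down x y : A <= x -> x <= y -> f y + w y <= f x + w x.
  move=> Ax xy; rewrite -lerN2.
  apply: (mono (fun u => - (f u + w u)) (fun u => - (df u - C * a%:R / u ^+ a.+1))) Ax xy => u Au.
    have H := is_derive_scalef (-1) (is_derive_addf (dfP u Au) (dw u Au)).
    rewrite (_ : (fun u => _) = (fun y => -1 * (f y + w y))); last by apply/funext => z; rewrite mulN1r.
    by apply: is_derive_eqd H _; rewrite mulN1r.
  by have := dfC u Au; rewrite ler_norml => /andP[_]; rewrite oppr_ge0 subr_le0.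
have w0 u : A <= u -> 0 <= w u by move=> /pos u0; rewrite divr_ge0// exprn_ge0// ltW.
have sandwich x y : A <= x -> A <= y -> f x - w x <= f y + w y.
  move=> Ax Ay; case: (leP x y) => [xy|/ltW yx].
    by have := up x y Ax xy; have := w0 y Ay; lra.
  by have := down y x Ay yx; have := w0 x Ax; lra.
pose S := [set f x - w x | x in [set x | A <= x]].
have S0 : S !=set0 by exists (f A - w A); exists A => /=.
have Sub y : A <= y -> ubound S (f y + w y).
  by move=> Ay _ [x /= Ax <-]; exact: sandwich.
have hS : has_ubound S by exists (f A + w A); exact: Sub.
exists (sup S) => u Au; rewrite -/(w u) ler_norml.
have lo : f u - w u <= sup S by apply: ub_le_sup => //; exists u.
have hi : sup S <= f u + w u by apply: sup_le_ub => //; exact: Sub.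
by apply/andP; split; lra.
Qed.

(** On [[A, B]] the ratio [M/d] takes the place of the constant; this brings a bound for [u >= 2]
    back to [u >= 1]. *)
Lemma dominated_extend (A B : R) (f g : R -> R) (M d : R) : 0 < d -> 0 <= M ->
  (forall u, A <= u -> 0 <= g u) ->
  (forall u, A <= u <= B -> `|f u| <= M /\ d <= g u) ->
  dominated B f g -> dominated A f g.
Proof.
move=> d0 M0 g0 fM [C C0 fC]; exists (C + M / d).
  by rewrite addr_ge0 ?divr_ge0// ltW.
move=> u Au; rewrite mulrDl; have [uB|Bu] := leP u B.
  have [fu gu] := fM u (introT andP (conj Au uB)).
  apply: (le_trans fu); apply: ler_wpDl; first by rewrite mulr_ge0// g0.
  by rewrite mulrAC ler_pdivlMr// ler_wpM2l.
apply: (le_trans (fC u (ltW Bu))); rewrite lerDl mulr_ge0 ?g0//.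
by apply: divr_ge0 => //; exact: ltW.
Qed.

End elementary.

(** * Comparison of Laplace transforms near 0 *)

Section constant.
Variable R : realType.
Notation mu := (@lebesgue_measure R).
Local Notation pos := (@pos R).
Implicit Types (s u : R).

Lemma Rintegral_Kr l kap s : 0 < s ->
  mu.-integrable pos (EFin \o (fun u => Kr l kap u * expR (- (s * u)))) /\
  Rintegral mu pos (fun u => Kr l kap u * expR (- (s * u))) =
  rE1 s ^+ l * (kap`!%:R * s `^ (- kap.+1%:R)).
Proof.
move=> s0.
have mK (D : set R) : measurable_fun D (fun u => (expR (- (s * u)))%:E * Kint l kap u)%E.
  apply: measurable_funTS; apply: emeasurable_funM; last exact: measurable_Kint.
  by apply/measurable_EFinP; exact: measurable_expRN.
have E : (\int[mu]_(u in pos) ((expR (- (s * u)))%:E * Kint l kap u) = eLapK l kap s)%E.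
  rewrite pos_itv integral_itv_obnd_cbnd; last exact: mK.
  rewrite integral_mkcond; apply: eq_integral => v _.
  rewrite patchE mem_setE/= in_itv/= andbT; case: ifPn => //.
  by rewrite -ltNge => v0; rewrite Kint_lt0// mule0.
have fE : EFin \o (fun u => Kr l kap u * expR (- (s * u))) =
    (fun u => (expR (- (s * u)))%:E * Kint l kap u)%E.
  by apply/funext => u; rewrite -KrE -EFinM/= mulrC.
split; last first.
  have -> : Rintegral mu pos (fun u => Kr l kap u * expR (- (s * u))) = fine (eLapK l kap s).
    by rewrite /Rintegral -E; congr fine; apply: eq_integral => u _; rewrite -KrE -EFinM mulrC.
  by rewrite eLapKE.
rewrite fE; apply/integrableP; split; first exact: mK.
under eq_integral do rewrite gee0_abs ?mule_ge0 ?Kint_ge0 ?lee_fin ?expR_ge0//.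
by rewrite E eLapKE// ltry.
Qed.

Lemma Rintegral_sum n (D : set (measurableTypeR R)) (f : 'I_n -> R -> R) : measurable D ->
  (forall i, mu.-integrable D (EFin \o f i)) ->
  mu.-integrable D (EFin \o (fun u => \sum_(i < n) f i u)) /\
  Rintegral mu D (fun u => \sum_(i < n) f i u) = \sum_(i < n) Rintegral mu D (f i).
Proof.
move=> mD; elim: n f => [|n IH] f fi.
  rewrite (_ : (fun u => _) = cst 0); last by apply/funext => u; rewrite big_ord0.
  rewrite big_ord0; split; first by apply: eq_integrable (integrable0 _ _) => //.
  by rewrite /Rintegral integral0_eq.
have [iS ES] := IH (fun i => f (widen_ord (leqnSn n) i)) (fun i => fi _).
rewrite (_ : (fun u => _) =
   (fun u => \sum_(i < n) f (widen_ord (leqnSn n) i) u + f ord_max u)); last first.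
  by apply/funext => u; rewrite big_ord_recr.
split; first exact: (integrableD mD iS (fi ord_max)).
by rewrite RintegralD// big_ord_recr/= ES.
Qed.

Definition main_poly kap l u : R := u ^+ kap * logpoly (logcoef R kap) l u.

Lemma Rintegral_main_poly l kap s : 0 < s ->
  mu.-integrable pos (EFin \o (fun u => main_poly kap l u * expR (- (s * u)))) /\
  Rintegral mu pos (fun u => main_poly kap l u * expR (- (s * u))) =
  s `^ (- kap.+1%:R) * ((- euler_gamma R - ln s) ^+ l / l`!%:R).
Proof.
move=> s0; have k0 : 0 < kap.+1%:R :> R by rewrite ltr0n.
have mp := @measurable_pos R.
pose f (r : 'I_l.+1) u := (logcoef R kap r / (l - r)`!%:R) * lapk s kap.+1%:R (l - r) u.
have [iS ES] := @Rintegral_sum l.+1 pos f mp (fun r => integrable_lapkZ _ _ s0 k0).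
have fE : {in pos, (fun u => \sum_(r < l.+1) f r u) =1 (fun u => main_poly kap l u * expR (- (s * u)))}.
  move=> u /[!inE] u0; rewrite /main_poly /logpoly mulr_sumr mulr_suml.
  apply: eq_bigr => r _; rewrite /f /lapk /logpow -natr1 addrK powR_mulrn; last exact: ltW.
  by ring.
split.
  by apply: eq_integrable iS => // u pu; rewrite /= fE.
transitivity (Rintegral mu pos (fun u => \sum_(r < l.+1) f r u)).
  by apply: eq_Rintegral => u pu; rewrite fE.
rewrite ES.
(* The signs of [logcoef] and those in [sum_Ccoef_Lap] combine to [(-1)^l], which changes
   [gamma + ln s] into [- gamma - ln s]. *)
transitivity ((-1) ^+ l * (s `^ (- kap.+1%:R) * ((euler_gamma R + ln s) ^+ l / l`!%:R))).
  rewrite -(sum_Ccoef_Lap kap l s0) mulr_sumr; apply: eq_bigr => r _.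
  rewrite -LapZ// /logcoef.
  have -> : (-1) ^+ l = (-1) ^+ r * (-1) ^+ (l - r) :> R.
    by rewrite -exprD subnKC// -ltnS.
  have e1 : (-1) ^+ (l - r) * (-1) ^+ (l - r) = 1 :> R.
    by rewrite -exprMn mulrNN mulr1 expr1n.
  transitivity ((-1) ^+ r * Ccoef R r kap / (l - r)`!%:R * Lap s (l - r) kap.+1%:R
    * ((-1) ^+ (l - r) * (-1) ^+ (l - r))); first by rewrite e1 mulr1.
  by ring.
have -> : - euler_gamma R - ln s = -1 * (euler_gamma R + ln s) by ring.
rewrite exprMn; ring.
Qed.

Lemma main_term_low kap N l : dominated 1
  (fun u => main_term kap N l u - main_term kap 0 l u)
  (fun u => (1 + ln u) ^+ l * (u ^+ kap / u)).
Proof.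
elim: N => [|N IH].
  by exists 0 => // u u1; rewrite subrr normr0 mul0r.
apply: (@dominated_ext _ _ (fun u => (main_term kap N.+1 l u - main_term kap N l u) +
   (main_term kap N l u - main_term kap 0 l u))).
  by move=> u _; rewrite addrA subrK.
apply: dominatedD => //.
refine (dominated_le ler01 _ (@main_termS_dominated R kap N l)).
move=> u u1; have u0 : 0 < u by exact: lt_le_trans u1.
rewrite mul1r; apply: ler_wpM2l.
  by rewrite exprn_ge0// (le_trans ler01)// ltr01_ln.
apply: ler_wpM2l; first by rewrite exprn_ge0// ltW.
by rewrite lef_pV2 ?posrE ?exprn_gt0// exprS ler_peMr ?exprn_ege1// ltW.
Qed.

(** Only the order [n = 0] of the main term is subtracted, since its transform is known exactly; the
    other orders count as error. *)
Definition remainder kap l c u : R :=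
  Kfun l kap u - kap`!%:R * main_poly kap l u - c * u ^+ kap.

(** The exponent is [kap - 1/2]: above [kap - 1], which absorbs the logarithms of the orders
    [n >= 1], and below [kap], which makes the transform negligible against [s^(-kap-1)]. *)
Lemma remainder_large kap N l c :
  dominated 2 (fun u => Kfun l kap u - main_term kap N l u - c * u ^+ kap) (fun u => u^-1) ->
  dominated 2 (remainder kap l c) (fun u => u `^ (kap%:R + 2^-1 - 1)).
Proof.
move=> H; have h0 : 0 < 2^-1 :> R by rewrite invr_gt0.
apply: (@dominated_ext _ _ (fun u => (Kfun l kap u - main_term kap N l u - c * u ^+ kap) +
   (main_term kap N l u - main_term kap 0 l u))).
  by move=> u _; rewrite /remainder -main_term0; ring.
apply: dominatedD.
  apply: (@dominated_le R 2 _ (fun u => u^-1) _ 1 ler01 _ H) => u u2.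
  have u0 : 0 < u by exact: lt_le_trans u2.
  rewrite mul1r -(powR_inv1 (ltW u0)); apply: ler_powR; first by lra.
  by have := ler0n R kap; lra.
have [C C0 Cle] := ln_le_powR l h0.
have le12 : 1 <= 2 :> R by rewrite ler1n.
apply: (dominated_le C0 _ (dominatedW le12 (main_term_low kap N l))) => u u2.
have u1 : 1 <= u by lra.
have u0 : 0 < u by lra.
have -> : kap%:R + 2^-1 - 1 = 2^-1 + (kap%:R + -1) :> R by ring.
rewrite !powr_ge1_split// (powR_mulrn _ (ltW u0)) (powR_inv1 (ltW u0)) [leRHS]mulrA.
apply: ler_wpM2r; last exact: Cle.
by apply: divr_ge0; [apply: exprn_ge0|]; exact: ltW.
Qed.

(** With [v = 1/u >= 1/2] the behaviour at 0 becomes a domination on a half-line. After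
    multiplication by [v^kap], K and [c u^kap] are bounded, and the powers of the logarithm are
    [O(v^(1/2))]. *)
Lemma remainder_small kap l c : exists2 C : R, 0 <= C &
  forall u, 0 < u <= 2 -> `|remainder kap l c u| <= C * u `^ (kap%:R + 2^-1 - 1).
Proof.
have h0 : 0 < 2^-1 :> R by rewrite invr_gt0.
have h1 : 2^-1 <= 1 :> R by lra.
have half (v : R) : 2^-1 <= v -> 2^-1 <= v `^ 2^-1.
  move=> v2; have v0 : 0 < v by exact: lt_le_trans v2.
  apply: (@le_trans _ _ (2^-1 `^ 2^-1)); last first.
    by apply: ge0_ler_powR; rewrite ?nnegrE// ltW.
  rewrite -{1}[2^-1]powRr1; last exact: ltW.
  by apply: ger_powR => //; rewrite h0 h1.
have one : dominated (2^-1 : R) (fun=> 1) (fun v => v `^ 2^-1).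
  exists 2 => // v v2; rewrite normr1; have := half v v2; lra.
have bounded M (f : R -> R) : (forall v, 2^-1 <= v -> `|f v| <= M) ->
    dominated 2^-1 f (fun v => v `^ 2^-1).
  move=> fM; have M0 : 0 <= M by exact: le_trans (fM 2^-1 (lexx _)).
  exists (M * 2) => [|v v2]; first by rewrite mulr_ge0.
  apply: (le_trans (fM v v2)); rewrite -mulrA ler_peMr//.
  by have := half v v2; lra.
have lnb m : dominated 2^-1 (fun v : R => ln v^-1 ^+ m) (fun v => v `^ 2^-1).
  have [C C0 Cle] := @ln_pow_bound R m 2^-1 h0.
  exists (C * 3) => [|v v2]; first by rewrite mulr_ge0.
  have v0 : 0 < v by exact: lt_le_trans v2.
  rewrite lnV ?posrE// normrX normrN; apply: (le_trans (Cle v v0)).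
  rewrite -mulrA; apply: ler_wpM2l => //.
  have -> : - 2^-1 = 2^-1 + -1 :> R by field.
  rewrite powr_ge1_split// (powR_inv1 (ltW v0)).
  have vV : v^-1 <= 2 by rewrite -[2]invrK lef_pV2 ?posrE// invr_gt0.
  have := ler_wpM2l (powR_ge0 v 2^-1) vV; lra.
have [C C0 Cle] : dominated 2^-1 (fun v => remainder kap l c v^-1 * v ^+ kap) (fun v => v `^ 2^-1).
  apply: (@dominated_ext _ _ (fun v => Kfun l kap v^-1 * v ^+ kap +
     ((- kap`!%:R) * (\sum_(r < l.+1) (logcoef R kap r / (l - r)`!%:R) * ln v^-1 ^+ (l - r)) + (- c) * 1))).
    move=> v v2; have v0 : 0 < v by exact: lt_le_trans v2.
    have vk : v ^+ kap != 0 by rewrite expf_neq0// gt_eqF.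
    rewrite /remainder /main_poly /logpoly /logpow.
    rewrite (_ : \sum_(r < l.+1) logcoef R kap r / (l - r)`!%:R * ln v^-1 ^+ (l - r) =
      \sum_(r < l.+1) logcoef R kap r * (ln v^-1 ^+ (l - r) / (l - r)`!%:R)).
      by move: (\sum_(r < _) _) => S; rewrite exprVn; field.
    by apply: eq_bigr => r _; ring.
  apply: dominatedD.
    apply: (bounded (2 ^+ l)) => v v2; have v0 : 0 < v by exact: lt_le_trans v2.
    have vi0 : 0 <= v^-1 by rewrite invr_ge0 ltW.
    rewrite normrM (ger0_norm (exprn_ge0 _ (ltW v0))) -ler_pdivlMr ?exprn_gt0//.
    rewrite /Kfun -/(Kr l kap v^-1) normrM normfV normr_nat (ger0_norm (Kr_ge0 _ _ _)).
    rewrite ler_pdivrMr ?ltr0n ?fact_gt0//.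
    apply: (le_trans (Kr_le l kap vi0)); rewrite exprD mulrC -exprVn.
    apply: (@le_trans _ _ (2 ^+ l * v^-1 ^+ kap)); last first.
      by rewrite ler_peMr ?mulr_ge0 ?exprn_ge0// ler1n fact_gt0.
    apply: ler_wpM2r; first by rewrite exprn_ge0.
    rewrite lerXn2r ?nnegrE// -[2]invrK lef_pV2 ?posrE// invr_gt0//.
  apply: dominatedD; last exact: dominatedZ one.
  apply: dominatedZ; apply: dominated_sum => [v _|r]; first exact: powR_ge0.
  exact: dominatedZ.
exists C => // u /andP[u0 u2].
have uV : 2^-1 <= u^-1 by rewrite lef_pV2 ?posrE.
have := Cle u^-1 uV; rewrite invrK normrM.
have uk : 0 <= (u ^+ kap)^-1 by rewrite invr_ge0 exprn_ge0 ?ltW.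
rewrite exprVn (ger0_norm uk) ler_pdivrMr ?exprn_gt0// => /le_trans; apply.
have -> : kap%:R + 2^-1 - 1 = - 2^-1 + kap%:R :> R by field.
rewrite powr_ge1_split// (powR_mulrn _ (ltW u0)) powRN -mulrA.
apply: ler_wpM2l => //; apply: ler_wpM2r; first by rewrite exprn_ge0// ltW.
have -> : u^-1 `^ 2^-1 = u `^ (-1 * 2^-1) by rewrite powRrM (powR_inv1 (ltW u0)).
by rewrite mulN1r powRN.
Qed.

Lemma remainder_bound kap N l c :
  dominated 2 (fun u => Kfun l kap u - main_term kap N l u - c * u ^+ kap) (fun u => u^-1) ->
  exists2 C : R, 0 <= C &
    forall u, 0 < u -> `|remainder kap l c u| <= C * u `^ (kap%:R + 2^-1 - 1).
Proof.
move=> /remainder_large[C C0 Cle]; have [D D0 Dle] := remainder_small kap l c.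
exists (C + D) => [|u u0]; first exact: addr_ge0.
rewrite mulrDl; have [u2|u2] := leP u 2.
  by apply: ler_wpDl; [rewrite mulr_ge0 ?powR_ge0|apply: Dle; rewrite u0].
by apply: ler_wpDr; [rewrite mulr_ge0 ?powR_ge0|apply: Cle; exact: ltW].
Qed.

(** The transform of the remainder multiplied by [s^(kap+1)]; the bound of exponent [kap - 1/2]
    contributes [s^(kap+1) s^(-kap-1/2) = s^(1/2)]. *)
Lemma laplace_remainder kap l c C s : 0 < s ->
  (forall u, 0 < u -> `|remainder kap l c u| <= C * u `^ (kap%:R + 2^-1 - 1)) ->
  `|kap`!%:R / l`!%:R * (rE1 s ^+ l - (- euler_gamma R - ln s) ^+ l) - c * kap`!%:R|
  <= C * Gamma (kap%:R + 2^-1) * s `^ 2^-1.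
Proof.
move=> s0 remC; have mp := @measurable_pos R.
have k0 : 0 < kap.+1%:R :> R by rewrite ltr0n.
have kh : 0 < kap%:R + 2^-1 :> R by rewrite ltr_wpDl// invr_gt0.
have [iK EK] := Rintegral_Kr l kap s0.
have [iQ EQ] := Rintegral_main_poly l kap s0.
pose f1 u := l`!%:R^-1 * (Kr l kap u * expR (- (s * u))).
pose f2 u := (- kap`!%:R) * (main_poly kap l u * expR (- (s * u))).
pose f3 u := (- c) * lapk s kap.+1%:R 0 u.
have i1 : mu.-integrable pos (EFin \o f1) by exact: (integrableZl mp _ iK).
have i2 : mu.-integrable pos (EFin \o f2) by exact: (integrableZl mp _ iQ).
have i3 : mu.-integrable pos (EFin \o f3) by exact: integrable_lapkZ.
have i12 : mu.-integrable pos (EFin \o (fun u => f1 u + f2 u)) by exact: (integrableD mp i1 i2).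
have i123 : mu.-integrable pos (EFin \o (fun u => f1 u + f2 u + f3 u)) by exact: (integrableD mp i12 i3).
have ih : mu.-integrable pos (EFin \o (fun u => C * lapk s (kap%:R + 2^-1) 0 u)).
  exact: integrable_lapkZ.
have val : Rintegral mu pos (fun u => f1 u + f2 u + f3 u) = s `^ (- kap.+1%:R) *
    (kap`!%:R / l`!%:R * (rE1 s ^+ l - (- euler_gamma R - ln s) ^+ l) - c * kap`!%:R).
  rewrite RintegralD// RintegralD// /f1 /f2 /f3 RintegralZl// RintegralZl// EK EQ.
  rewrite -LapZ// Lap_scale// Gamma_nat; ring.
have bnd : `|Rintegral mu pos (fun u => f1 u + f2 u + f3 u)| <=
    C * (s `^ (- (kap%:R + 2^-1)) * Gamma (kap%:R + 2^-1)).
  apply: (le_trans (le_normr_Rintegral mp i123)).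
  rewrite -Lap_scale// LapZ//; apply: le_Rintegral => //.
    by have := integrable_abse i123; apply: eq_integrable.
  move=> u u0; rewrite (_ : f1 u + f2 u + f3 u = remainder kap l c u * expR (- (s * u))).
    rewrite normrM (ger0_norm (expR_ge0 _)) /lapk expr0 mulr1 mulrA.
    by apply: ler_wpM2r; [exact: expR_ge0|exact: remC].
  rewrite /f1 /f2 /f3 /remainder /lapk expr0 -natr1 addrK powR_mulrn; last exact: ltW.
  by rewrite /Kfun -/(Kr l kap u); ring.
have p0 : 0 < s `^ kap.+1%:R by rewrite powR_gt0.
move: bnd; rewrite val normrM (ger0_norm (powR_ge0 _ _)) -(ler_pM2l p0) [leLHS]mulrA -powr_ge1_split//.
rewrite subrr powRr0 mul1r => /le_trans; apply.
rewrite [leLHS](_ : _ = C * Gamma (kap%:R + 2^-1) *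
  (s `^ kap.+1%:R * s `^ (- (kap%:R + 2^-1)))); last by ring.
rewrite -powr_ge1_split//.
by rewrite (_ : kap.+1%:R + - (kap%:R + 2^-1) = 2^-1 :> R)//; rewrite -natr1; field.
Qed.

Lemma rE1_power l : exists2 C : R, 0 <= C & forall u, 1 <= u ->
  `|rE1 u^-1 ^+ l - (- euler_gamma R - ln u^-1) ^+ l| <= C * u `^ (- 4^-1).
Proof.
have [D D0 Dle] := rE1_asymp R.
have q0 : 0 < 4^-1 :> R by rewrite invr_gt0.
have [L L0 Lle] := ln_le_powR l.-1 q0.
(* Both [E_1(1/u)] and [- gamma + ln u] are at most [B (1 + ln u)] in absolute value. In the
   factorisation of the difference of l-th powers, the [l-1] remaining factors cost [u^(1/4)], and
   [-1/2 + 1/4 = -1/4]. *)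
pose B : R := 1 + `|euler_gamma R| + D.
have B0 : 0 <= B by rewrite !addr_ge0.
exists (D * (l%:R * (B ^+ l.-1 * L))) => [|u u1].
  by rewrite !mulr_ge0// exprn_ge0.
have u0 : 0 < u by exact: lt_le_trans u1.
have uV0 : 0 < u^-1 by rewrite invr_gt0.
rewrite lnV ?posrE// opprK.
set x := - euler_gamma R + ln u.
have dle : `|rE1 u^-1 - x| <= D * u `^ (- 2^-1).
  have := Dle _ uV0; rewrite lnV ?posrE// opprK -/x.
  have -> // : u^-1 `^ 2^-1 = u `^ (- 2^-1).
  by rewrite -(powR_inv1 (ltW u0)) -powRrM mulN1r.
have lu : 0 <= ln u by rewrite ln_ge0.
have p1 : u `^ (- 2^-1) <= 1.
  by rewrite -[leRHS](powRr0 u); apply: ler_powR => //; rewrite oppr_le0 invr_ge0.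
have l1 : 1 <= 1 + ln u by exact: ltr01_ln.
have xB : `|x| <= B * (1 + ln u).
  apply: (le_trans (ler_normD _ _)); rewrite normrN (ger0_norm lu).
  have g0 := normr_ge0 (euler_gamma R).
  rewrite /B; nra.
have rB : `|rE1 u^-1| <= B * (1 + ln u).
  rewrite -(subrK x (rE1 u^-1)); apply: (le_trans (ler_normD _ _)).
  have : `|rE1 u^-1 - x| <= D by apply: (le_trans dle); rewrite ler_piMr.
  have : `|x| <= `|euler_gamma R| + ln u.
    by apply: (le_trans (ler_normD _ _)); rewrite normrN (ger0_norm lu).
  have g0 := normr_ge0 (euler_gamma R).
  rewrite /B; nra.
rewrite subrXX normrM.
have -> : u `^ (- 4^-1) = u `^ (- 2^-1) * u `^ 4^-1.
  by rewrite -powr_ge1_split//; congr (_ `^ _); field.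
rewrite [leRHS](_ : _ = (D * u `^ (- 2^-1)) * (l%:R * (B ^+ l.-1 * (L * u `^ 4^-1)))); last by ring.
apply: ler_pM => //.
apply: (le_trans (ler_norm_sum _ _ _)).
apply: (@le_trans _ _ (\sum_(i < l) (B * (1 + ln u)) ^+ l.-1)).
  apply: ler_sum => i _; rewrite normrM !normrX.
  have il : (l.-1 - i + i)%N = l.-1 by rewrite subnK// -ltnS prednK// (leq_trans _ (ltn_ord i)).
  rewrite -{2}il exprD; apply: ler_pM => //; rewrite ?exprn_ge0//.
    by rewrite lerXn2r ?nnegrE// mulr_ge0// (le_trans ler01).
  by rewrite lerXn2r ?nnegrE// mulr_ge0// (le_trans ler01).
rewrite sumr_const card_ord -[_ *+ l]mulr_natl exprMn.
by apply: ler_wpM2l => //; apply: ler_wpM2l; [rewrite exprn_ge0|exact: Lle].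
Qed.

(** Taking [s = 1/u] in [laplace_remainder] gives [c kap! = O(u^(-1/4))]. *)
Lemma constant_eq0 kap N l c :
  dominated 2 (fun u => Kfun l kap u - main_term kap N l u - c * u ^+ kap) (fun u => u^-1) ->
  c = 0.
Proof.
move=> /remainder_bound[C C0 Cle]; have [D D0 Dle] := rE1_power l.
have fk : 0 < kap`!%:R :> R by rewrite ltr0n fact_gt0.
have fl : 0 < l`!%:R :> R by rewrite ltr0n fact_gt0.
have q0 : 0 < 4^-1 :> R by rewrite invr_gt0.
have G0 : 0 <= Gamma (kap%:R + 2^-1) :> R by rewrite Gamma_eLap fine_ge0// eLap_ge0.
suff : c * kap`!%:R = 0 by move/eqP; rewrite mulf_eq0 (gt_eqF fk) orbF => /eqP.
apply: (@powRN_bound_eq0 R _ (kap`!%:R / l`!%:R * D + C * Gamma (kap%:R + 2^-1)) _ q0) => u u1.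
have u0 : 0 < u by exact: lt_le_trans u1.
have uV0 : 0 < u^-1 by rewrite invr_gt0.
have := laplace_remainder uV0 Cle.
set E := kap`!%:R / l`!%:R * _ => H.
have EE : `|E| <= kap`!%:R / l`!%:R * D * u `^ (- 4^-1).
  have q : 0 <= kap`!%:R / l`!%:R :> R by apply: divr_ge0; exact: ltW.
  rewrite /E normrM (ger0_norm q) -[leRHS]mulrA; apply: ler_wpM2l => //.
  exact: Dle.
have p : u^-1 `^ 2^-1 <= u `^ (- 4^-1).
  rewrite -(powR_inv1 (ltW u0)) -powRrM mulN1r; apply: ler_powR => //.
  by rewrite lerN2 lef_pV2 ?posrE// ler_nat.
have CG : C * Gamma (kap%:R + 2^-1) * u^-1 `^ 2^-1 <= C * Gamma (kap%:R + 2^-1) * u `^ (- 4^-1).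
  by apply: ler_wpM2l => //; rewrite mulr_ge0.
have := ler_normB E (E - c * kap`!%:R); rewrite subKr => /le_trans; apply.
rewrite mulrDl; apply: lerD => //; exact: le_trans H CG.
Qed.

End constant.

(** * The induction on l *)

Section induction.
Variable R : realType.
Implicit Types (kap N J l : nat) (u : R).

Local Notation P kap := (@dlp R kap (logcoef R kap)).

Lemma is_derive_Kfun l kap u : 1 < u ->
  is_derive u 1 (Kfun l.+1 kap) ((kap%:R * Kfun l.+1 kap u + Kfun l kap (u - 1)) / u).
Proof.
move=> u1.
have -> : @Kfun R l.+1 kap = fun v => (l.+1`!%:R)^-1 * Kr l.+1 kap v.
  by apply/funext => v; rewrite mulrC.
apply: is_derive_eqd (is_derive_scalef _ (is_derive_Kr l kap u1)) _.
rewrite /Kfun -/(Kr l kap (u - 1)) factS natrM; field.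
by rewrite gt_eqF ?(lt_trans ltr01)//= nat1r !pnatr_eq0 -!lt0n fact_gt0.
Qed.

(** Division by [u^kap] is the integrating factor: it removes the term in [kap] common to the
    equations of K and of the main term. *)
Lemma is_derive_error l kap N u : 1 < u ->
  is_derive u 1 (fun v => (Kfun l.+1 kap v - main_term kap N l.+1 v) * (v ^+ kap)^-1)
    ((Kfun l kap (u - 1) - main_term_shift kap N l u) / u ^+ kap.+1).
Proof.
move=> u1; have u0 : 0 < u by exact: lt_trans u1.
have H := is_derive_mulf (is_derive_addf (is_derive_Kfun l kap u1)
  (is_derive_scalef (-1) (is_derive_main_term kap N l.+1 u0))) (is_derive_invX kap u0).
rewrite (_ : (fun v => _) = (fun v => (Kfun l.+1 kap v + -1 * main_term kap N l.+1 v) / v ^+ kap)).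
  apply: is_derive_eqd H _; rewrite -main_term_ode// exprS; field.
  by rewrite expf_neq0 ?gt_eqF.
by apply/funext => v; rewrite mulN1r.
Qed.

Lemma dominated_shift N f : dominated 1 f (fun u => (u ^+ N)^-1) ->
  dominated 2 (fun u => f (u - 1)) (fun u => (u ^+ N)^-1).
Proof.
move=> [C C0 fC]; exists (C * 2 ^+ N) => [|u u2]; first by rewrite mulr_ge0// exprn_ge0.
have u11 : 1 <= u - 1 :> R by lra.
apply: (le_trans (fC _ u11)); rewrite -mulrA; apply: ler_wpM2l => //.
have u0 : 0 < u :> R by lra.
have v0 : 0 < u - 1 :> R by lra.
rewrite ler_pdivlMr ?exprn_gt0// mulrC ler_pdivrMr ?exprn_gt0// -exprMn.
by apply: lerXn2r; rewrite ?nnegrE ?mulr_ge0 ?(ltW u0) ?(ltW v0)//; lra.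
Qed.

(** The error of degree l at [u - 1] is kept up to a constant. The truncation error of the
    translation is [(1 + ln u)^l / u^(J+2)], and one power of u is spent on the logarithm. *)
Lemma shifted_error l kap J :
  dominated 1 (fun u => Kfun l kap u - main_term kap (kap + J.+1) l u)
    (fun u => (u ^+ J.+1)^-1) ->
  dominated 2 (fun u => Kfun l kap (u - 1) - main_term_shift kap (kap + J.+1) l u)
    (fun u => (u ^+ J.+1)^-1).
Proof.
move=> /dominated_shift H; set N := (kap + J.+1)%N.
apply: (@dominated_ext R 2 (fun u => (Kfun l kap (u - 1) - main_term kap N l (u - 1)) +
  (main_term kap N l (u - 1) - main_term_shift kap N l u))).
  by move=> u _; rewrite addrA subrK.
apply: dominatedD H _; have [C C0 Cle] := expr_1ln_le R l.
refine (dominated_le C0 _ (main_term_shiftP R kap N l)) => u u2.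
have u0 : 0 < u by lra.
have u1 : 1 <= u by lra.
apply: (@le_trans _ _ (C * u * (u ^+ kap / u ^+ N.+1))).
  by apply: ler_wpM2r (Cle u u1); rewrite divr_ge0// exprn_ge0// ltW.
rewrite /N -addnS exprD exprS le_eqVlt; apply/orP; left; apply/eqP; field.
by rewrite !expf_neq0 ?gt_eqF.
Qed.

Lemma main_term_bounded kap N l : exists2 M : R, 0 <= M &
  forall u, 1 <= u <= 2 -> `|main_term kap N l u| <= M.
Proof.
have [C C0 Cle] : dominated 1 (main_term kap N l) (fun u : R => (1 + ln u) ^+ l * (u ^+ kap / u ^+ 0)).
  apply: dominatedZ; apply: dominated_sum => [u u1|m]; first exact: bound_fun_ge0.
  apply: dominated_sum => [u u1|n]; first exact: bound_fun_ge0.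
  apply: dominatedZ; refine (dominated_le ler01 _ (dlp_dominated R kap n (leq_subr m l))) => u u1.
  have u0 : 0 < u by exact: lt_le_trans u1.
  rewrite mul1r; apply: ler_wpM2l; first by rewrite exprn_ge0// (le_trans ler01)// ltr01_ln.
  apply: ler_wpM2l; first by rewrite exprn_ge0// ltW.
  by rewrite lef_pV2 ?posrE ?exprn_gt0// expr0 exprn_ege1.
exists (C * ((1 + ln 2) ^+ l * 2 ^+ kap)) => [|u /andP[u1 u2]].
  by rewrite !mulr_ge0 ?exprn_ge0// addr_ge0// ln_ge0// ler1n.
apply: (le_trans (Cle u u1)); apply: ler_wpM2l => //; rewrite expr0 divr1.
have u0 : 0 < u by exact: lt_le_trans u1.
apply: ler_pM; rewrite ?exprn_ge0 ?(ltW u0) ?(le_trans ler01 (ltr01_ln u1))//.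
  exact: ler_ln_exp.
by apply: lerXn2r; rewrite ?nnegrE ?(ltW u0).
Qed.

Lemma error_bounded kap N l : exists2 M : R, 0 <= M &
  forall u, 1 <= u <= 2 -> `|Kfun l kap u - main_term kap N l u| <= M.
Proof.
have [M M0 Mle] := main_term_bounded kap N l.
exists (2 ^+ (kap + l) + M) => [|u u12]; first by rewrite addr_ge0 ?exprn_ge0.
have /andP[u1 u2] := u12; have u0 : 0 <= u by exact: le_trans u1.
apply: (le_trans (ler_normB _ _)); apply: lerD; last exact: Mle.
rewrite /Kfun -/(Kr l kap u) normrM normfV normr_nat (ger0_norm (Kr_ge0 _ _ _)).
rewrite ler_pdivrMr ?ltr0n ?fact_gt0//; apply: (le_trans (Kr_le l kap u0)).
apply: (@le_trans _ _ (2 ^+ (kap + l))); first by apply: lerXn2r; rewrite ?nnegrE.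
by rewrite ler_peMr ?exprn_ge0// ler1n fact_gt0.
Qed.

Lemma main_term_l0 kap N u : main_term kap N 0 u = u ^+ kap.
Proof.
rewrite /main_term big_ord1 subnn big_ord_recl big1 ?addr0 => [|n _]; last first.
  by rewrite Ecoef_m0 !mul0r.
rewrite Ecoef_m0 fact0 divr1 mul1r /= /logpoly big_ord1 /logcoef /logpow Ccoef_0.
rewrite subnn !expr0 fact0 divr1 mulr1 mul1r mulrCA mulfV ?mulr1//.
Qed.

Theorem Kfun_asymptotics kap l J :
  dominated 1 (fun u => Kfun l kap u - main_term kap (kap + J.+1) l u)
    (fun u => (u ^+ J.+1)^-1).
Proof.
elim: l J => [|l IH] J.
  exists 0 => // u u1.
  by rewrite main_term_l0 /Kfun/= (le_trans ler01 u1)/= fact0 divr1 subrr normr0 mul0r.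
have [C C0 Cle] := shifted_error (IH J).
set N := (kap + J.+1)%N in Cle *.
have N0 : 0 < N%:R :> R by rewrite ltr0n /N addnS.
have le12 : 1 <= 2 :> R by rewrite ler1n.
have CN0 : 0 <= C / N%:R by rewrite divr_ge0// ltW.
have dE u : 2 <= u -> is_derive u 1
    (fun v => (Kfun l.+1 kap v - main_term kap N l.+1 v) * (v ^+ kap)^-1)
    ((Kfun l kap (u - 1) - main_term_shift kap N l u) / u ^+ kap.+1).
  by move=> u2; apply: is_derive_error; lra.
(* The derivative is at most [C / u^(N+1)], since [(J+1) + (kap+1) = N+1]; the constant [C/N] is
   that of its primitive. *)
have [|c cle] := limit_of_derive_bound le12 CN0 dE (a := N).
  move=> u u2; have u0 : 0 < u by lra.
  rewrite normrM normfV (ger0_norm (exprn_ge0 _ (ltW u0))) divfK ?gt_eqF//.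
  rewrite /N -addSn exprD invfM mulrCA mulrC.
  by apply: ler_wpM2l; [rewrite invr_ge0 exprn_ge0// ltW|exact: Cle].
have bnd : dominated 2 (fun u => Kfun l.+1 kap u - main_term kap N l.+1 u - c * u ^+ kap)
    (fun u => (u ^+ J.+1)^-1).
  exists (C / N%:R) => // u u2; have u0 : 0 < u by lra.
  have uk : 0 < u ^+ kap by rewrite exprn_gt0.
  have -> : Kfun l.+1 kap u - main_term kap N l.+1 u - c * u ^+ kap =
      ((Kfun l.+1 kap u - main_term kap N l.+1 u) * (u ^+ kap)^-1 - c) * u ^+ kap.
    by rewrite mulrBl divfK ?gt_eqF.
  rewrite normrM (ger0_norm (ltW uk)) -ler_pdivlMr//.
  by apply: (le_trans (cle u u2)); rewrite /N exprD invfM mulrA mulrAC.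
have c0 : c = 0.
  apply: (@constant_eq0 R kap N l.+1); refine (dominated_le ler01 _ bnd) => u u2.
  have u1 : 1 <= u by lra.
  have u0 : 0 < u by lra.
  by rewrite mul1r lef_pV2 ?posrE ?exprn_gt0// exprS ler_peMr ?exprn_ege1// ltW.
(* The next step of the induction evaluates the error at [u - 1] for [u >= 2], so the interval
   [[1, 2]] has to be recovered. *)
have [M M0 Mle] := error_bounded kap N l.+1.
have d0 : 0 < (2 ^+ J.+1)^-1 :> R by rewrite invr_gt0 exprn_gt0.
apply: (@dominated_extend R 1 2 _ _ M _ d0 M0) => [u u1|u u12|].
- by rewrite invr_ge0 exprn_ge0// (le_trans ler01).
- split; first exact: Mle.
  have /andP[u1 u2] := u12; have u0 : 0 < u by exact: lt_le_trans u1.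
  rewrite lef_pV2 ?posrE ?exprn_gt0//; by apply: lerXn2r; rewrite ?nnegrE ?(ltW u0).
by apply: (dominated_ext _ bnd) => u _; rewrite c0 mul0r subr0.
Qed.

End induction.
Unset Implicit Arguments.
Local Close Scope classical_set_scope.

Theorem theorem2 (R : realType) (kappa J l : nat) (hl : (1 <= l)%N) :
  exists C : R, forall u : R, l%:R <= u ->
    `| Kfun l kappa u
       - (\sum_(0 <= m < l.+1) \sum_(m <= n < kappa.+1) \sum_(0 <= r < (l - m).+1)
            ((-1) ^+ r * (kappa`!)%:R * Ecoef R n m / ((m`!)%:R * ((l - m - r)`!)%:R))
            * Ccoef R r (kappa - n) * u ^+ (kappa - n) * ln u ^+ (l - m - r))
       - (\sum_(1 <= j < J.+1) \sum_(0 <= m < l.+1) \sum_(0 <= r < (l - m).+1)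
            ((-1) ^+ r * (kappa`!)%:R * Ecoef R (kappa + j) m
               / ((m`!)%:R * ((l - m - r)`!)%:R))
            * C0coef R r * derive1n j (fun x : R => ln x ^+ (l - m - r)) u) |
    <= C * (ln (expR 1 * u) ^+ l / u ^+ J.+1).
Proof.
have [C C0 Cle] := Kfun_asymptotics R kappa l J.
have [D D0 Dle] := main_termS_dominated R kappa (kappa + J) l.
exists (C + D) => u ul.
have u1 : 1 <= u by apply: le_trans ul; rewrite ler1n.
have u0 : 0 < u by exact: lt_le_trans u1.
rewrite -addrA -opprD -main_termE// lnM ?posrE ?expR_gt0// expRK.
(* The order [kappa+J+1] is not displayed in the theorem. It has size [(1 + ln u)^l / u^(J+1)] with
   [1 + ln u = ln(eu)], and is the sole source of the logarithm in the error. *)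
have -> : Kfun l kappa u - main_term kappa (kappa + J) l u =
    (Kfun l kappa u - main_term kappa (kappa + J.+1) l u) +
    (main_term kappa (kappa + J).+1 l u - main_term kappa (kappa + J) l u).
  by rewrite addnS addrA subrK.
apply: (le_trans (ler_normD _ _)); rewrite mulrDl; apply: lerD.
  apply: (le_trans (Cle u u1)); apply: ler_wpM2l => //.
  by rewrite ler_peMl ?exprn_ege1 ?ltr01_ln// invr_ge0 exprn_ge0// ltW.
apply: (le_trans (Dle u u1)); apply: ler_wpM2l => //.
rewrite -addnS exprD le_eqVlt; apply/orP; left; apply/eqP; field.
by rewrite !expf_neq0 ?gt_eqF.
Qed.
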